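(* Let $g\in\mathrm{Hol}(\Omega)$ and let $C_g=C_{g,\mathrm{id}}$. If $0<s<\infty$, then $$C_g\in\mathcal S_s(A^2(\Omega))\iff g=0.$$
   Context: $\Omega\subset\mathbb C^n$ ($n\ge1$) is a bounded convex domain with smooth ($C^\infty$) boundary of finite type, with $0\in\Omega$. $\mathrm{Hol}(\Omega)$ is the space of holomorphic functions on $\Omega$, and $A^2(\Omega)=\mathrm{Hol}(\Omega)\cap L^2(\Omega,dv)$ ($dv$ Lebesgue volume). $Rf(z)=\sum_{k=1}^n z_k\partial_kf(z)$. $\mathcal S_s$ is the Schatten class of order $s$. $$C_gf(z)=\int_0^1Rf(tz)\,g(tz)\,\frac{dt}{t}.$$ The operator is first defined for $f$ holomorphic in a neighbourhood of $\overline\Omega$ (a dense subspace of $A^2(\Omega)$); when bounded, the same symbol denotes the unique bounded extension to $A^2(\Omega)$. *)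

(* Defs.v *)
From HB Require Import structures.
From mathcomp Require Import all_boot all_order all_algebra.
From mathcomp Require Import complex.
From mathcomp Require Import all_classical all_reals all_analysis.

Set Implicit Arguments.
Unset Strict Implicit.
Unset Printing Implicit Defensive.

Import Order.TTheory GRing.Theory Num.Theory.
Import numFieldNormedType.Exports.
Import ComplexField.Normc.

Local Open Scope classical_set_scope.
Local Open Scope ring_scope.
Local Open Scope complex_scope.

(* The field R[i] as a normed space over itself. The space C^n is 'rV[R[i]]_n,
   whose library topology is the product one (its norm is the sup norm). *)
#[non_forgetful_inheritance]
HB.instance Definition _ (R : realType) :=
  NormedModule.copy R[i] (R[i] : numFieldType)^o.

Section Volume.
Context (R : realType).

Local Notation line := (measurableTypeR R).
Local Notation plane := (line * line)%type.
Local Notation lambda := (@lebesgue_measure R).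

(* Lebesgue measure lives on tuples of pairs (real part, imaginary part):
   tuples carry the product sigma-algebra, row vectors carry none. *)
Definition toCn n (x : n.-tuple plane) : 'rV[R[i]]_n :=
  \row_k ((tnth x k).1 +i* (tnth x k).2).

Definition consC n (p : n.-tuple plane * line * line) : n.+1.-tuple plane :=
  [tuple of (p.1.2, p.2) :: p.1.1].

Lemma measurable_consC n :
  measurable_fun [set: n.-tuple plane * line * line] (@consC n).
Proof.
apply: measurable_cons.
  apply: measurable_fun_pair => //.
  exact: (measurableT_comp measurable_snd measurable_fst).
exact: (measurableT_comp measurable_fst measurable_fst).
Qed.

Section Step.
Context n (mu : {measure set (n.-tuple plane) -> \bar R}).

Definition volume_step := pushforward ((mu \x lambda) \x lambda)%E (@consC n).

HB.instance Definition _ := Measure.copy volume_step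
  (measure_function_pushforward__canonical__measure_function_Measure
    ((mu \x lambda) \x lambda)%E (@measurable_consC n)).

End Step.

Fixpoint volume n : {measure set (n.-tuple plane) -> \bar R} :=
  match n with
  | 0 => \d_ [tuple]
  | m.+1 => volume_step (volume m)
  end.

End Volume.

Section ComplexIntegral.
Context (R : realType) d (T : measurableType d).

Definition cintegral (mu : {measure set T -> \bar R}) (D : set T)
    (f : T -> R[i]) : R[i] :=
  (\int[mu]_(x in D) complex.Re (f x)) +i* (\int[mu]_(x in D) complex.Im (f x)).

End ComplexIntegral.

Definition holomorphic (R : realType) (V W : normedModType R[i]) (U : set V)
    (f : V -> W) :=
  forall z, U z -> differentiable f z.

(* Real calculus for real-valued functions on a complex normed space, through
   the restrictions to real lines. *)
Section RealCalculus.
Context (R : realType) (V : normedModType R[i]).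
Implicit Types (h : V -> R) (z v : V) (U : set V).

Definition along h z v : R -> R := fun t => h (z + t%:C *: v).

Definition dderiv v h : V -> R := fun z => derive1 (along h z v) 0.

Definition iter_dderiv (vs : seq V) h : V -> R := foldr dderiv h vs.

Definition smooth_on U h := forall vs z, U z ->
  {for z, continuous (iter_dderiv vs h)} /\
  forall v, derivable (along (iter_dderiv vs h) z v) 0 1.

End RealCalculus.

Section FiniteType.
Context (R : realType) (n : nat).
Local Notation Cn := 'rV[R[i]]_n.
Implicit Types (Omega U : set Cn) (p z : Cn) (r : Cn -> R) (gamma : R[i] -> Cn).

Definition boundary Omega := closure Omega `\` interior Omega.

Definition local_defining Omega p U r :=
  [/\ open U, U p, smooth_on U r,
      forall z, U z -> (Omega z <-> r z < 0)
    & exists v, dderiv v r p != 0].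

(* Order of vanishing: the largest m (or +oo) such that all the derivatives
   of order k < m, described by vanish k, are zero. *)
Definition vanishing_order (vanish : nat -> Prop) : \bar R :=
  ereal_sup [set m%:R%:E | m in [set m | forall k, (k < m)%N -> vanish k]].

Definition real_order (h : R[i] -> R) : \bar R :=
  vanishing_order
    (fun k => forall vs : seq R[i], size vs = k -> iter_dderiv vs h 0 = 0).

Definition curve_order p gamma : \bar R :=
  vanishing_order (fun k => derive1n k (fun w => gamma w - p) 0 = 0).

Definition holomorphic_curve p gamma :=
  [/\ \forall w \near 0, differentiable gamma w, gamma 0 = p
    & ~ \forall w \near 0, gamma w = p].

(* D'Angelo's type at p of the hypersurface {r = 0}. A nonconstant curve has a
   finite positive order, so the inverse below is that of a positive real. *)
Definition dangelo_type p r : \bar R :=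
  ereal_sup [set (real_order (r \o gamma) * (curve_order p gamma)^-1)%E
            | gamma in holomorphic_curve p].

Definition smooth_finite_type Omega := forall p, boundary Omega p ->
  exists U r, local_defining Omega p U r /\ (dangelo_type p r < +oo)%E.

(* The field of scalars is R[i], whose elements between 0 and 1 are real. *)
Definition convex Omega := @convex_set R[i] Cn Omega.

End FiniteType.

(* Elements of A^2(Omega) are represented by total functions, of which only
   the values on Omega are relevant: equality is equality on Omega. *)
Section Bergman.
Context (R : realType) (n : nat) (Omega : set 'rV[R[i]]_n).
Local Notation Cn := 'rV[R[i]]_n.
Local Notation OmegaR := (@toCn R n @^-1` Omega).
Implicit Types (f g h : Cn -> R[i]) (T : (Cn -> R[i]) -> (Cn -> R[i])).

Definition bergman f :=
  holomorphic Omega f /\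
  (\int[volume R n]_(x in OmegaR) (normc (f (toCn x)) ^+ 2)%:E < +oo)%E.

Definition inner f h : R[i] :=
  cintegral (volume R n) OmegaR (fun x => f (toCn x) * conjc (h (toCn x))).

Definition L2norm f : R :=
  Num.sqrt (\int[volume R n]_(x in OmegaR) (normc (f (toCn x)) ^+ 2)).

(* Boundedness forces T to respect equality on Omega. *)
Definition bounded_operator T :=
  [/\ forall f, bergman f -> bergman (T f),
      forall (a : R[i]) f h, bergman f -> bergman h ->
        {in Omega, T (fun w => a * f w + h w) =1 (fun z => a * T f z + T h z)}
    & exists M : R, forall f, bergman f -> L2norm (T f) <= M * L2norm f].

(* Families orthonormal on the set of indices where sigma is nonzero. *)
Definition orthonormal_on (sigma : nat -> R) (e : nat -> Cn -> R[i]) :=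
  forall j k, sigma j != 0 -> sigma k != 0 -> inner (e j) (e k) = (j == k)%:R.

(* Canonical decomposition T = \sum_k sigma_k <., e_k> u_k of a compact
   operator; the sigma_k are its singular values, listed in nonincreasing
   order with multiplicity, and followed by zeros when T has finite rank. *)
Definition singular_decomposition T (sigma : nat -> R)
    (e u : nat -> Cn -> R[i]) :=
  [/\ (forall k, 0 <= sigma k) /\ {homo sigma : j k / (j <= k)%N >-> k <= j},
      sigma @ \oo --> 0,
      forall k, bergman (e k) /\ bergman (u k),
      orthonormal_on sigma e /\ orthonormal_on sigma u
    & forall f, bergman f ->
        (fun N => L2norm (fun z =>
           T f z - \sum_(k < N) (sigma k)%:C * inner f (e k) * u k z))
        @ \oo --> 0].

Definition schatten (s : R) T := exists sigma e u,
  singular_decomposition T sigma e u /\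
  (\sum_(0 <= k <oo) ((sigma k) `^ s)%:E < +oo)%E.

Definition radial f : Cn -> R[i] :=
  fun z => \sum_(k < n) z 0 k * 'D_(delta_mx 0 k) f z.

Definition Cop g f : Cn -> R[i] := fun z =>
  cintegral (@lebesgue_measure R) `]0, 1]
    (fun t : R => radial f (t%:C *: z) * g (t%:C *: z) / t%:C).

Definition holomorphic_near_closure f :=
  exists U, [/\ open U, closure Omega `<=` U & holomorphic U f].

(* At most one T up to equality on Omega, since the functions holomorphic near
   the closure are dense in A^2(Omega). *)
Definition bounded_extension g T :=
  bounded_operator T /\
  forall f, holomorphic_near_closure f -> {in Omega, T f =1 Cop g f}.

Definition Cop_in_schatten (s : R) g :=
  exists2 T, bounded_extension g T & schatten s T.

End Bergman.

(* Main.v *)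
From HB Require Import structures.
Require Import Defs.
From mathcomp Require Import all_boot all_order all_algebra.
From mathcomp Require Import complex.
From mathcomp Require Import all_classical all_reals all_analysis.
From mathcomp Require Import measurable_realfun.
From mathcomp Require Import ring lra.
Import Order.TTheory GRing.Theory Num.Theory.
Import numFieldNormedType.Exports.
Import ComplexField.Normc.
Local Open Scope classical_set_scope.
Local Open Scope ring_scope.
Local Open Scope complex_scope.
Set Implicit Arguments.
Unset Strict Implicit.
Unset Printing Implicit Defensive.

(** Let R be the radial derivative. Differentiating the defining integral along
    rays gives R(C_g f) = g R f (Cop_derive): up to R, the operator C_g is the
    multiplication by g. Suppose that g(a) <> 0 for some a <> 0, and restrict to the
    complex line a + w a. If the derivative of f along this line is c w^m + o(w^m)
    as w tends to 0, then that of C_g f is g(a) c w^m + o(w^m) (jet_Cop): C_g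
    multiplies leading coefficients by the nonzero number g(a).

    At each order m the leading coefficient is controlled by the norm of A^2(Omega)
    (jet_bound), so there is a function f_m of norm 1 whose leading coefficient
    kappa_m at the order m is maximal up to a factor (extremal). A function with
    leading coefficient c at the order m then has norm at least |c| / (2 kappa_m).
    For m < m' the difference f_m - f_m' still has leading coefficient kappa_m at
    the order m, since the derivative of f_m' is o(w^m). Hence the norm of
    C_g (f_m - f_m') is at least |g(a)| / 2. So C_g sends a bounded sequence to a
    uniformly separated one, and is not compact; but the operators of a Schatten
    class are compact, as their singular values tend to 0.

    C_g is given by its integral only on functions holomorphic near the closure.
    As Omega is convex, the dilation of center a and factor r < 1 maps the closure
    into Omega, and it multiplies leading coefficients of order m by r^(m+1); with r
    close to 1 the dilates of the f_m serve as well (test_function). Compactness is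
    used in the form of singular_bound, which bounds the norm of T f by finitely
    many coefficients of f and a small multiple of its norm, and of the pigeonhole
    principle for these coefficients.

    The analysis behind jet_bound has two parts. Cauchy's inequality for leading
    coefficients comes from Goursat's theorem on rectangles, by integrating over
    squares around 0 (goursat, cauchy_coef, cauchy_ineq_derive). Point values are
    bounded by the norm (point_bound): Cauchy's formula averaged over squares bounds
    |f(z)| by an area integral (area_bound), and Tonelli's theorem iterates this
    over the coordinates (cube_bound).

    Conversely, if g = 0 on Omega then C_g is zero, because t z stays in Omega for
    0 < t <= 1 by convexity. *)

(** * The modulus, and derivatives in one complex variable *)

Section ComplexBasics.
Context (R : realType).
Implicit Types (z w : R[i]).

Lemma normr_normc z : `|z| = (normc z)%:C.
Proof. by case: z => a b; rewrite normc_def. Qed.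

Lemma normc_ge0 z : 0 <= normc z.
Proof. by case: z => a b; exact: sqrtr_ge0. Qed.

Lemma normc_eq0 z : (normc z == 0) = (z == 0).
Proof.
apply/eqP/eqP => [|->]; [exact: eq0_normc|exact: normc0].
Qed.

Lemma normcD z w : normc (z + w) <= normc z + normc w.
Proof. exact: le_normcD. Qed.

Lemma normcNE z : normc (- z) = normc z.
Proof. exact: normcN. Qed.

Lemma normcB z w : normc (z - w) <= normc z + normc w.
Proof. by rewrite -(normcNE w); exact: normcD. Qed.

Lemma normcX z k : normc (z ^+ k) = normc z ^+ k.
Proof. by elim: k => [|k IH]; rewrite ?normc1// !exprS normcM IH. Qed.

Lemma normc_real (x : R) : normc x%:C = `|x|.
Proof. by rewrite /= expr0n/= addr0 sqrtr_sqr. Qed.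

Lemma normci : normc ('i : R[i]) = 1.
Proof. by rewrite /= expr0n/= add0r expr1n sqrtr1. Qed.

Lemma normc_Re z : `|complex.Re z| <= normc z.
Proof. by rewrite -lecR -normr_normc normc_ge_Re. Qed.

Lemma normc_Im z : `|complex.Im z| <= normc z.
Proof.
by case: z => a b /=; rewrite -sqrtr_sqr ler_wsqrtr// lerDr sqr_ge0.
Qed.

Lemma normc_ReIm z : normc z <= `|complex.Re z| + `|complex.Im z|.
Proof.
case: z => a b /=; rewrite -[leRHS]ger0_norm ?addr_ge0// -sqrtr_sqr ler_wsqrtr//.
rewrite sqrrD !real_normK ?num_real// addrAC lerDl.
by rewrite mulrn_wge0// mulr_ge0.
Qed.

(** Radii of balls over R[i] are elements of R[i]; this brings them back to R. *)
Lemma nbhs_normcP (V : normedModType R[i]) (x : V) (P : set V) :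
  nbhs x P <-> exists2 d : R, 0 < d & forall y, `|x - y| < d%:C -> P y.
Proof.
split.
  move=> /nbhs_ballP[e /= e0 eP].
  have eE : e = (complex.Re e)%:C by rewrite RRe_real// gtr0_real.
  exists (complex.Re e); first by rewrite -ltcR -eE.
  by move=> y; rewrite -eE => xy; apply: eP; rewrite -ball_normE.
move=> [d d0 dP]; apply/nbhs_ballP; exists d%:C => /=; first by rewrite ltcR.
by move=> y; rewrite -ball_normE => /dP.
Qed.

(** Epsilon-delta form of complex differentiability, in the real-valued modulus:
    all the estimates below are inequalities in R. *)
Definition cdiff (h : R[i] -> R[i]) z d := forall e : R, 0 < e ->
  exists2 r : R, 0 < r & forall w, normc w < r ->
   normc (h (z + w) - h z - d * w) <= e * normc w.

Lemma is_derive_cdiff (h : R[i] -> R[i]) z d :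
  is_derive z 1 h d -> cdiff h z d.
Proof.
move=> [dh <-] e e0.
move/cvgrPdist_le : dh => /(_ e%:C); rewrite ltcR => /(_ e0).
rewrite -/(dnbhs _) /dnbhs /within /= => /nbhs_normcP[r r0 H].
exists r => // w wr; have [->|w0] := eqVneq w 0.
  by rewrite addr0 mulr0 subr0 subrr normc0 mulr0.
have := H w; rewrite sub0r normrN normr_normc ltcR => /(_ wr w0).
rewrite normr_normc lecR => {}H.
have -> : h (z + w) - h z - 'D_1 h z * w =
   - (w * ('D_1 h z - w^-1 * (h (w + z) - h z))).
  rewrite (addrC w) mulrBr mulrA mulfV// mul1r opprB [w * _]mulrC//.
rewrite normcNE normcM mulrC ler_wpM2r ?normc_ge0//.
move: H; rewrite /derive /=.
by rewrite /GRing.scale /= mulr1.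
Qed.

Lemma cdiff_is_derive (h : R[i] -> R[i]) z d :
  cdiff h z d -> is_derive z 1 h d.
Proof.
move=> H.
have Hc : (fun w : R[i] => w^-1 *: ((h \o shift z) (w *: 1) - h z)) @ 0^' --> d.
  apply/cvgrPdist_le => e e0.
  have eE : e = (complex.Re e)%:C by rewrite RRe_real// gtr0_real.
  have [|r r0 {}H] := H (complex.Re e); first by rewrite -ltcR -eE.
  rewrite /dnbhs; apply/nbhs_normcP; exists r => // w.
  rewrite sub0r normrN normr_normc ltcR => wr w0.
  rewrite eE normr_normc lecR.
  have := H w wr.
  have -> : h (z + w) - h z - d * w =
     - (w * (d - w^-1 * (h (w + z) - h z))).
    by rewrite (addrC w) mulrBr mulrA mulfV// mul1r opprB [w * _]mulrC.
  rewrite normcNE normcM mulrC ler_pM2r; last first.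
    by rewrite lt_neqAle eq_sym normc_eq0 w0 normc_ge0.
  by rewrite /GRing.scale /= mulr1.
split; first by apply/cvg_ex; exists d.
exact/cvg_lim.
Qed.

Lemma differentiable_cdiff (h : R[i] -> R[i]) z :
  differentiable h z -> cdiff h z ('D_1 h z).
Proof.
by move=> /derivable1_diffP /derivableP; exact: is_derive_cdiff.
Qed.

Lemma diff_inv z : z != 0 -> differentiable (fun w : R[i] => w^-1) z.
Proof. exact: differentiable_Rinv. Qed.

Lemma diff_mul (V : normedModType R[i]) (f g : V -> R[i]) (x : V) :
  differentiable f x -> differentiable g x ->
  differentiable (fun y => f y * g y) x.
Proof. exact: differentiableM. Qed.

Lemma diff_exp (V : normedModType R[i]) (h : V -> R[i]) k (x : V) :
  differentiable h x -> differentiable (fun y => h y ^+ k) x.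
Proof.
move=> dh; elim: k => [|k IH].
  have -> : (fun y => h y ^+ 0) = cst 1 by apply/funext => y; rewrite expr0.
  exact: differentiable_cst.
have -> : (fun y => h y ^+ k.+1) = (fun y => h y * h y ^+ k).
  by apply/funext => y; rewrite exprS.
exact: diff_mul dh IH.
Qed.

End ComplexBasics.

(** * Integrals of complex functions *)

Section CIntegral.
Context (R : realType) d (T : measurableType d) (mu : {measure set T -> \bar R}) (D : set T).
Context (mD : measurable D).
Implicit Types F G : T -> R[i].

Definition cintegrable F :=
  mu.-integrable D (EFin \o (fun x => complex.Re (F x))) /\
  mu.-integrable D (EFin \o (fun x => complex.Im (F x))).

Lemma cintegralD F G : cintegrable F -> cintegrable G ->
  cintegral mu D (fun x => F x + G x) = cintegral mu D F + cintegral mu D G.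
Proof.
move=> [F1 F2] [G1 G2].
rewrite /cintegral {3}/GRing.add /=; congr Complex.
  rewrite -RintegralD//; apply: eq_Rintegral => t _.
  by case: (F t) (G t) => [? ?] [].
rewrite -RintegralD//; apply: eq_Rintegral => t _.
by case: (F t) (G t) => [? ?] [].
Qed.

Let RZ (r : R) (f : T -> R) : mu.-integrable D (EFin \o f) ->
  mu.-integrable D (EFin \o (fun t => r * f t)).
Proof. by move=> fi; exact: (integrableZl mD r fi). Qed.

Lemma cintegralZl c F : cintegrable F ->
  cintegral mu D (fun x => c * F x) = c * cintegral mu D F.
Proof.
move=> [F1 F2]; rewrite /cintegral {2}/GRing.mul /=; case: c => x y /=; congr Complex.
  rewrite -RintegralZl// -RintegralZl// -RintegralB//; try exact: RZ.
  by apply: eq_Rintegral => t _; case: (F t).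
rewrite -RintegralZl// -RintegralZl// -RintegralD//; try exact: RZ.
by apply: eq_Rintegral => t _; case: (F t).
Qed.

Lemma cintegrableZl c F : cintegrable F -> cintegrable (fun x => c * F x).
Proof.
case: c => x y [F1 F2]; split.
  have := integrableB mD (RZ x F1) (RZ y F2); apply: eq_integrable => // t _.
  by rewrite /= -EFinB; case: (F t).
have := integrableD mD (RZ x F2) (RZ y F1); apply: eq_integrable => // t _.
by rewrite /= -EFinD; case: (F t).
Qed.

Lemma cintegral_conj F : cintegrable F ->
  cintegral mu D (fun x => conjc (F x)) = conjc (cintegral mu D F).
Proof.
move=> [F1 F2]; rewrite /cintegral /=; congr Complex.
  by apply: eq_Rintegral => t _; case: (F t).
rewrite -[RHS]mulN1r -RintegralZl//; apply: eq_Rintegral => t _.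
by rewrite mulN1r; case: (F t).
Qed.

End CIntegral.

Section ComplexIntervalIntegral.
Context (R : realType).
Implicit Types (F G : R -> R[i]) (a b : R).
Local Notation lambda := (@lebesgue_measure R).

Lemma cvg_ReIm (T : Type) (H : set_system T) (FF : Filter H) (f : T -> R[i]) (l : R[i]) :
  f @ H --> l -> (complex.Re (f x) @[x --> H] --> complex.Re l) /\
                 (complex.Im (f x) @[x --> H] --> complex.Im l).
Proof.
move=> /cvgrPdist_le fl; split; apply/cvgrPdist_le => e e0.
- have /= := fl e%:C; rewrite ltcR => /(_ e0); apply: filterS => x.
  rewrite normr_normc lecR; apply: le_trans; rewrite -raddfB.
  exact: normc_Re.
- have /= := fl e%:C; rewrite ltcR => /(_ e0); apply: filterS => x.
  rewrite normr_normc lecR; apply: le_trans; rewrite -raddfB.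
  exact: normc_Im.
Qed.

Lemma cvg_real_complex (T : Type) (H : set_system T) (FF : Filter H) (f : T -> R) (l : R) :
  f @ H --> l -> (f x)%:C @[x --> H] --> l%:C.
Proof.
move=> /cvgrPdist_le fl; apply/cvgrPdist_le => e e0.
have eE : e = (complex.Re e)%:C by rewrite RRe_real// gtr0_real.
have /= := fl (complex.Re e); rewrite -ltcR -eE => /(_ e0).
apply: filterS => x; rewrite eE -rmorphB normr_normc lecR normc_real//.
Qed.

Definition cint a b F : R[i] := cintegral lambda `[a, b] F.

Lemma integrable_ReIm a b F : {in `[a, b], continuous F} ->
  cintegrable lambda `[a, b] F.
Proof.
move=> cF; split; apply: continuous_compact_integrable;
  (try exact: segment_compact); apply: continuous_in_subspaceT => t;
  rewrite inE /= => /cF /cvg_ReIm[]//.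
Qed.

Lemma eq_cint a b F G : {in `[a, b], F =1 G} -> cint a b F = cint a b G.
Proof.
by move=> FG; congr Complex; apply: eq_Rintegral => t; rewrite inE/= => /FG->.
Qed.

Lemma cintD a b F G : {in `[a, b], continuous F} -> {in `[a, b], continuous G} ->
  cint a b (fun t => F t + G t) = cint a b F + cint a b G.
Proof.
move=> /integrable_ReIm iF /integrable_ReIm iG.
have mI : measurable (`[a, b]%classic : set (measurableTypeR R)) by exact: measurable_itv.
exact: (cintegralD mI iF iG).
Qed.

Lemma cintZl a b c F : {in `[a, b], continuous F} ->
  cint a b (fun t => c * F t) = c * cint a b F.
Proof.
move=> /integrable_ReIm iF.
have mI : measurable (`[a, b]%classic : set (measurableTypeR R)) by exact: measurable_itv.
exact: (cintegralZl mI c iF).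
Qed.

Lemma cintN a b F : {in `[a, b], continuous F} ->
  cint a b (fun t => - F t) = - cint a b F.
Proof.
move=> cF; rewrite -mulN1r -cintZl//; apply: eq_cint => t _.
by rewrite mulN1r.
Qed.

Lemma cintB a b F G : {in `[a, b], continuous F} -> {in `[a, b], continuous G} ->
  cint a b (fun t => F t - G t) = cint a b F - cint a b G.
Proof.
move=> cF cG; have cN : {in `[a, b], continuous (fun t => - G t)}.
  by move=> t /cG ct; apply: cvgN.
by rewrite (cintD cF cN) (cintN cG).
Qed.

Lemma fine_lebesgue_segment a b : a <= b ->
  fine (lambda (`[a, b] : set R)) = b - a.
Proof.
move=> ab; have -> := lebesgue_measure_itv `[a, b].
rewrite /= lte_fin; case: ltP => [//|ba].
by rewrite /=; lra.
Qed.

Lemma cint_cst a b c : a <= b -> cint a b (fun=> c) = c * (b - a)%:C.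
Proof.
move=> ab; rewrite /cint /cintegral !Rintegral_cst// fine_lebesgue_segment//.
by case: c => x y; simpc.
Qed.

Lemma cint_split a m b F : a <= m -> m <= b -> {in `[a, b], continuous F} ->
  cint a b F = cint a m F + cint m b F.
Proof.
move=> am mb /integrable_ReIm[F1 F2].
have key f : lambda.-integrable `[a, b] (EFin \o f) ->
    \int[lambda]_(t in `[a, b]) f t =
    \int[lambda]_(t in `[a, m]) f t + \int[lambda]_(t in `[m, b]) f t.
  move=> fi.
  have /= := @Rintegral_itvB R f (BLeft a) (BRight b) m fi.
  rewrite !bnd_simp => /(_ am mb).
  rewrite Rintegral_itv_obnd_cbnd; last first.
    apply: integrableS fi => //; apply: subset_itvr.
    by rewrite bnd_simp.
  by move=> <-; rewrite addrC subrK.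
rewrite /cint /cintegral (key _ F1) (key _ F2) //.
Qed.

(** The factor 2 is the price of bounding real and imaginary parts separately. *)
Lemma cint_le a b F M : a <= b -> {in `[a, b], continuous F} ->
  (forall t, a <= t <= b -> normc (F t) <= M) ->
  normc (cint a b F) <= 2 * M * (b - a).
Proof.
move=> ab cF FM; have [F1 F2] := integrable_ReIm cF.
have key f : lambda.-integrable `[a, b] (EFin \o f) ->
    (forall t, a <= t <= b -> `|f t| <= M) ->
    `|\int[lambda]_(t in `[a, b]) f t| <= M * (b - a).
  move=> fi fM; apply: (le_trans (le_normr_Rintegral _ fi)) => //.
  have cst : M * (b - a) = \int[lambda]_(t in `[a, b]) M.
    by rewrite Rintegral_cst// fine_lebesgue_segment.
  rewrite cst; apply: le_Rintegral => //.
  - by have := integrable_norm fi.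
  - apply: continuous_compact_integrable; first exact: segment_compact.
    by apply: continuous_subspaceT => x; exact: cvg_cst.
apply: (le_trans (normc_ReIm _)) => /=.
rewrite -mulrA mulr2n mulrDl mul1r; apply: lerD; apply: key => // t tab.
  exact: le_trans (normc_Re _) (FM _ tab).
exact: le_trans (normc_Im _) (FM _ tab).
Qed.

Lemma cint_real a b (q : R -> R) :
  cint a b (fun t => (q t)%:C) = (\int[lambda]_(t in `[a, b]) q t)%:C.
Proof.
by rewrite /cint /cintegral /=; congr (_ +i* _); rewrite Rintegral_cst// mul0r.
Qed.

End ComplexIntervalIntegral.
Global Opaque cint.

(** * Goursat's theorem for rectangles *)

Section Goursat.
Context (R : realType).
Implicit Types (h : R[i] -> R[i]) (x y : R) (z p d : R[i]).

Lemma complex_mkE x y : x +i* y = x%:C + 'i * y%:C :> R[i].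
Proof. by simpc. Qed.

Lemma hline_cont h x y : differentiable h (x +i* y) ->
  {for x, continuous (fun t => h (t +i* y))}.
Proof.
move=> /differentiable_continuous ch.
have cl : (fun t : R => t +i* y) @ x --> x +i* y.
  have -> : (fun t => t +i* y) = (fun t => t%:C + 'i * y%:C).
    by apply/funext => t; exact: complex_mkE.
  rewrite complex_mkE; apply: cvgD; last exact: cvg_cst.
  exact: cvg_real_complex cvg_id.
exact: (cvg_comp _ _ cl ch).
Qed.

Lemma vline_cont h x y : differentiable h (x +i* y) ->
  {for y, continuous (fun t => h (x +i* t))}.
Proof.
move=> /differentiable_continuous ch.
have cl : (fun t : R => x +i* t) @ y --> x +i* y.
  have -> : (fun t => x +i* t) = (fun t => x%:C + 'i * t%:C).
    by apply/funext => t; exact: complex_mkE.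
  rewrite complex_mkE; apply: cvgD; first exact: cvg_cst.
  by apply: cvgM; [exact: cvg_cst|exact: cvg_real_complex cvg_id].
exact: (cvg_comp _ _ cl ch).
Qed.

Definition rect x0 x1 y0 y1 z :=
  [/\ x0 <= complex.Re z, complex.Re z <= x1, y0 <= complex.Im z & complex.Im z <= y1].

(** The contour integral of h along the boundary of a rectangle, run
    counterclockwise: bottom minus top, then i times (right minus left). *)
Definition rint h x0 x1 y0 y1 : R[i] :=
  cint x0 x1 (fun x => h (x +i* y0) - h (x +i* y1)) +
  'i * cint y0 y1 (fun y => h (x1 +i* y) - h (x0 +i* y)).

Definition hdiff h x0 x1 y := forall x, x0 <= x <= x1 -> differentiable h (x +i* y).
Definition vdiff h x y0 y1 := forall y, y0 <= y <= y1 -> differentiable h (x +i* y).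

Lemma hdiff_cont h x0 x1 y : hdiff h x0 x1 y ->
  {in `[x0, x1], continuous (fun x => h (x +i* y))}.
Proof. by move=> H t; rewrite in_itv /= => /H /hline_cont. Qed.

Lemma vdiff_cont h x y0 y1 : vdiff h x y0 y1 ->
  {in `[y0, y1], continuous (fun y => h (x +i* y))}.
Proof. by move=> H t; rewrite in_itv /= => /H /vline_cont. Qed.

Lemma contB (F G : R -> R[i]) a b : {in `[a, b], continuous F} ->
  {in `[a, b], continuous G} -> {in `[a, b], continuous (fun t => F t - G t)}.
Proof. by move=> cF cG t tab; apply: cvgB; [exact: cF|exact: cG]. Qed.

Lemma contD (F G : R -> R[i]) a b : {in `[a, b], continuous F} ->
  {in `[a, b], continuous G} -> {in `[a, b], continuous (fun t => F t + G t)}.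
Proof. by move=> cF cG t tab; apply: cvgD; [exact: cF|exact: cG]. Qed.

Lemma contM (F G : R -> R[i]) a b : {in `[a, b], continuous F} ->
  {in `[a, b], continuous G} -> {in `[a, b], continuous (fun t => F t * G t)}.
Proof. by move=> cF cG t tab; apply: cvgM; [exact: cF|exact: cG]. Qed.

Lemma cont_cst c a b : {in `[a, b], continuous (fun _ : R => c : R[i])}.
Proof. by move=> t _; apply: cvg_cst. Qed.

Lemma rint_splitx h x0 m x1 y0 y1 : x0 <= m <= x1 ->
  hdiff h x0 x1 y0 -> hdiff h x0 x1 y1 ->
  vdiff h x0 y0 y1 -> vdiff h m y0 y1 -> vdiff h x1 y0 y1 ->
  rint h x0 x1 y0 y1 = rint h x0 m y0 y1 + rint h m x1 y0 y1.
Proof.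
move=> /andP[x0m mx1] /hdiff_cont h0 /hdiff_cont h1.
move=> /vdiff_cont v0 /vdiff_cont vm /vdiff_cont v1.
rewrite /rint (cint_split x0m mx1 (contB h0 h1)).
by rewrite (cintB v1 v0) (cintB vm v0) (cintB v1 vm); ring.
Qed.

Lemma rint_splity h x0 x1 y0 m y1 : y0 <= m <= y1 ->
  hdiff h x0 x1 y0 -> hdiff h x0 x1 m -> hdiff h x0 x1 y1 ->
  vdiff h x0 y0 y1 -> vdiff h x1 y0 y1 ->
  rint h x0 x1 y0 y1 = rint h x0 x1 y0 m + rint h x0 x1 m y1.
Proof.
move=> /andP[y0m my1] /hdiff_cont h0 /hdiff_cont hm /hdiff_cont h1.
move=> /vdiff_cont v0 /vdiff_cont v1.
rewrite /rint (cint_split y0m my1 (contB v1 v0)).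
by rewrite (cintB h0 h1) (cintB h0 hm) (cintB hm h1); ring.
Qed.

(** Near a point p of differentiability h is affine up to e|z - p|. The contour
    integral of the affine part vanishes; the error is at most e D, where D is half
    the perimeter, and it is integrated over sides of total length 2 D. *)
Lemma rint_local h p d x0 x1 y0 y1 (e r : R) : 0 <= e ->
  (forall w, normc w < r -> normc (h (p + w) - h p - d * w) <= e * normc w) ->
  x0 <= x1 -> y0 <= y1 -> rect x0 x1 y0 y1 p ->
  (x1 - x0) + (y1 - y0) < r ->
  hdiff h x0 x1 y0 -> hdiff h x0 x1 y1 ->
  vdiff h x0 y0 y1 -> vdiff h x1 y0 y1 ->
  normc (rint h x0 x1 y0 y1) <= 4 * e * ((x1 - x0) + (y1 - y0)) ^+ 2.
Proof.
move=> e0 H x01 y01 [p1 p2 p3 p4] Dr /hdiff_cont h0 /hdiff_cont h1.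
move=> /vdiff_cont v0 /vdiff_cont v1.
set D := (x1 - x0) + (y1 - y0) in Dr *.
pose err z := h z - h p - d * (z - p).
have errE z : h z = err z + (h p + d * (z - p)) by rewrite /err; ring.
have errle x y : x0 <= x <= x1 -> y0 <= y <= y1 -> normc (err (x +i* y)) <= e * D.
  move=> /andP[? ?] /andP[? ?].
  have zD : normc (x +i* y - p) <= D.
    apply: (le_trans (normc_ReIm _)); case: p p1 p2 p3 p4 {H err errE} => a b /= ? ? ? ?.
    by rewrite /D; apply: lerD; rewrite ler_norml; apply/andP; split; lra.
  have := H (x +i* y - p) (le_lt_trans zD Dr).
  rewrite [p + _]addrC subrK => /le_trans; apply.
  exact: ler_wpM2l.
have -> : rint h x0 x1 y0 y1 =
    cint x0 x1 (fun x => h (x +i* y0) - h (x +i* y1) - d * 'i * (y0 - y1)%:C) +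
  'i * cint y0 y1 (fun y => h (x1 +i* y) - h (x0 +i* y) - d * (x1 - x0)%:C).
  rewrite (cintB (contB h0 h1) (@cont_cst _ _ _)).
  rewrite (cintB (contB v1 v0) (@cont_cst _ _ _)) !cint_cst// /rint.
  by rewrite !rmorphB; ring.
have D0 : 0 <= D by rewrite /D addr_ge0// subr_ge0.
have i1 : normc (cint x0 x1 (fun x => h (x +i* y0) - h (x +i* y1) - d * 'i * (y0 - y1)%:C))
  <= 2 * (e * D + e * D) * (x1 - x0).
  apply: (cint_le x01 (contB (contB h0 h1) (@cont_cst _ _ _))).
  move=> t tx; rewrite errE (errE (t +i* y1)).
  have -> : err (t +i* y0) + (h p + d * (t +i* y0 - p)) -
    (err (t +i* y1) + (h p + d * (t +i* y1 - p))) - d * 'i * (y0 - y1)%:C =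
    err (t +i* y0) - err (t +i* y1) by rewrite !complex_mkE !rmorphB; ring.
  by apply: (le_trans (normcB _ _)); apply: lerD; apply: errle => //; rewrite ?lexx ?y01.
have i2 : normc (cint y0 y1 (fun y => h (x1 +i* y) - h (x0 +i* y) - d * (x1 - x0)%:C))
  <= 2 * (e * D + e * D) * (y1 - y0).
  apply: (cint_le y01 (contB (contB v1 v0) (@cont_cst _ _ _))).
  move=> t tx; rewrite errE (errE (x0 +i* t)).
  have -> : err (x1 +i* t) + (h p + d * (x1 +i* t - p)) -
    (err (x0 +i* t) + (h p + d * (x0 +i* t - p))) - d * (x1 - x0)%:C =
    err (x1 +i* t) - err (x0 +i* t) by rewrite !complex_mkE !rmorphB; ring.
  by apply: (le_trans (normcB _ _)); apply: lerD; apply: errle => //; rewrite ?lexx ?x01.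
apply: (le_trans (normcD _ _)); rewrite normcM normci mul1r.
apply: (le_trans (lerD i1 i2)); rewrite expr2 -mulrDr -/D.
by rewrite le_eqVlt; apply/orP; left; apply/eqP; ring.
Qed.

Lemma normc_quarter (q : R) (a b c d : R[i]) : q <= normc (a + b + (c + d)) ->
  [\/ q / 4 <= normc a, q / 4 <= normc b, q / 4 <= normc c | q / 4 <= normc d].
Proof.
move=> qn; have {qn} := le_trans qn (le_trans (normcD _ _) (lerD (normcD _ _) (normcD _ _))).
move: (normc a) (normc b) (normc c) (normc d) => {a b c d} a b c d H.
have [l1|l1] := leP (q / 4) a; first by constructor 1.
have [l2|l2] := leP (q / 4) b; first by constructor 2.
have [l3|l3] := leP (q / 4) c; first by constructor 3.
by constructor 4; lra.
Qed.

(** Bisection: if the contour integral were nonzero, one of the four quarters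
    would carry at least a quarter of it, and so on; at the common point p of
    the nested rectangles this contradicts the quadratic bound of rint_local. *)
Lemma goursat h x0 x1 y0 y1 : x0 <= x1 -> y0 <= y1 ->
  (forall z, rect x0 x1 y0 y1 z -> differentiable h z) ->
  rint h x0 x1 y0 y1 = 0.
Proof.
move=> x01 y01 dh; apply: eq0_normc; apply/eqP/negPn/negP => E0.
pose e := normc (rint h x0 x1 y0 y1).
have e0 : 0 < e by rewrite lt_neqAle eq_sym E0 normc_ge0.
pose w k := (x1 - x0) / 2 ^+ k; pose v k := (y1 - y0) / 2 ^+ k.
have halve (c : R) k : c / 2 ^+ k.+1 = c / 2 ^+ k / 2.
  by rewrite exprS invfM mulrA mulrAC.
have w0 k : 0 <= w k by rewrite divr_ge0 ?subr_ge0// exprn_ge0.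
have v0 k : 0 <= v k by rewrite divr_ge0 ?subr_ge0// exprn_ge0.
(* the invariant of the bisection, and the nesting of consecutive rectangles *)
pose P k (s : R * R) := [/\ x0 <= s.1, s.1 + w k <= x1, y0 <= s.2, s.2 + v k <= y1
  & e / 4 ^+ k <= normc (rint h s.1 (s.1 + w k) s.2 (s.2 + v k))].
pose N k (s s' : R * R) := [/\ s.1 <= s'.1, s'.1 + w k.+1 <= s.1 + w k,
  s.2 <= s'.2 & s'.2 + v k.+1 <= s.2 + v k].
have hd a b y : x0 <= a -> b <= x1 -> y0 <= y -> y <= y1 -> hdiff h a b y.
  by move=> ? ? ? ? x /andP[? ?]; apply: dh; split => //=; lra.
have vd a b x : y0 <= a -> b <= y1 -> x0 <= x -> x <= x1 -> vdiff h x a b.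
  by move=> ? ? ? ? y /andP[? ?]; apply: dh; split => //=; lra.
have Sx (a m b c d : R) : x0 <= a -> a <= m -> m <= b -> b <= x1 ->
    y0 <= c -> c <= d -> d <= y1 -> rint h a b c d = rint h a m c d + rint h m b c d.
  move=> xa am mb bx yc cd dy; apply: rint_splitx; first by apply/andP; split.
  - exact: (hd _ _ _ xa bx yc (le_trans cd dy)).
  - exact: (hd _ _ _ xa bx (le_trans yc cd) dy).
  - exact: (vd _ _ _ yc dy xa (le_trans am (le_trans mb bx))).
  - exact: (vd _ _ _ yc dy (le_trans xa am) (le_trans mb bx)).
  - exact: (vd _ _ _ yc dy (le_trans xa (le_trans am mb)) bx).
have Sy (a b c m d : R) : x0 <= a -> a <= b -> b <= x1 -> y0 <= c ->
    c <= m -> m <= d -> d <= y1 -> rint h a b c d = rint h a b c m + rint h a b m d.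
  move=> xa ab bx yc cm md dy; apply: rint_splity; first by apply/andP; split.
  - exact: (hd _ _ _ xa bx yc (le_trans cm (le_trans md dy))).
  - exact: (hd _ _ _ xa bx (le_trans yc cm) (le_trans md dy)).
  - exact: (hd _ _ _ xa bx (le_trans yc (le_trans cm md)) dy).
  - exact: (vd _ _ _ yc dy xa (le_trans ab bx)).
  - exact: (vd _ _ _ yc dy (le_trans xa ab) bx).
have step k s : exists s', P k s -> P k.+1 s' /\ N k s s'.
  have [[]|nP] := pselect (P k s); last by exists s.
  case: s => x y /= X1 X2 Y1 Y2 Ee.
  have wh : w k.+1 = w k / 2 by exact: halve.
  have vh : v k.+1 = v k / 2 by exact: halve.
  move: (w0 k) (v0 k) wh vh; rewrite /P /N /=.
  set W := w k in X2 Ee *; set V := v k in Y2 Ee *; set W' := w k.+1; set V' := v k.+1.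
  move=> W0 V0 W'E V'E.
  have WW : x + W = x + W' + W' by rewrite W'E; clear; lra.
  have VV : y + V = y + V' + V' by rewrite V'E; clear; lra.
  have W'0 : 0 <= W' by rewrite W'E divr_ge0.
  have V'0 : 0 <= V' by rewrite V'E divr_ge0.
  have xx1 : x <= x + W' by rewrite lerDl.
  have xx2 : x + W' <= x + W' + W' by rewrite lerDl.
  have yy1 : y <= y + V' by rewrite lerDl.
  have yy2 : y + V' <= y + V' + V' by rewrite lerDl.
  rewrite WW in X2 Ee *; rewrite VV in Y2 Ee *.
  have xx3 := le_trans X1 xx1; have xx4 := le_trans xx2 X2.
  have yy3 := le_trans Y1 yy1; have yy4 := le_trans yy2 Y2.
  have split4 : rint h x (x + W' + W') y (y + V' + V') =
      rint h x (x + W') y (y + V') + rint h x (x + W') (y + V') (y + V' + V') +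
      (rint h (x + W') (x + W' + W') y (y + V') +
       rint h (x + W') (x + W' + W') (y + V') (y + V' + V')).
    etransitivity; first by apply: (Sx x (x + W')) => //; exact: le_trans yy2.
    by congr (_ + _); apply: (Sy _ _ y (y + V')).
  have e4 : e / 4 ^+ k.+1 = e / 4 ^+ k / 4 by rewrite exprS invfM mulrA mulrAC.
  rewrite split4 in Ee; rewrite e4; clear split4.
  case: (normc_quarter Ee) => l.
  - by exists (x, y).
  - by exists (x, y + V').
  - by exists (x + W', y).
  - by exists (x + W', y + V').
have [f Hf] := choice (fun ks : nat * (R * R) => step ks.1 ks.2).
pose s := fix s k := if k is k'.+1 then f (k', s k') else (x0, y0).
have Ps k : P k (s k).
  elim: k => [|k IH] /=; last by have [] := Hf (k, s k) IH.
  have sk (a b : R) : a + (b - a) = b by rewrite addrC subrK.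
  by rewrite /P /w /v /= !expr0 !divr1 !sk; split.
have Ns k : N k (s k) (s k.+1) by have [] := Hf (k, s k) (Ps k).
have nest j k : [/\ (s j).1 <= (s (j + k)%N).1, (s (j + k)%N).1 + w (j + k)%N <= (s j).1 + w j,
   (s j).2 <= (s (j + k)%N).2 & (s (j + k)%N).2 + v (j + k)%N <= (s j).2 + v j].
  elim: k => [|k [a b c d]]; first by rewrite addn0.
  rewrite addnS; have [a' b' c' d'] := Ns (j + k)%N.
  by split; [exact: le_trans a'|exact: le_trans b|exact: le_trans c'|exact: le_trans d].
have cross j k : (s k).1 <= (s j).1 + w j /\ (s k).2 <= (s j).2 + v j.
  have [jk|kj] := leqP j k.
    have [_ a _ b] := nest j (k - j)%N; rewrite subnKC// in a b.
    by move: (w0 k) (v0 k) a b; clear; split; lra.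
  have [a _ b _] := nest k (j - k)%N; rewrite subnKC ?(ltnW kj)// in a b.
  by move: (w0 j) (v0 j) a b; clear; split; lra.
pose X := [set (s k).1 | k in setT]; pose Y := [set (s k).2 | k in setT].
have supX : has_sup X.
  split; first by exists (s 0%N).1, 0%N.
  by exists ((s 0%N).1 + w 0%N) => _ [k _ <-]; have [] := cross 0%N k.
have supY : has_sup Y.
  split; first by exists (s 0%N).2, 0%N.
  by exists ((s 0%N).2 + v 0%N) => _ [k _ <-]; have [] := cross 0%N k.
have inX k : (s k).1 <= sup X <= (s k).1 + w k.
  rewrite ub_le_sup//=; [|by case: supX|by exists k].
  by apply: ge_sup; [case: supX|move=> _ [j _ <-]; have [] := cross k j].
have inY k : (s k).2 <= sup Y <= (s k).2 + v k.
  rewrite ub_le_sup//=; [|by case: supY|by exists k].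
  by apply: ge_sup; [case: supY|move=> _ [j _ <-]; have [] := cross k j].
pose p := sup X +i* sup Y.
have pk k : rect (s k).1 ((s k).1 + w k) (s k).2 ((s k).2 + v k) p.
  by have /andP[? ?] := inX k; have /andP[? ?] := inY k; split.
have dp : differentiable h p.
  apply: dh; have [a b c d] := pk 0%N; have [a' b' c' d' _] := Ps 0%N.
  by split; lra.
pose D := (x1 - x0) + (y1 - y0).
have D0 : 0 <= D by rewrite /D addr_ge0// subr_ge0.
pose eps := e / (8 * (D + 1) ^+ 2).
have D1 : 0 < D + 1 by rewrite ltr_wpDl.
have D2 : 0 < (D + 1) ^+ 2 by rewrite exprn_gt0.
have eps0 : 0 < eps by rewrite divr_gt0// mulr_gt0.
have [r r0 Hr] := differentiable_cdiff dp eps0.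
have [k kr] : exists k, D / 2 ^+ k < r.
  have := @cvg_expr R (2^-1 : R); rewrite ger0_norm// invf_lt1// ltr1n => /(_ isT) c2.
  have /cvgrPdist_lt /(_ (r / (D + 1))) c3 := c2.
  have [|k _ /(_ k (leqnn k))] := c3; first by rewrite divr_gt0.
  rewrite sub0r normrN ger0_norm ?exprn_ge0// ltr_pdivlMr//.
  move=> {}c3; exists k; rewrite -exprVn mulrC; apply: le_lt_trans c3.
  by rewrite ler_wpM2l ?exprn_ge0// lerDl.
have wv : w k + v k = D / 2 ^+ k by rewrite /w /v -mulrDl.
have [a b c d Ek] := Ps k.
have := @rint_local h p _ (s k).1 ((s k).1 + w k) (s k).2 ((s k).2 + v k) eps r
   (ltW eps0) Hr.
rewrite !lerDl => /(_ (w0 k) (v0 k) (pk k)).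
have -> : (s k).1 + w k - (s k).1 + ((s k).2 + v k - (s k).2) = D / 2 ^+ k.
  by rewrite -wv ![_ + _ - _]addrAC !subrr !add0r.
move=> /(_ kr); have := w0 k; have := v0 k => v0k w0k.
move=> H; have {}H := le_trans Ek (H _ _ _ _).
have : e / 4 ^+ k <= 4 * eps * (D / 2 ^+ k) ^+ 2.
  have sx : (s k).1 <= (s k).1 + w k by rewrite lerDl.
  have sy : (s k).2 <= (s k).2 + v k by rewrite lerDl.
  apply: H.
  - exact: (hd _ _ _ a b c (le_trans sy d)).
  - exact: (hd _ _ _ a b (le_trans c sy) d).
  - exact: (vd _ _ _ c d a (le_trans sx b)).
  - exact: (vd _ _ _ c d (le_trans a sx) b).
have -> : (D / 2 ^+ k) ^+ 2 = D ^+ 2 / 4 ^+ k.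
  rewrite expr_div_n -exprM mulnC exprM; congr (_ / _ ^+ _); ring.
rewrite mulrA ler_pM2r ?invr_gt0 ?exprn_gt0//.
rewrite /eps.
move=> /(@ler_wpM2r _ ((D + 1) ^+ 2)) => /(_ (ltW D2)).
have -> : 4 * (e / (8 * (D + 1) ^+ 2)) * D ^+ 2 * (D + 1) ^+ 2 = e * D ^+ 2 / 2.
  by field; rewrite gt_eqF.
have DD : D ^+ 2 <= (D + 1) ^+ 2 by rewrite ler_sqr ?nnegrE ?(ltW D1)// lerDl.
rewrite -mulrA ler_pM2l//; move: DD D2; clear; nra.
Qed.

End Goursat.

(** * Cauchy's inequality for a leading coefficient *)

Section CauchyInequality.
Context (R : realType).
Implicit Types (h psi phi : R[i] -> R[i]) (x y s rho : R) (z w c : R[i]).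
Local Notation lambda := (@lebesgue_measure R).

Definition in_square rho z := rect (- rho) rho (- rho) rho z.
Definition square_contour h s := rint h (- s) s (- s) s.

(** The region between two squares consists of four rectangles that avoid 0, so
    a function holomorphic off 0 has the same integral over both contours. *)
Lemma square_contour_annulus h s rho : 0 < s <= rho ->
  (forall z, in_square rho z -> z != 0 -> differentiable h z) ->
  square_contour h rho = square_contour h s.
Proof.
move=> /andP[s0 srho] dh.
have neq0 z : complex.Re z != 0 \/ complex.Im z != 0 -> z != 0.
  by case: z => a b /= H; apply/eqP => -[a0 b0]; case: H; rewrite ?a0 ?b0 eqxx.
have hd a b y : - rho <= a -> b <= rho -> - rho <= y <= rho -> y != 0 -> hdiff h a b y.
  move=> ? ? /andP[? ?] ? x /andP[? ?]; apply: dh; first by split => //=; lra.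
  by apply: neq0; right.
have vd a b x : - rho <= a -> b <= rho -> - rho <= x <= rho -> x != 0 -> vdiff h x a b.
  move=> ? ? /andP[? ?] ? y /andP[? ?]; apply: dh; first by split => //=; lra.
  by apply: neq0; left.
have n0 (t : R) : t < 0 \/ 0 < t -> t != 0 by case=> ?; lra.
have Sx (a m b c d : R) : - rho <= a -> a <= m -> m <= b -> b <= rho ->
    - rho <= c -> c <= d -> d <= rho -> a != 0 -> m != 0 -> b != 0 -> c != 0 ->
    d != 0 -> rint h a b c d = rint h a m c d + rint h m b c d.
  move=> ? ? ? ? ? ? ? ? ? ? ? ?; apply: rint_splitx; first by apply/andP; split.
  - by apply: hd => //; lra.
  - by apply: hd => //; lra.
  - by apply: vd => //; lra.
  - by apply: vd => //; lra.
  - by apply: vd => //; lra.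
have Sy (a b c m d : R) : - rho <= a -> a <= b -> b <= rho -> - rho <= c ->
    c <= m -> m <= d -> d <= rho -> a != 0 -> b != 0 -> c != 0 -> m != 0 ->
    d != 0 -> rint h a b c d = rint h a b c m + rint h a b m d.
  move=> ? ? ? ? ? ? ? ? ? ? ? ?; apply: rint_splity; first by apply/andP; split.
  - by apply: hd => //; lra.
  - by apply: hd => //; lra.
  - by apply: hd => //; lra.
  - by apply: vd => //; lra.
  - by apply: vd => //; lra.
have G (a b c d : R) : - rho <= a -> a <= b -> b <= rho -> - rho <= c -> c <= d ->
    d <= rho -> 0 < a \/ b < 0 \/ 0 < c \/ d < 0 -> rint h a b c d = 0.
  move=> ? ab ? ? cd ? H; apply: goursat => // z [? ? ? ?].
  apply: dh; first by split; lra.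
  by apply: neq0; case: H => [|[|[|]]] ?; [left|left|right|right]; lra.
have [s0' r0 r0'] : [/\ - s < 0, 0 < rho & - rho < 0] by split; lra.
have sne : s != 0 by lra.
have sne' : - s != 0 by lra.
have rne : rho != 0 by lra.
have rne' : - rho != 0 by lra.
clear dh hd vd neq0.
have e1 : rint h (- rho) rho (- rho) rho =
    rint h (- rho) rho (- rho) (- s) + rint h (- rho) rho (- s) rho.
  by apply: Sy => //; clear Sx G; lra.
have e2 : rint h (- rho) rho (- s) rho =
    rint h (- rho) rho (- s) s + rint h (- rho) rho s rho.
  by apply: Sy => //; clear Sx G e1; lra.
have e3 : rint h (- rho) rho (- s) s =
    rint h (- rho) (- s) (- s) s + rint h (- s) rho (- s) s.
  by apply: Sx => //; clear Sy G e1 e2; lra.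
have e4 : rint h (- s) rho (- s) s =
    rint h (- s) s (- s) s + rint h s rho (- s) s.
  by apply: Sx => //; clear Sy G e1 e2 e3; lra.
clear Sx Sy; rewrite /square_contour e1 e2 e3 e4; clear e1 e2 e3 e4.
have -> : rint h (- rho) rho (- rho) (- s) = 0.
  by apply: G; try (right; right; right; lra); lra.
have -> : rint h (- rho) (- s) (- s) s = 0.
  by apply: G; try (right; left; lra); lra.
have -> : rint h s rho (- s) s = 0.
  by apply: G; try (left; lra); lra.
have -> : rint h (- rho) rho s rho = 0.
  by apply: G; try (right; right; left; lra); lra.
by rewrite add0r !addr0 add0r.
Qed.

(** The part of the square outside the disc of radius s: it contains the four
    sides, and the bound s <= |z| is what the estimates on the contour use. *)
Definition square_edge s z := in_square s z /\ s <= normc z.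

Lemma square_edgeP s z : 0 < s -> in_square s z -> [\/ complex.Re z = s, complex.Re z = - s,
  complex.Im z = s | complex.Im z = - s] -> square_edge s z.
Proof.
move=> s0 zs H; split=> //.
have nr := normc_Re z; have ni := normc_Im z.
case: H => H; rewrite H in nr ni.
- by rewrite ger0_norm in nr; lra.
- by rewrite ler0_norm in nr; lra.
- by rewrite ger0_norm in ni; lra.
- by rewrite ler0_norm in ni; lra.
Qed.

Lemma square_edgeT s x : 0 < s -> - s <= x <= s -> square_edge s (x +i* s).
Proof.
by move=> s0 /andP[? ?]; apply: square_edgeP => //; [split => /=; lra|constructor 3].
Qed.

Lemma square_edgeB s x : 0 < s -> - s <= x <= s -> square_edge s (x +i* (- s)).
Proof.
by move=> s0 /andP[? ?]; apply: square_edgeP => //; [split => /=; lra|constructor 4].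
Qed.

Lemma square_edgeR s x : 0 < s -> - s <= x <= s -> square_edge s (s +i* x).
Proof.
by move=> s0 /andP[? ?]; apply: square_edgeP => //; [split => /=; lra|constructor 1].
Qed.

Lemma square_edgeL s x : 0 < s -> - s <= x <= s -> square_edge s (- s +i* x).
Proof.
by move=> s0 /andP[? ?]; apply: square_edgeP => //; [split => /=; lra|constructor 2].
Qed.

Lemma square_edge_cont h s : 0 < s -> (forall z, square_edge s z -> differentiable h z) ->
  [/\ {in `[- s, s], continuous (fun x => h (x +i* - s))},
      {in `[- s, s], continuous (fun x => h (x +i* s))},
      {in `[- s, s], continuous (fun y => h (- s +i* y))} &
      {in `[- s, s], continuous (fun y => h (s +i* y))}].
Proof.
move=> s0 dh; split.
- by apply: hdiff_cont => x xs; exact: dh (square_edgeB s0 xs).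
- by apply: hdiff_cont => x xs; exact: dh (square_edgeT s0 xs).
- by apply: vdiff_cont => x xs; exact: dh (square_edgeL s0 xs).
- by apply: vdiff_cont => x xs; exact: dh (square_edgeR s0 xs).
Qed.

Lemma square_contour_le h s M : 0 < s -> (forall z, square_edge s z -> differentiable h z) ->
  (forall z, square_edge s z -> normc (h z) <= M) -> normc (square_contour h s) <= 16 * M * s.
Proof.
move=> s0 dh hM; have [cB cT cL cR] := square_edge_cont s0 dh.
have ss : - s <= s by lra.
apply: (le_trans (normcD _ _)); rewrite normcM normci mul1r.
have i1 : normc (cint (- s) s (fun x => h (x +i* - s) - h (x +i* s))) <= 2 * (M + M) * (s - - s).
  apply: (cint_le ss (contB cB cT)) => t ts; apply: (le_trans (normcB _ _)).
  by apply: lerD; apply: hM; [exact: (square_edgeB s0 ts)|exact: (square_edgeT s0 ts)].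
have i2 : normc (cint (- s) s (fun y => h (s +i* y) - h (- s +i* y))) <= 2 * (M + M) * (s - - s).
  apply: (cint_le ss (contB cR cL)) => t ts; apply: (le_trans (normcB _ _)).
  by apply: lerD; apply: hM; [exact: (square_edgeR s0 ts)|exact: (square_edgeL s0 ts)].
by apply: (le_trans (lerD i1 i2)); rewrite le_eqVlt; apply/orP; left; apply/eqP; ring.
Qed.

Lemma eq_square_contour h k s : 0 < s -> (forall z, square_edge s z -> h z = k z) ->
  square_contour h s = square_contour k s.
Proof.
move=> s0 hk; congr (_ + 'i * _); apply: eq_cint => t; rewrite in_itv /= => ts.
  by congr (_ - _); apply: hk; [exact: (square_edgeB s0 ts)|exact: (square_edgeT s0 ts)].
by congr (_ - _); apply: hk; [exact: (square_edgeR s0 ts)|exact: (square_edgeL s0 ts)].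
Qed.

Lemma square_contourD h k s : 0 < s -> (forall z, square_edge s z -> differentiable h z) ->
  (forall z, square_edge s z -> differentiable k z) ->
  square_contour (fun z => h z + k z) s = square_contour h s + square_contour k s.
Proof.
move=> s0 dh dk; have [hB hT hL hR] := square_edge_cont s0 dh.
have [kB kT kL kR] := square_edge_cont s0 dk.
rewrite /square_contour /rint (cintB (contD hB kB) (contD hT kT)) (cintB (contD hR kR) (contD hL kL)).
rewrite (cintD hB kB) (cintD hT kT) (cintD hL kL) (cintD hR kR).
by rewrite (cintB hB hT) (cintB hR hL) (cintB kB kT) (cintB kR kL); ring.
Qed.

Lemma square_contourZl c h s : 0 < s -> (forall z, square_edge s z -> differentiable h z) ->
  square_contour (fun z => c * h z) s = c * square_contour h s.
Proof.
move=> s0 dh; have [hB hT hL hR] := square_edge_cont s0 dh.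
have cc := @cont_cst R c (- s) s.
rewrite /square_contour /rint (cintB (contM cc hB) (contM cc hT)) (cintB (contM cc hR) (contM cc hL)).
rewrite (cintZl c hB) (cintZl c hT) (cintZl c hL) (cintZl c hR).
by rewrite (cintB hB hT) (cintB hR hL); ring.
Qed.

Lemma square_edge_neq0 s z : 0 < s -> square_edge s z -> z != 0.
Proof.
by move=> s0 [_ sz]; apply/eqP => z0; move: sz; rewrite z0 normc0; lra.
Qed.

(** The exact value is 2 i pi. The bound 4 comes from the pointwise estimate of
    the kernel 2s / (t^2 + s^2) of the sides by 1/s, and is all that the
    inequalities below need. *)
Lemma square_contour_inv s : 0 < s -> 4 <= normc (square_contour (fun z => z^-1) s).
Proof.
move=> s0; have ss : - s <= s by lra.
have cinv : forall z, square_edge s z -> differentiable (fun z : R[i] => z^-1) z.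
  by move=> z /(square_edge_neq0 s0) /diff_inv.
have [cB cT cL cR] := square_edge_cont s0 cinv.
pose q (t : R) := 2 * s / (t ^+ 2 + s ^+ 2).
have den (t : R) : t ^+ 2 + s ^+ 2 != 0.
  by rewrite gt_eqF// ltr_wpDl ?sqr_ge0// exprn_gt0.
have e1 t : (t +i* - s)^-1 - (t +i* s)^-1 = 'i * (q t)%:C.
  rewrite /q {1 2}/GRing.inv /=; simpc; rewrite sqrrN subrr; congr (_ +i* _).
  by rewrite -mulrDl; congr (_ / _); ring.
have e2 t : (s +i* t)^-1 - (- s +i* t)^-1 = (q t)%:C.
  rewrite /q {1 2}/GRing.inv /=; simpc; rewrite sqrrN (addrC (s ^+ 2)).
  congr (_ +i* _); last by ring.
  by rewrite -mulrDl; congr (_ / _); ring.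
have c1 : {in `[- s, s], continuous (fun y => (q y)%:C)}.
  move=> t ts; have := contB cR cL ts; congr (continuous_at _ _).
  by apply/funext => u; exact: e2.
have qs : {in `[- s, s], continuous q}.
  move=> t ts; have /cvg_ReIm[]// := c1 t ts.
rewrite /square_contour /rint (eq_cint (in1W e1)) (eq_cint (in1W e2)) (cintZl _ c1) cint_real.
set I := \int[lambda]_(t in `[- s, s]) q t.
have -> : 'i * I%:C + 'i * I%:C = 'i * (2 * I)%:C :> R[i].
  by rewrite -mulrDr -rmorphD; congr (_ * _%:C); ring.
rewrite normcM normci mul1r normc_real.
suff : 2 <= I by have := ler_norm (2 * I); lra.
rewrite /I.
have -> : 2 = \int[lambda]_(t in `[- s, s]) s^-1 :> R.
  by rewrite Rintegral_cst// fine_lebesgue_segment//; field; lra.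
apply: le_Rintegral => //.
- apply: continuous_compact_integrable; first exact: segment_compact.
  by apply: continuous_subspaceT => x; exact: cvg_cst.
- apply: continuous_compact_integrable; first exact: segment_compact.
  by apply: continuous_in_subspaceT => x; rewrite inE => /qs.
move=> t /=; rewrite in_itv /= => /andP[t1 t2].
have d0 : 0 < t ^+ 2 + s ^+ 2 by rewrite ltr_wpDl ?sqr_ge0// exprn_gt0.
rewrite /q ler_pdivlMr// mulrC ler_pdivrMr//.
have : t ^+ 2 <= s ^+ 2 by rewrite -subr_ge0 subr_sqr mulr_ge0//; clear -t1 t2; lra.
clear -s0; nra.
Qed.

Lemma diff_invX z k : z != 0 -> differentiable (fun w : R[i] => w^-1 ^+ k) z.
Proof. by move=> z0; apply: diff_exp; exact: diff_inv. Qed.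

(** psi(w) = c w^m + o(w^m) as w tends to 0. Working with leading terms avoids
    power series: only first derivatives of holomorphic functions occur. *)
Definition leading c m psi := forall e : R, 0 < e ->
  exists2 r : R, 0 < r & forall w, normc w < r ->
    normc (psi w - c * w ^+ m) <= e * normc w ^+ m.

(** On a small square psi(w) / w^(m+1) is c / w up to o(1/|w|), whose integral
    over the contour is small; the contour can be enlarged to the radius rho. *)
Lemma cauchy_coef psi c m rho : 0 < rho ->
  (forall z, in_square rho z -> differentiable psi z) -> leading c m psi ->
  4 * normc c <= normc (square_contour (fun w => psi w * w^-1 ^+ m.+1) rho).
Proof.
move=> rho0 dpsi H; apply/ler_addgt0Pr => e e0.
have [r r0 Hr] := H (e / 16) ltac:(by lra).
pose s := Num.min rho (r / 3).
have s0 : 0 < s by rewrite /s lt_min rho0/=; lra.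
have srho : s <= rho by rewrite /s ge_min lexx.
have s3 : s <= r / 3 by rewrite /s ge_min lexx orbT.
have dh z : in_square rho z -> z != 0 -> differentiable (fun w => psi w * w^-1 ^+ m.+1) z.
  by move=> zr z0; apply: diff_mul; [exact: dpsi|exact: diff_invX].
rewrite (@square_contour_annulus _ s) ?s0//.
have bs z : square_edge s z -> in_square rho z.
  by move=> [[? ? ? ?] _]; split; lra.
pose err w := (psi w - c * w ^+ m) * w^-1 ^+ m.+1.
have -> : square_contour (fun w => psi w * w^-1 ^+ m.+1) s =
    square_contour (fun w => c * w^-1 + err w) s.
  apply: eq_square_contour => // z /(square_edge_neq0 s0) z0; rewrite /err mulrBl.
  rewrite -mulrA exprS [w in _ = _ + (_ - c * w)](mulrCA) -exprMn mulfV// expr1n mulr1.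
  by ring.
have dinv z : square_edge s z -> differentiable (fun w : R[i] => w^-1) z.
  by move=> /(square_edge_neq0 s0) /diff_inv.
have derr z : square_edge s z -> differentiable err z.
  move=> zs; have z0 := square_edge_neq0 s0 zs; apply: diff_mul; last exact: diff_invX.
  apply: (@differentiableB _ _ _ psi (fun w => c * w ^+ m)); first exact/dpsi/bs.
  by apply: diff_mul; [exact: differentiable_cst|exact: diff_exp].
have dcinv z : square_edge s z -> differentiable (fun w : R[i] => c * w^-1) z.
  by move=> zs; exact: (diff_mul (@differentiable_cst _ _ _ c z) (dinv z zs)).
rewrite (square_contourD s0 dcinv derr) (square_contourZl c s0 dinv).
have := square_contour_inv s0 => inv4.
have errle : normc (square_contour err s) <= 16 * (e / 16 / s) * s.
  apply: square_contour_le => // z zs; have z0 := square_edge_neq0 s0 zs.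
  have [[? ? ? ?] sz] := zs.
  have zr : normc z < r.
    apply: (le_lt_trans (normc_ReIm z)).
    have : `|complex.Re z| <= s by rewrite ler_norml; lra.
    have : `|complex.Im z| <= s by rewrite ler_norml; lra.
    lra.
  have nz0 : 0 < normc z by lra.
  rewrite normcM normcX normcV; apply: (le_trans (ler_wpM2r _ (Hr z zr))).
    by rewrite exprn_ge0// invr_ge0 normc_ge0.
  rewrite exprS -!mulrA -[normc z ^+ m * _]mulrCA -exprMn mulfV ?gt_eqF// expr1n mulr1.
  rewrite !mulrA ler_pM2l; last by lra.
  by rewrite lef_pV2.
have es : 16 * (e / 16 / s) * s = e by field; lra.
rewrite es in errle.
have := normcB (c * square_contour (fun z => z^-1) s + square_contour err s) (square_contour err s).
rewrite addrK normcM.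
have := ler_wpM2l (normc_ge0 c) inv4; lra.
Qed.

Lemma cauchy_ineq psi c m rho M : 0 < rho ->
  (forall z, in_square rho z -> differentiable psi z) ->
  (forall z, in_square rho z -> normc (psi z) <= M) -> leading c m psi ->
  normc c <= 4 * M / rho ^+ m.
Proof.
move=> rho0 dpsi psiM H; have := cauchy_coef rho0 dpsi H.
have M0 : 0 <= M.
  apply: le_trans (psiM 0 _); first exact: normc_ge0.
  by split => /=; lra.
have : normc (square_contour (fun w => psi w * w^-1 ^+ m.+1) rho) <= 16 * (M / rho ^+ m.+1) * rho.
  apply: (square_contour_le rho0) => z zs; have z0 := square_edge_neq0 rho0 zs; have [zc zn] := zs.
    exact: (diff_mul (dpsi z zc) (@diff_invX z m.+1 z0)).
  rewrite normcM normcX normcV; apply: ler_pM => //.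
  - exact: normc_ge0.
  - by rewrite exprn_ge0// invr_ge0 normc_ge0.
  - exact: psiM.
  have nz0 : 0 < normc z by lra.
  rewrite exprVn lef_pV2 ?posrE ?exprn_gt0//.
  by rewrite lerXn2r// nnegrE; lra.
have -> : 16 * (M / rho ^+ m.+1) * rho = 4 * (4 * M / rho ^+ m).
  by rewrite exprS; field; rewrite expf_neq0 ?gt_eqF.
lra.
Qed.

End CauchyInequality.

(** * Continuity of the derivative *)

Section DerivativeContinuity.
Context (R : realType).
Implicit Types (h psi phi : R[i] -> R[i]) (x y s rho : R) (z w c : R[i]).
Local Notation lambda := (@lebesgue_measure R).

Lemma is_derive_line phi z v (t : R) : differentiable phi (z + t%:C * v) ->
  is_derive t 1 (fun t : R => complex.Re (phi (z + t%:C * v)))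
     (complex.Re ('D_1 phi (z + t%:C * v) * v)) /\
  is_derive t 1 (fun t : R => complex.Im (phi (z + t%:C * v)))
     (complex.Im ('D_1 phi (z + t%:C * v) * v)).
Proof.
move=> /differentiable_cdiff dphi; set d := 'D_1 phi _.
have key (F : R[i] -> R) : (forall u w : R[i], F (u - w) = F u - F w) ->
   (forall (a : R) w, F (a%:C * w) = a * F w) -> (forall w, `|F w| <= normc w) ->
   is_derive t 1 (fun t : R => F (phi (z + t%:C * v))) (F (d * v)).
  move=> FB FZ Fn.
  have H : (fun u : R => u^-1 *: (((fun t => F (phi (z + t%:C * v))) \o shift t) (u *: 1)
     - F (phi (z + t%:C * v)))) @ 0^' --> F (d * v).
    apply/cvgrPdist_le => e e0.
    have nv : 0 < normc v + 1 by have := normc_ge0 v; lra.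
    have [r r0 Hr] := dphi (e / (normc v + 1)) (divr_gt0 e0 nv).
    rewrite /dnbhs; apply/nbhs_ballP; exists (r / (normc v + 1)) => /=; first exact: divr_gt0.
    move=> u; rewrite -ball_normE /= sub0r normrN => ur u0.
    have uv : normc (u%:C * v) < r.
      rewrite normcM normc_real; apply: le_lt_trans (_ : `|u| * (normc v + 1) < r).
        by rewrite ler_wpM2l//; lra.
      by rewrite -ltr_pdivlMr.
    have := Hr _ uv.
    have -> : z + t%:C * v + u%:C * v = z + (u *: 1 + t)%:C * v.
      by rewrite /GRing.scale /= mulr1 rmorphD /=; ring.
    have -> : d * (u%:C * v) = u%:C * (d * v) by ring.
    move=> /(le_trans (Fn _)); rewrite !FB FZ.
    rewrite normcM normc_real => Hu.
    have -> : F (d * v) - u^-1 *: (F (phi (z + (u *: 1 + t)%:C * v)) - F (phi (z + t%:C * v)))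
      = - (u^-1 * (F (phi (z + (u *: 1 + t)%:C * v)) - F (phi (z + t%:C * v)) - u * F (d * v))).
      by rewrite /GRing.scale /= mulr1; field.
    rewrite normrN normrM normfV ler_pdivrMl ?normr_gt0//.
    apply: (le_trans Hu); rewrite mulrCA ler_wpM2l// mulrAC ler_pdivrMr//.
    by rewrite ler_pM2l//; lra.
  by split; [apply/cvg_ex; exists (F (d * v))|exact/cvg_lim].
split; apply: key.
- by move=> x y; rewrite raddfB.
- by move=> a [x y]; simpc.
- exact: normc_Re.
- by move=> x y; rewrite raddfB.
- by move=> a [x y]; simpc.
- exact: normc_Im.
Qed.

(** The real mean value theorem applied to the real and imaginary parts along
    the segment, hence the factor 2. *)
Lemma mean_value_ineq phi z v L :
  (forall t : R, 0 <= t <= 1 -> differentiable phi (z + t%:C * v)) ->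
  (forall t : R, 0 <= t <= 1 -> normc ('D_1 phi (z + t%:C * v)) <= L) ->
  normc (phi (z + v) - phi z) <= 2 * L * normc v.
Proof.
move=> dphi HL.
have key (F : R[i] -> R) : (forall u w : R[i], F (u - w) = F u - F w) ->
  (forall w, `|F w| <= normc w) ->
  (forall t : R, 0 <= t <= 1 -> is_derive t 1 (fun t : R => F (phi (z + t%:C * v)))
     (F ('D_1 phi (z + t%:C * v) * v))) -> `|F (phi (z + v) - phi z)| <= L * normc v.
  move=> FB Fn Fd.
  have [|||t t01] := @MVT_segment R (fun t : R => F (phi (z + t%:C * v)))
     (fun t => F ('D_1 phi (z + t%:C * v) * v)) 0 1.
  - exact: ler01.
  - by move=> t; rewrite in_itv /= => /andP[? ?]; apply: Fd; lra.
  - apply: derivable_within_continuous => t; rewrite in_itv /= => /Fd[].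
    by [].
  - rewrite subr0 mulr1 mul0r addr0 mul1r -FB => ->.
    apply: (le_trans (Fn _)); rewrite normcM ler_wpM2r ?normc_ge0//.
    by apply: HL; move: t01; rewrite in_itv.
apply: (le_trans (normc_ReIm _)); rewrite -mulrA mulr2n mulrDl mul1r.
apply: lerD; apply: key.
- by move=> x y; rewrite raddfB.
- exact: normc_Re.
- by move=> t /dphi /is_derive_line[].
- by move=> x y; rewrite raddfB.
- exact: normc_Im.
- by move=> t /dphi /is_derive_line[].
Qed.

Lemma in_square_normc rho z : in_square rho z -> normc z <= 2 * rho.
Proof.
move=> [? ? ? ?]; apply: (le_trans (normc_ReIm z)).
have : `|complex.Re z| <= rho by rewrite ler_norml; lra.
have : `|complex.Im z| <= rho by rewrite ler_norml; lra.
lra.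
Qed.

Lemma normc_in_square rho z : normc z <= rho -> in_square rho z.
Proof.
move=> zr; have := normc_Re z; have := normc_Im z.
by rewrite !ler_norml => /andP[? ?] /andP[? ?]; split; lra.
Qed.

Lemma cdiff_differentiable phi z d : cdiff phi z d -> differentiable phi z.
Proof. by move=> /cdiff_is_derive[dphi _]; exact/derivable1_diffP. Qed.

Lemma cdiff_derive phi z d : cdiff phi z d -> 'D_1 phi z = d.
Proof. by move=> /cdiff_is_derive[_]. Qed.

Lemma cdiffB phi psi z c d : cdiff phi z c -> cdiff psi z d ->
  cdiff (fun w => phi w - psi w) z (c - d).
Proof.
move=> dphi dpsi e e0; have e20 : 0 < e / 2 by rewrite divr_gt0.
have [r r0 Hr] := dphi _ e20; have [q q0 Hq] := dpsi _ e20.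
exists (Num.min r q); first by rewrite lt_min r0.
move=> w; rewrite lt_min => /andP[/Hr wr /Hq wq].
have -> : phi (z + w) - psi (z + w) - (phi z - psi z) - (c - d) * w =
  (phi (z + w) - phi z - c * w) - (psi (z + w) - psi z - d * w) by ring.
apply: (le_trans (normcB _ _)); apply: (le_trans (lerD wr wq)).
by rewrite -mulrDl -splitr.
Qed.

Lemma cdiff_translater phi z v d : cdiff phi (z + v) d ->
  cdiff (fun w => phi (w + v)) z d.
Proof.
by move=> dphi e /dphi[r r0 H]; exists r => // u /H; rewrite (addrAC z v u).
Qed.

Lemma differentiable_translate phi z w :
  differentiable phi (z + w) -> differentiable (fun u => phi (z + u)) w.
Proof.
move=> /differentiable_cdiff dphi; apply: (@cdiff_differentiable _ _ ('D_1 phi (z + w))).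
by move=> e /dphi[r r0 H]; exists r => // u /H; rewrite addrA.
Qed.

Lemma derive_ineq phi z rho M : 0 < rho ->
  (forall w, in_square rho w -> differentiable phi (z + w)) ->
  (forall w, in_square rho w -> normc (phi (z + w)) <= M) ->
  normc ('D_1 phi z) <= 8 * M / rho.
Proof.
move=> rho0 dphi phiM.
have c0 : in_square rho 0 by split => /=; lra.
have := @cauchy_ineq R (fun w => phi (z + w) - phi z) ('D_1 phi z) 1 rho (M + M) rho0.
have -> : 4 * (M + M) = 8 * M by ring.
apply.
- move=> w /dphi /differentiable_translate dw.
  by apply: differentiableB => //; exact: differentiable_cst.
- move=> w wr; apply: (le_trans (normcB _ _)); apply: lerD; first exact: phiM.
  by rewrite -[z in phi z]addr0; exact: phiM.
- have := dphi 0 c0; rewrite addr0 => /differentiable_cdiff dz e e0.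
  by have [r r0 Hr] := dz e e0; exists r => // w wr; rewrite !expr1; exact: Hr.
Qed.

(** By Cauchy's inequality the derivative is locally bounded, so phi is locally
    Lipschitz; hence w |-> phi(w + v) - phi(w) is O(v), and Cauchy's inequality
    applied to this difference makes the derivative Lipschitz in turn. *)
Lemma derive_continuous phi z :
  (\forall w \near z, differentiable phi w) -> {for z, continuous ('D_1 phi)}.
Proof.
move=> nphi.
have nM : \forall w \near z, normc (phi w) <= normc (phi z) + 1.
  have /differentiable_continuous cz := nbhs_singleton nphi.
  have /cvgrPdist_le /(_ 1 ltr01) := cz; apply: filterS => w.
  rewrite normr_normc lecE /= => /andP[_ n1].
  rewrite -[phi w](addrNK (phi z)) addrC; apply: (le_trans (normcD _ _)).
  by rewrite lerD2l -normcNE opprB.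
have /nbhs_normcP[r r0 H] : \forall w \near z, differentiable phi w /\ normc (phi w) <= normc (phi z) + 1.
  by apply: filterS2 nphi nM.
set M := normc (phi z) + 1 in H.
have {}H w : normc w < r -> differentiable phi (z + w) /\ normc (phi (z + w)) <= M.
  move=> wr; apply: H; rewrite opprD addNKr normrN normr_normc ltcR//.
pose rho := r / 16; have rho0 : 0 < rho by rewrite /rho; lra.
have bound w : normc w < r / 2 -> normc ('D_1 phi (z + w)) <= 8 * M / rho.
  move=> wr; apply: (derive_ineq rho0) => u /in_square_normc ur; rewrite -addrA; apply H.
    apply: (le_lt_trans (normcD _ _)); rewrite /rho in ur; lra.
  by apply: (le_lt_trans (normcD _ _)); rewrite /rho in ur; lra.
pose L := 8 * M / rho.
have L0 : 0 <= L by apply: le_trans (bound 0 _); rewrite ?normc_ge0// normc0; lra.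
have lip v w : normc v < r / 4 -> normc w < r / 4 ->
   normc (phi (z + w + v) - phi (z + w)) <= 2 * L * normc v.
  move=> vr wr; apply: mean_value_ineq => t /andP[t0 t1]; rewrite -addrA.
    apply: (H _ _).1; apply: (le_lt_trans (normcD _ _)).
    rewrite normcM normc_real ger0_norm//.
    have := ler_wpM2r (normc_ge0 v) t1; lra.
  apply: bound; apply: (le_lt_trans (normcD _ _)).
  rewrite normcM normc_real ger0_norm//.
  have := ler_wpM2r (normc_ge0 v) t1; lra.
have dlip v : normc v < rho -> normc ('D_1 phi (z + v) - 'D_1 phi z) <= 8 * (2 * L * normc v) / rho.
  move=> vr.
  pose chi w := phi (w + v) - phi w.
  have dchi w : in_square rho w -> differentiable phi (z + w + v) /\ differentiable phi (z + w).
    move=> /in_square_normc wr; split; last by apply: (H _ _).1; rewrite /rho in wr; lra.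
    rewrite -addrA; apply: (H _ _).1; apply: (le_lt_trans (normcD _ _)); rewrite /rho in vr wr; lra.
  have cchi w : in_square rho w ->
      cdiff chi (z + w) ('D_1 phi (z + w + v) - 'D_1 phi (z + w)).
    move=> /dchi[/differentiable_cdiff d1 /differentiable_cdiff d2].
    exact: (cdiffB (cdiff_translater d1) d2).
  have c0 : in_square rho 0 by split => /=; lra.
  have := cchi 0 c0; rewrite !addr0 => /cdiff_derive <-.
  apply: (derive_ineq rho0) => w wr; first exact: cdiff_differentiable (cchi w wr).
  move/in_square_normc in wr; apply: lip; rewrite /rho in vr wr; lra.
suff : 'D_1 phi w @[w --> z] --> 'D_1 phi z by [].
apply/(@cvgrPdist_le _ _ _ _ (nbhs_filter z)) => e e0.
have eE : e = (complex.Re e)%:C by rewrite RRe_real// gtr0_real.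
have e0' : 0 < complex.Re e by rewrite -ltcR -eE.
pose d := Num.min rho (complex.Re e * rho / (16 * L + 1)).
have l1 : 0 < 16 * L + 1 by lra.
have d0 : 0 < d by rewrite /d lt_min rho0/= divr_gt0// mulr_gt0.
apply/nbhs_normcP; exists d => // w.
rewrite normr_normc ltcR => wd.
rewrite eE normr_normc lecR.
have wr : normc (w - z) < rho.
  by rewrite -normcNE opprB; apply: (lt_le_trans wd); rewrite ge_min lexx.
have zw : z + (w - z) = w by rewrite addrC subrK.
have nzw : normc (w - z) = normc (z - w) by rewrite -normcNE opprB.
have dl := dlip _ wr; rewrite zw nzw in dl.
rewrite -normcNE opprB; apply: (le_trans dl).
have : normc (z - w) <= complex.Re e * rho / (16 * L + 1).
  by apply: (le_trans (ltW wd)); rewrite ge_min lexx orbT.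
rewrite ler_pdivlMr// ler_pdivrMr//; have := normc_ge0 (z - w).
clear; nra.
Qed.

Lemma is_derive_monomial c w m :
  is_derive w (1 : R[i]) (fun w => (c / m.+1%:R) * w ^+ m.+1) (c * w ^+ m).
Proof.
have n0 : (m.+1%:R : R[i]) != 0 by rewrite pnatr_eq0.
have dX := @exp_derive R[i] m.+1 w 1.
have : is_derive w 1 ((c / m.+1%:R) \*: (@GRing.exp R[i])^~ m.+1) ((c / m.+1%:R) *: (m.+1%:R *: w ^+ m)).
  have := is_deriveZ (c / m.+1%:R) (derivableP (@exprn_derivable R[i] m.+1 w 1)).
  by rewrite dX /= /GRing.scale /= mulr1.
move=> hd; apply: (is_derive_eq hd).
by rewrite /GRing.scale /= mulrA divfK.
Qed.

(** Cauchy's inequality when the leading term is that of the derivative: by the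
    mean value inequality psi - psi(0) has the leading term c w^(m+1) / (m+1). *)
Lemma cauchy_ineq_derive psi c m rho M : 0 < rho ->
  (forall z, in_square rho z -> differentiable psi z) ->
  (forall z, in_square rho z -> normc (psi z) <= M) -> leading c m ('D_1 psi) ->
  normc c <= m.+1%:R * (8 * M / rho ^+ m.+1).
Proof.
move=> rho0 dpsi psiM H.
have n0 : (m.+1%:R : R[i]) != 0 by rewrite pnatr_eq0.
pose q : R[i] -> R[i] := fun w => (c / m.+1%:R) * w ^+ m.+1.
have dq w : is_derive w (1 : R[i]) q (c * w ^+ m) := is_derive_monomial c w m.
have Hp : leading (c / m.+1%:R) m.+1 (fun w => psi w - psi 0).
  move=> e e0; have [r r0 Hr] := H (e / 2) ltac:(lra).
  exists (Num.min r rho); first by rewrite lt_min r0.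
  move=> w; rewrite lt_min => /andP[wr wrho].
  have tw (t : R) : 0 <= t <= 1 -> normc (t%:C * w) <= normc w.
    move=> /andP[t0 t1]; rewrite normcM normc_real ger0_norm//.
    by rewrite ler_piMl// normc_ge0.
  have cq (t : R) : 0 <= t <= 1 -> cdiff (fun w => psi w - q w) (0 + t%:C * w)
      ('D_1 psi (0 + t%:C * w) - c * (0 + t%:C * w) ^+ m).
    move=> t01; apply: (cdiffB _ (is_derive_cdiff (dq _))).
    apply: differentiable_cdiff; apply: dpsi; rewrite add0r; apply: normc_in_square.
    exact: le_trans (tw t t01) (ltW wrho).
  have mv : normc (psi (0 + w) - q (0 + w) - (psi 0 - q 0)) <=
      2 * (e / 2 * normc w ^+ m) * normc w.
    apply: (mean_value_ineq (fun t t01 => cdiff_differentiable (cq t t01))) => t t01.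
    rewrite (cdiff_derive (cq t t01)) add0r.
    apply: (le_trans (Hr _ (le_lt_trans (tw t t01) wr))).
    rewrite ler_wpM2l//; first by lra.
    by rewrite lerXn2r ?nnegrE ?normc_ge0// tw.
  have -> : psi w - psi 0 - c / m.+1%:R * w ^+ m.+1 =
      psi (0 + w) - q (0 + w) - (psi 0 - q 0).
    by rewrite add0r /q expr0n /= mulr0; ring.
  by apply: (le_trans mv); rewrite exprS le_eqVlt; apply/orP; left; apply/eqP; field.
have c0 : in_square rho 0 by split => /=; lra.
have dpsi0 z : in_square rho z -> differentiable (fun w => psi w - psi 0) z.
  move=> zr; exact: (differentiableB (dpsi z zr) (@differentiable_cst _ _ _ (psi 0) z)).
have psi0M z : in_square rho z -> normc (psi z - psi 0) <= M + M.
  by move=> zr; apply: (le_trans (normcB _ _)); apply: lerD; exact: psiM.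
have m0 : 0 < m.+1%:R :> R by rewrite ltr0n.
have nm : normc (m.+1%:R : R[i]) = m.+1%:R.
  by have := @normc_real R m.+1%:R; rewrite rmorph_nat => ->; rewrite ger0_norm.
have := @cauchy_ineq R _ _ m.+1 rho (M + M) rho0 dpsi0 psi0M Hp.
rewrite normcM normcV nm ler_pdivrMr// mulrC.
have -> // : 4 * (M + M) = 8 * M by ring.
Qed.

End DerivativeContinuity.

(** * Holomorphic functions along complex lines and rays *)

Section Slices.
Context (R : realType) (n : nat).
Local Notation Cn := 'rV[R[i]]_n.
Local Notation lambda := (@lebesgue_measure R).
Implicit Types (Omega : set Cn) (f g : Cn -> R[i]) (z v : Cn) (c w : R[i]).

Lemma convexE Omega z v (t : R) : convex Omega -> Omega z -> Omega v ->
  0 <= t <= 1 -> Omega (t%:C *: z + (1 - t)%:C *: v).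
Proof.
move=> cO Oz Ov /andP[t0 t1].
have t0' : 0 <= t%:C by rewrite lecR.
have t1' : t%:C <= 1 by rewrite [1](_ : _ = 1%:C)// lecR.
have /set_mem := cO z v (Itv01 t0' t1') (mem_set Oz) (mem_set Ov).
by congr (Omega _); congr (_ + _); rewrite rmorphB.
Qed.

Lemma is_derive_dir f z v d : is_derive z v f d -> forall e : R, 0 < e ->
  exists2 r : R, 0 < r & forall w, normc w < r ->
    normc (f (w *: v + z) - f z - d * w) <= e * normc w.
Proof.
move=> [dh <-] e e0.
move/cvgrPdist_le : dh => /(_ e%:C); rewrite ltcR => /(_ e0).
rewrite -/(dnbhs _) /dnbhs /within /= => /nbhs_normcP[r r0 H].
exists r => // w wr; have [->|w0] := eqVneq w 0.
  by rewrite scale0r add0r mulr0 subr0 subrr normc0 mulr0.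
have := H w; rewrite sub0r normrN normr_normc ltcR => /(_ wr w0).
rewrite normr_normc lecR => {}H.
have -> : f (w *: v + z) - f z - 'D_v f z * w =
   - (w * ('D_v f z - w^-1 * (f (w *: v + z) - f z))).
  by rewrite mulrBr mulrA mulfV// mul1r opprB [w * _]mulrC.
by rewrite normcNE normcM mulrC ler_wpM2r ?normc_ge0.
Qed.

(** On the complex line through z in the direction v, directional derivatives
    become derivatives in one complex variable. *)
Lemma cdiff_slice f z v w : differentiable f (z + w *: v) ->
  cdiff (fun u => f (z + u *: v)) w ('D_v f (z + w *: v)).
Proof.
move=> /(@diff_derivable _ _ _ _ _ v) /derivableP /is_derive_dir df e /df[r r0 H].
exists r => // u /H; rewrite addrCA -scalerDl (addrC u w).
by rewrite addrC addrC.
Qed.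

Lemma derive_dirZ f z v c : differentiable f z -> 'D_(c *: v) f z = c * 'D_v f z.
Proof. by move=> df; rewrite !deriveE// linearZ. Qed.

Lemma radialE f z : differentiable f z -> radial f z = 'D_z f z.
Proof.
move=> df.
have -> : 'D_z f z = 'd f z (\sum_(j < n) z 0 j *: delta_mx 0 j).
  by rewrite -row_sum_delta deriveE.
rewrite linear_sum; apply: eq_bigr => k _.
by rewrite -(derive_dirZ _ _ df) (deriveE _ df).
Qed.

Lemma slice_near Omega z v w : open Omega -> Omega (z + w *: v) ->
  \forall u \near w, Omega (z + u *: v).
Proof.
move=> oO Oz.
have : (fun u : R[i] => z + u *: v) @ w --> z + w *: v.
  have c1 : (fun _ : R[i] => z) @ w --> z by exact: (@cvg_cst _ _ _ _ (nbhs_filter w)).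
  exact: (@cvgD _ _ _ _ (nbhs_filter w) _ _ _ _ c1 (@scalel_continuous _ _ v w)).
by apply; exact: open_nbhs_nbhs.
Qed.

Lemma slice_derive_continuous Omega f z v w : open Omega -> holomorphic Omega f ->
  Omega (z + w *: v) -> (fun u => 'D_v f (z + u *: v)) @ w --> 'D_v f (z + w *: v).
Proof.
move=> oO hf Oz; have nO := slice_near oO Oz.
pose phi u := f (z + u *: v).
have nphi : \forall u \near w, differentiable phi u.
  apply: filterS nO => u /hf /cdiff_slice; exact: cdiff_differentiable.
have dphi : \forall u \near w, 'D_1 phi u = 'D_v f (z + u *: v).
  apply: filterS nO => u /hf /cdiff_slice; exact: cdiff_derive.
have := derive_continuous nphi.
have -> : 'D_v f (z + w *: v) = 'D_1 phi w by rewrite (nbhs_singleton dphi).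
by apply: cvg_trans; exact: (@near_eq_cvg _ _ _ (nbhs_filter w) _ _ dphi).
Qed.

End Slices.

Section Rays.
Context (R : realType) (n : nat).
Local Notation Cn := 'rV[R[i]]_n.
Local Notation lambda := (@lebesgue_measure R).
Implicit Types (Omega : set Cn) (f g : Cn -> R[i]) (z v : Cn) (c w : R[i]).

Lemma Rintegral_scale (G : R -> R) (t : R) : 0 < t -> {in `[0, t], continuous G} ->
  \int[lambda]_(x in `[0, t]) G x = \int[lambda]_(x in `[0, 1]) (t * G (t * x)).
Proof.
move=> t0 cG; pose F x := t * x.
have dF (x : R) : is_derive x 1 F t.
  have := is_deriveZ t (is_derive_id x (1 : R)).
  by rewrite /GRing.scale /= mulr1.
have F' : F^`()%classic = cst t.
  by apply/funext => x; rewrite derive1E; have [_ ->] := dF x.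
have Fc (x : R) : {for x, continuous F}.
  by apply/differentiable_continuous/derivable1_diffP; have [] := dF x.
have := @integration_by_substitution_increasing R F G 0 1 ler01.
rewrite F' /F mulr0 mulr1 => sub.
rewrite /Rintegral sub; first last.
- by apply: continuous_in_subspaceT => x; rewrite inE /= => /cG.
- split; first by move=> x _; have [] := dF x.
    exact: cvg_at_right_filter (Fc 0).
  exact: cvg_at_left_filter (Fc 1).
- exact: is_cvg_cst.
- exact: is_cvg_cst.
- by move=> x _; exact: cvg_cst.
- by move=> x y _ _ xy; rewrite ltr_pM2l.
by congr fine; apply: eq_integral => x _ /=; rewrite mulrC.
Qed.

End Rays.

Section Rays.
Context (R : realType) (n : nat).
Local Notation Cn := 'rV[R[i]]_n.
Local Notation lambda := (@lebesgue_measure R).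
Implicit Types (Omega : set Cn) (f g F : Cn -> R[i]) (z v : Cn) (c w : R[i]).

Lemma Re_realM (a : R) w : complex.Re (a%:C * w) = a * complex.Re w.
Proof. by case: w => x y /=; rewrite mul0r subr0. Qed.

Lemma Im_realM (a : R) w : complex.Im (a%:C * w) = a * complex.Im w.
Proof. by case: w => x y /=; rewrite mul0r addr0. Qed.

Lemma Rintegral_scale_oc (G : R -> R) (t : R) : 0 < t -> {in `[0, t], continuous G} ->
  \int[lambda]_(x in `]0, 1]) (t * G (t * x)) = \int[lambda]_(x in `[0, t]) G x.
Proof.
move=> t0 cG; rewrite Rintegral_scale//.
have cH : {within `[0, 1], continuous (fun x => t * G (t * x))}.
  apply: continuous_in_subspaceT => x; rewrite inE /= in_itv /= => /andP[x0 x1].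
  have ct : {for t * x, continuous G}.
    by apply: cG; rewrite in_itv /= mulr_ge0 ?(ltW t0)//= ler_piMr// ltW.
  apply: cvgM; first exact: cvg_cst.
  have cx : (fun y => t * y) @ x --> t * x.
    by apply: cvgM; [exact: cvg_cst|exact: cvg_id].
  exact: (cvg_comp _ _ cx ct).
apply: (@Rintegral_itv_obnd_cbnd R 0 (BRight 1) (fun x => t * G (t * x))).
have i1 : lambda.-integrable `[0, 1] (EFin \o (fun x => t * G (t * x))).
  by apply: continuous_compact_integrable => //; exact: segment_compact.
apply: integrableS i1 => //.
by apply: subset_itvr; rewrite bnd_simp.
Qed.

(** Substituting s = t u in the defining integral gives, for t > 0,
    F(t z) = \int_0^t 'D_z f (u z) g (u z) du; differentiating at t = 1 yields
    R(C_g f) = g R f. Everything is used slightly beyond t = 1, where the ray is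
    still inside Omega. *)
Lemma Cop_derive Omega f g F z : open Omega -> convex Omega -> Omega 0 ->
  holomorphic Omega f -> holomorphic Omega g -> Omega z -> differentiable F z ->
  (forall v, Omega v -> F v = Cop g f v) -> 'D_z F z = 'D_z f z * g z.
Proof.
move=> oO cO O0 hf hg Oz dF FE.
pose q (u : R) : R[i] := 'D_z f (0 + u%:C *: z) * g (0 + u%:C *: z).
have [d d0 Od] : exists2 d : R, 0 < d & forall u : R, 0 <= u <= 1 + d -> Omega (0 + u%:C *: z).
  have O1 : Omega (0 + (1 : R[i]) *: z) by rewrite add0r scale1r.
  have /nbhs_normcP[r r0 H] := slice_near oO O1.
  exists (r / 2); first by rewrite divr_gt0.
  move=> u /andP[u0 u1]; have [ul1|u1'] := leP u 1.
    have := convexE cO Oz O0 (t := u); rewrite scaler0 addr0 add0r; apply.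
    by rewrite u0.
  apply: H; rewrite [1](_ : _ = 1%:C)// -rmorphB normr_normc ltcR normc_real.
  by rewrite ltr0_norm ?subr_lt0// opprB; clear -r0 u1; lra.
have cq (u : R) : 0 <= u <= 1 + d -> q @ u --> q u.
  move=> ud; have Ou := Od u ud.
  have cu : (fun u : R => u%:C) @ u --> (u%:C : R[i]).
    exact: cvg_real_complex cvg_id.
  have c1 := cvg_comp _ _ cu (slice_derive_continuous oO hf Ou).
  have /cdiff_slice/cdiff_differentiable/differentiable_continuous c2 := hg _ Ou.
  exact: cvgM c1 (cvg_comp _ _ cu c2).
have cqRe (t : R) : t <= 1 + d -> {in `[0, t], continuous (fun u => complex.Re (q u))}.
  move=> td u; rewrite in_itv /= => /andP[u0 ut].
  have /cvg_ReIm[]// : q @ u --> q u.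
  by apply: cq; rewrite u0 (le_trans ut).
have cqIm (t : R) : t <= 1 + d -> {in `[0, t], continuous (fun u => complex.Im (q u))}.
  move=> td u; rewrite in_itv /= => /andP[u0 ut].
  have /cvg_ReIm[]// : q @ u --> q u.
  by apply: cq; rewrite u0 (le_trans ut).
have Fint (t : R) : 0 < t -> t <= 1 + d ->
   complex.Re (F (0 + t%:C *: z)) = \int[lambda]_(x in `[0, t]) complex.Re (q x) /\
   complex.Im (F (0 + t%:C *: z)) = \int[lambda]_(x in `[0, t]) complex.Im (q x).
  move=> t0 td.
  have Ot : Omega (0 + t%:C *: z) by apply: Od; rewrite (ltW t0).
  rewrite FE// /Cop.
  (* the factor t s of the radial derivative cancels the denominator s *)
  have E (s : R) : 0 < s <= 1 ->
     radial f (s%:C *: (0 + t%:C *: z)) * g (s%:C *: (0 + t%:C *: z)) / s%:C =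
     t%:C * q (t * s).
    move=> /andP[s0 s1].
    have sc : s%:C *: (0 + t%:C *: z) = 0 + (t * s)%:C *: z.
      by rewrite !add0r scalerA -rmorphM mulrC.
    have Os : Omega (0 + (t * s)%:C *: z).
      apply: Od; rewrite mulr_ge0 ?(ltW t0) ?(ltW s0)//=.
      by apply: le_trans td; rewrite ler_piMr// ltW.
    rewrite sc (radialE (hf _ Os)).
    have sc' : 0 + (t * s)%:C *: z = (t * s)%:C *: z by rewrite add0r.
    have -> : 'D_(0 + (t * s)%:C *: z) f (0 + (t * s)%:C *: z) =
        (t * s)%:C * 'D_z f (0 + (t * s)%:C *: z).
      by rewrite -(derive_dirZ z (t * s)%:C (hf _ Os)); congr ('D__ _ _).
    rewrite /q.
    have sne : s%:C != 0 :> R[i] by rewrite eq_complex /= gt_eqF.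
    by rewrite rmorphM; field.
  split.
    rewrite -(Rintegral_scale_oc t0 (cqRe t td)) /cintegral /=.
    apply: eq_Rintegral => s; rewrite inE /= in_itv /= => /E ->.
    exact: Re_realM.
  rewrite -(Rintegral_scale_oc t0 (cqIm t td)) /cintegral /=.
  apply: eq_Rintegral => s; rewrite inE /= in_itv /= => /E ->.
  exact: Im_realM.
have FTC (G : R -> R) (H : R -> R) : {in `[0, 1 + d], continuous G} ->
    (forall t : R, 0 < t -> t <= 1 + d -> H t = \int[lambda]_(x in `[0, t]) G x) ->
    'D_1 H 1 = G 1.
  move=> cG HE.
  have iG : lambda.-integrable `[0, 1 + d] (EFin \o G).
    apply: continuous_compact_integrable; first exact: segment_compact.
    by apply: continuous_in_subspaceT => x; rewrite inE /= => /cG.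
  have l1 : 1 < 1 + d by rewrite ltrDl.
  have cG1 : {for 1, continuous G} by apply: cG; rewrite in_itv /= ler01 ltW.
  have [D1 D2] := continuous_FTC1_closed l1 iG ltr01 cG1.
  rewrite -D2 derive1E; apply: near_eq_derive.
  near=> t; apply: HE; last by rewrite ltW//; near: t; exact: lt_nbhsl.
  by near: t; exact: lt_nbhsr.
have dF1 : differentiable F (0 + (0 + (1:R)%:C * (1 : R[i])) *: z).
  by rewrite !add0r mulr1 scale1r.
have cF := cdiff_slice dF1.
have [DRe DIm] := @is_derive_line R (fun u => F (0 + u *: z)) 0 1 1 (cdiff_differentiable cF).
have dd : 1 <= 1 + d by rewrite lerDl ltW.
have tE (t : R) : 0 + t%:C * 1 = t%:C :> R[i] by rewrite add0r mulr1.
have RE : complex.Re ('D_z F z) = complex.Re (q 1).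
  have := FTC _ (fun t => complex.Re (F (0 + (0 + t%:C * 1) *: z))) (cqRe _ (lexx _)).
  move=> <-; last by move=> t t0 td; rewrite tE; exact: (Fint t t0 td).1.
  case: DRe => _ ->; by rewrite (cdiff_derive cF) !mulr1 !add0r scale1r.
have IE : complex.Im ('D_z F z) = complex.Im (q 1).
  have := FTC _ (fun t => complex.Im (F (0 + (0 + t%:C * 1) *: z))) (cqIm _ (lexx _)).
  move=> <-; last by move=> t t0 td; rewrite tE; exact: (Fint t t0 td).2.
  case: DIm => _ ->; by rewrite (cdiff_derive cF) !mulr1 !add0r scale1r.
have q1 : q 1 = 'D_z f z * g z by rewrite /q add0r scale1r.
rewrite -q1; move: RE IE; case: ('D_z F z) => a b; case: (q 1) => a' b' /= -> ->//.
Unshelve. all: by end_near.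
Qed.

End Rays.

(** * Borel sets of C^n *)

Section OpenMeasurable.
Context (R : realType) (N : nat).
Local Notation CN := 'rV[R[i]]_N.

Lemma nbhs_rV_ReIm (v : CN) (U : set CN) : nbhs v U ->
  exists2 r : R, 0 < r & forall u : CN,
    (forall k, `|complex.Re (v 0 k - u 0 k)| < r /\ `|complex.Im (v 0 k - u 0 k)| < r) ->
    U u.
Proof.
move=> /nbhs_normcP[d d0 dU]; exists (d / 2); first by rewrite divr_gt0.
move=> u H; apply: dU; rewrite [X in X < _](_ : _ = mx_norm (v - u))//.
have [->|vu0] := eqVneq (mx_norm (v - u)) 0; first by rewrite ltcR.
have [[i j] /= ->] := mx_norm_neq0 vu0.
rewrite normr_normc ltcR; apply: (le_lt_trans (normc_ReIm _)).
by rewrite (splitr d) ord1 !mxE; have [H1 H2] := H j; rewrite ltrD.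
Qed.

(** Boxes with rational centers and radii 1/(m+1): countably many, and they
    generate the topology. *)
Definition ratbox (q : {ffun 'I_N -> rat * rat} * nat) : set CN :=
  [set u | forall k, `|ratr (q.1 k).1 - complex.Re (u 0 k)| < q.2.+1%:R^-1 /\
                     `|ratr (q.1 k).2 - complex.Im (u 0 k)| < q.2.+1%:R^-1].

Lemma open_ratbox (U : set CN) : open U ->
  U = \bigcup_(q in [set q | ratbox q `<=` U]) ratbox q.
Proof.
move=> oU; apply/seteqP; split=> [v Uv|v [q qU /qU]//].
have [r r0 rU] := nbhs_rV_ReIm (open_nbhs_nbhs (conj oU Uv)).
have [m mr] : exists m : nat, (m.+1%:R^-1 : R) < r / 2.
  have r20 : 0 < r / 2 by rewrite divr_gt0.
  exists (Num.trunc (r / 2)^-1); rewrite invf_plt ?posrE// truncnS_gt//.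
have m0 : 0 < (m.+1%:R^-1 : R) by rewrite invr_gt0 ltr0n.
have app (x : R) : exists q : rat, `|ratr q - x| < (m.+1%:R^-1 : R).
  have /rat_in_itvoo[q] : x < x + m.+1%:R^-1 by rewrite ltrDl.
  rewrite in_itv /= => /andP[q1 q2]; exists q.
  by rewrite gtr0_norm ?subr_gt0// ltrBlDl.
have /choice[a Ha] : forall k : 'I_N, exists q : rat * rat,
    `|ratr q.1 - complex.Re (v 0 k)| < (m.+1%:R^-1 : R) /\
    `|ratr q.2 - complex.Im (v 0 k)| < (m.+1%:R^-1 : R).
  move=> k; have [q1 h1] := app (complex.Re (v 0 k)).
  by have [q2 h2] := app (complex.Im (v 0 k)); exists (q1, q2).
exists ([ffun k => a k], m) => /=; last by move=> k; rewrite ffunE.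
move=> u Hu; apply: rU => k.
have [h1 h2] := Ha k; have /= [h3 h4] := Hu k; rewrite ffunE in h3 h4.
have tri (x y w : R) : `|w - x| < (m.+1%:R^-1 : R) -> `|w - y| < (m.+1%:R^-1 : R) ->
    `|x - y| < r.
  move=> wx wy; have -> : x - y = (w - y) - (w - x) by ring.
  apply: (le_lt_trans (ler_normB _ _)); rewrite (splitr r).
  by rewrite ltrD// (lt_trans _ mr).
by rewrite !raddfB; split; [exact: tri h1 h3|exact: tri h2 h4].
Qed.

(** Row vectors carry no sigma-algebra, so Borel measurability of a map to C^n is
    expressed by that of its real coordinates. *)
Lemma measurable_open_preimage d (T : measurableType d) (X : T -> CN) (U : set CN) :
  (forall k, measurable_fun [set: T] (fun x => complex.Re (X x 0 k) : measurableTypeR R)) ->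
  (forall k, measurable_fun [set: T] (fun x => complex.Im (X x 0 k) : measurableTypeR R)) ->
  open U -> measurable (X @^-1` U).
Proof.
move=> mRe mIm oU; rewrite (open_ratbox oU) preimage_bigcup bigcup_mkcond.
apply: countable_bigcupT_measurable; first exact: (@countableP ({ffun _} * nat)%type).
move=> q; case: ifPn => // _.
have -> : X @^-1` ratbox q = \bigcap_(k in [set: 'I_N])
   ((fun x => complex.Re (X x 0 k)) @^-1` `]ratr (q.1 k).1 - q.2.+1%:R^-1, ratr (q.1 k).1 + q.2.+1%:R^-1[ `&`
    (fun x => complex.Im (X x 0 k)) @^-1` `]ratr (q.1 k).2 - q.2.+1%:R^-1, ratr (q.1 k).2 + q.2.+1%:R^-1[).
  apply/seteqP; split => [x /= H k _|x /= H k].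
    by have [h1 h2] := H k; rewrite /= !in_itv /= -!ltr_distlC.
  by have /= [] := H k I; rewrite !in_itv /= -!ltr_distlC.
apply: fin_bigcap_measurable => // k _; apply: measurableI.
- by rewrite -[X in measurable X]setTI; exact: mRe.
- by rewrite -[X in measurable X]setTI; exact: mIm.
Qed.

End OpenMeasurable.

(** * Tonelli's theorem for the volume *)

Section Volume.
Context (R : realType).
Local Notation line := (measurableTypeR R).
Local Notation plane := (line * line)%type.
Local Notation lambda := (@lebesgue_measure R).

Definition cube n (r : R) : set (n.-tuple plane) :=
  [set t | forall k, - r <= (tnth t k).1 <= r /\ - r <= (tnth t k).2 <= r].

Lemma measurable_coord n (k : 'I_n) :
  measurable_fun setT (fun t : n.-tuple plane => (tnth t k).1) /\
  measurable_fun setT (fun t : n.-tuple plane => (tnth t k).2).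
Proof.
have mt : measurable_fun setT (fun t : n.-tuple plane => tnth t k) by exact: measurable_tnth.
split; first exact: measurableT_comp measurable_fst mt.
exact: measurableT_comp measurable_snd mt.
Qed.

Lemma measurable_cube n r : measurable (@cube n r).
Proof.
have -> : @cube n r = \bigcap_(k in [set: 'I_n])
   ((fun t : n.-tuple plane => (tnth t k).1) @^-1` `[- r, r] `&`
    (fun t : n.-tuple plane => (tnth t k).2) @^-1` `[- r, r]).
  apply/seteqP; split => [t H k _|t H k].
    by have [h1 h2] := H k; rewrite /= !in_itv.
  by have /= [] := H k I; rewrite !in_itv.
apply: fin_bigcap_measurable => // k _; have [m1 m2] := measurable_coord k.
apply: measurableI.
- by rewrite -[X in measurable X]setTI; exact: m1.
- by rewrite -[X in measurable X]setTI; exact: m2.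
Qed.

Lemma consC_cube n (r : R) (p : n.-tuple plane * line * line) :
  cube r (consC p) <-> (cube r p.1.1 /\ - r <= p.1.2 <= r) /\ - r <= p.2 <= r.
Proof.
case: p => [[t x] y] /=; split => [H|[[H hx] hy] k].
  split; last by have [] := H ord0; rewrite tnth0.
  split; last by have [] := H ord0; rewrite tnth0.
  by move=> k; have := H (lift ord0 k); rewrite tnthS.
case: (unliftP ord0 k) => [j ->|->]; last by rewrite tnth0.
by rewrite tnthS; exact: H.
Qed.

Lemma lebesgue_segment_fin (a b : R) : (lambda (`[a, b] : set R) < +oo)%E.
Proof.
have -> := lebesgue_measure_itv `[a, b]; rewrite /=.
by case: ifP => _; rewrite ?ltry// -EFinB ltry.
Qed.

Lemma volume_cube_fin n r : (volume R n (@cube n r) < +oo)%E.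
Proof.
elim: n => [|n IH].
  by rewrite /= diracE ltry.
pose I : set line := `[- r, r]%classic.
have E : volume R n.+1 (@cube n.+1 r) =
    ((volume R n \x lambda) \x lambda)%E ((@cube n r `*` I) `*` I).
  transitivity (((volume R n \x lambda) \x lambda)%E (@consC R n @^-1` (@cube n.+1 r))) => //.
  congr (_ _); apply/seteqP; split => [p /consC_cube[[h1 h2] h3]|p [[h1 h2] h3]].
    by split; [split|]; rewrite /I //= in_itv.
  by apply/consC_cube; move: h2 h3; rewrite /I /= !in_itv.
have mI : measurable I by exact: measurable_itv.
have mC := @measurable_cube n r.
have e1 : ((volume R n \x lambda) \x lambda)%E ((@cube n r `*` I) `*` I) =
    ((volume R n \x lambda)%E (@cube n r `*` I) * lambda I)%E.
  by apply: product_measure1E => //; exact: measurableX.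
have e2 : (volume R n \x lambda)%E (@cube n r `*` I) =
    (volume R n (@cube n r) * lambda I)%E.
  exact: product_measure1E.
rewrite E e1 e2; have := lebesgue_segment_fin (- r) r => l.
have f1 : (volume R n (@cube n r)) \is a fin_num by rewrite ge0_fin_numE.
have f2 : lambda I \is a fin_num by rewrite ge0_fin_numE.
by rewrite -(fineK f1) -(fineK f2) -!EFinM ltry.
Qed.

(** Tonelli's theorem takes sigma-finite measures. The aliases vol and vol_line
    carry this structure for the volume and for its product with a line. *)
Definition vol n : set (n.-tuple plane) -> \bar R := volume R n.

HB.instance Definition _ n := Measure.copy (@vol n) (volume R n).

Lemma cubes_exhaust n (t : n.-tuple plane) :
  exists k : nat, forall j, (k <= j)%N -> @cube n j%:R t.
Proof.
pose M := \sum_(k < n) (`|(tnth t k).1| + `|(tnth t k).2|).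
exists (Num.trunc M).+1 => j jM k.
have kM : `|(tnth t k).1| + `|(tnth t k).2| <= M.
  rewrite /M (bigD1 k)//= lerDl; apply: sumr_ge0 => i _.
  by rewrite addr_ge0.
have MM : M <= j%:R.
  by apply: (le_trans (ltW (truncnS_gt M))); rewrite ler_nat.
have := normr_ge0 (tnth t k).1; have := normr_ge0 (tnth t k).2.
by split; rewrite -ler_norml; lra.
Qed.

Lemma sigma_finite_vol n : sigma_finite setT (@vol n).
Proof.
exists (fun k => @cube n k%:R); last first.
  by move=> k; split; [exact: measurable_cube|exact: volume_cube_fin].
apply/seteqP; split => // t _; have [k Hk] := cubes_exhaust t.
by exists k => //; exact: Hk.
Qed.

HB.instance Definition _ n := @Measure_isSigmaFinite.Build _ _ _ (@vol n) (@sigma_finite_vol n).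

Definition vol_line n : set (n.-tuple plane * line) -> \bar R := (@vol n \x lambda)%E.

HB.instance Definition _ n := Measure.copy (@vol_line n) (@vol n \x lambda)%E.

Lemma sigma_finite_vol_line n : sigma_finite setT (@vol_line n).
Proof.
pose J (k : nat) : set line := `[- k%:R, k%:R]%classic.
exists (fun k => @cube n k%:R `*` J k).
  apply/seteqP; split => // -[t x] _; have [k Hk] := cubes_exhaust t.
  exists (maxn k (Num.trunc `|x|).+1) => //; split => /=.
    by apply: Hk; rewrite leq_maxl.
  rewrite /J /= in_itv /= -ler_norml.
  apply: (le_trans (ltW (truncnS_gt `|x|))).
  by rewrite ler_nat leq_maxr.
move=> k; have mC := @measurable_cube n k%:R.
have mJ : measurable (J k) by exact: measurable_itv.
split; first exact: measurableX.
have -> : @vol_line n (@cube n k%:R `*` J k) = (volume R n (@cube n k%:R) * lambda (J k))%E.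
  exact: product_measure1E.
have f1 : (volume R n (@cube n k%:R)) \is a fin_num.
  by rewrite ge0_fin_numE// volume_cube_fin.
have f2 : lambda (J k) \is a fin_num by rewrite ge0_fin_numE// lebesgue_segment_fin.
by rewrite -(fineK f1) -(fineK f2) -!EFinM ltry.
Qed.

HB.instance Definition _ n :=
  @Measure_isSigmaFinite.Build _ _ _ (@vol_line n) (@sigma_finite_vol_line n).

Lemma measurable_iterated n (F : n.+1.-tuple plane -> \bar R) :
  measurable_fun [set: n.+1.-tuple plane] F -> (forall t, 0 <= F t)%E ->
  measurable_fun [set: n.-tuple plane]
    (fun t => \int[lambda]_x \int[lambda]_y F (consC (t, x, y)))%E.
Proof.
move=> mF F0.
have mG : measurable_fun [set: n.-tuple plane * line * line]
    (fun p : n.-tuple plane * line * line => F (consC p)).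
  exact: (measurableT_comp mF (@measurable_consC R n)).
have G0 (p : n.-tuple plane * line * line) : (0 <= F (consC p))%E by exact: F0.
have mK := @measurable_fun_fubini_tonelli_F _ _ _ _ _ lambda _ mG G0.
have K0 p : (0 <= fubini_F lambda
    (fun p : n.-tuple plane * line * line => F (consC p)) p)%E.
  by apply: integral_ge0.
exact: (@measurable_fun_fubini_tonelli_F _ _ _ _ _ lambda _ mK K0).
Qed.

(** The volume in dimension n + 1 is an iterated product by definition. *)
Lemma tonelli_volume n (F : n.+1.-tuple plane -> \bar R) :
  measurable_fun [set: n.+1.-tuple plane] F -> (forall t, 0 <= F t)%E ->
  (\int[volume R n.+1]_t F t =
   \int[volume R n]_t \int[lambda]_x \int[lambda]_y F (consC (t, x, y)))%E.
Proof.
move=> mF F0.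
have mG : measurable_fun [set: n.-tuple plane * line * line] (fun p : n.-tuple plane * line * line => F (consC p)).
  exact: (measurableT_comp mF (@measurable_consC R n)).
have G0 (p : n.-tuple plane * line * line) : (0 <= F (consC p))%E by exact: F0.
transitivity (\int[pushforward ((@vol n \x lambda) \x lambda) (@consC R n)]_t F t)%E.
  by [].
rewrite (ge0_integral_pushforward (@measurable_consC R n))//=.
rewrite preimage_setT.
have e1 := @fubini_tonelli1 _ _ _ _ _ (@vol_line n) lambda _ mG G0.
have mH := @measurable_fun_fubini_tonelli_F _ _ _ _ _ lambda _ mG G0.
have H0 p : (0 <= fubini_F lambda (fun p : n.-tuple plane * line * line => F (consC p)) p)%E.
  by apply: integral_ge0.
have e2 := @fubini_tonelli1 _ _ _ _ _ (@vol n) lambda _ mH H0.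
exact: etrans e1 e2.
Qed.

End Volume.

(** * Affine changes of variables *)

Lemma ge0_integralTZl (R : realType) d (T : measurableType d)
    (mu : {measure set T -> \bar R}) (k : R) (f : T -> \bar R) : 0 <= k ->
  measurable_fun setT f -> (forall x, 0 <= f x)%E ->
  (\int[mu]_x (k%:E * f x) = k%:E * \int[mu]_x f x)%E.
Proof. by move=> k0 mf f0; rewrite ge0_integralZl. Qed.

Section Affine.
Context (R : realType).
Local Notation line := (measurableTypeR R).
Local Notation plane := (line * line)%type.
Local Notation lambda := (@lebesgue_measure R).

Lemma measurable_affine (b r : R) : measurable_fun [set: line] (fun x : line => b + r * x : line).
Proof.
by apply: measurable_funD; [exact: measurable_cst|apply: measurable_funM; [exact: measurable_cst|exact: measurable_id]].
Qed.

(** By uniqueness of the Lebesgue measure it is enough to compare the two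
    measures on half-open intervals. *)
Lemma lebesgue_affine_set (b r : R) (A : set line) : r != 0 -> measurable A ->
  lambda A = (`|r|%:E * lambda ((fun x => (b + r * x)%R) @^-1` A))%E.
Proof.
move=> r0 mA.
pose m : {measure set line -> \bar R} := mscale (NngNum (normr_ge0 r))
  (measure_function_pushforward__canonical__measure_function_Measure lambda
    (measurable_affine b r)).
suff H : forall X : set R, ocitv X -> lambda X = m X.
  exact: (@lebesgue_measure_unique R m H A mA).
move=> X [[c d] _ <-] /=.
rewrite /m /mscale /= /pushforward.
have n0 : 0 < `|r| by rewrite normr_gt0.
pose i : interval R := if 0 < r then `](c - b) / r, (d - b) / r]
                   else `[(d - b) / r, (c - b) / r[.
have -> : (fun x : R => b + r * x) @^-1` `]c, d] = [set` i].
  rewrite /i; case: ifPn => rs.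
    apply/seteqP; split => x /=; rewrite !in_itv /= ltr_pdivrMr// ler_pdivlMr// (mulrC x);
    by rewrite ltrBlDl lerBrDl.
  have {}rs : r < 0 by rewrite lt_neqAle r0 leNgt.
  apply/seteqP; split => x /=; rewrite !in_itv /= ltr_ndivlMr// ler_ndivrMr// (mulrC x);
  by rewrite ltrBlDl lerBrDl andbC.
have -> := lebesgue_measure_itv `]c, d]; have -> := lebesgue_measure_itv i.
rewrite /i; case: (boolP (0 < r)) => rs; rewrite /= !lte_fin.
  rewrite ltr_pdivlMr// divfK// ltrD2r; case: ifPn => _; last by rewrite mule0.
  rewrite -!EFinB -EFinM (gtr0_norm rs); congr (_%:E); field; lra.
have {}rs : r < 0 by rewrite lt_neqAle r0 leNgt.
rewrite ltr_ndivlMr// divfK// ltrD2r; case: ifPn => _; last by rewrite mule0.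
rewrite -!EFinB -EFinM (ltr0_norm rs); congr (_%:E); field; lra.
Qed.

Lemma lebesgue_affine (b r : R) (F : line -> \bar R) : r != 0 ->
  measurable_fun setT F -> (forall x, 0 <= F x)%E ->
  (\int[lambda]_x F (b + r * x)%R = (`|r|^-1)%:E * \int[lambda]_x F x)%E.
Proof.
move=> r0 mF F0.
pose p := measure_function_pushforward__canonical__measure_function_Measure lambda
    (measurable_affine b r).
have -> : (\int[lambda]_x F x = \int[mscale (NngNum (normr_ge0 r)) p]_x F x)%E.
  by apply: eq_measure_integral => A mA _; exact: lebesgue_affine_set.
rewrite ge0_integral_mscale//= (ge0_integral_pushforward (measurable_affine b r))//=.
rewrite preimage_setT muleA -EFinM mulVf ?normr_eq0// mul1e.
by [].
Qed.

Definition tuple_affine n (b : 'I_n -> R * R) (r : R) (t : n.-tuple plane) :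
    n.-tuple plane :=
  [tuple ((b k).1 + r * (tnth t k).1, (b k).2 + r * (tnth t k).2) | k < n].

Lemma measurable_tuple_affine n b r :
  measurable_fun [set: n.-tuple plane] (@tuple_affine n b r).
Proof.
apply/measurable_fun_tnthP => k; have [m1 m2] := @measurable_coord R n k.
have -> : (@tnth n plane)^~ k \o tuple_affine b r =
    (fun t => ((b k).1 + r * (tnth t k).1, (b k).2 + r * (tnth t k).2)).
  by apply/funext => t; rewrite /= tnth_mktuple.
apply: measurable_fun_pair.
- exact: (measurableT_comp (measurable_affine (b k).1 r) m1).
- exact: (measurableT_comp (measurable_affine (b k).2 r) m2).
Qed.

Lemma tuple_affine_consC n b r (p : n.-tuple plane * line * line) :
  tuple_affine b r (consC p) =
  consC (tuple_affine (fun k => b (lift ord0 k)) r p.1.1,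
         (b ord0).1 + r * p.1.2, (b ord0).2 + r * p.2).
Proof.
apply: eq_from_tnth => k; rewrite tnth_mktuple.
case: (unliftP ord0 k) => [j ->|->]; last by rewrite !tnth0.
by rewrite !tnthS tnth_mktuple.
Qed.

(** The exponent 2n is the real dimension. *)
Lemma volume_affine n b r (F : n.-tuple plane -> \bar R) : r != 0 ->
  measurable_fun [set: n.-tuple plane] F -> (forall t, 0 <= F t)%E ->
  (\int[volume R n]_t F (tuple_affine b r t) =
   (`|r|^-1 ^+ (2 * n))%:E * \int[volume R n]_t F t)%E.
Proof.
move=> r0; elim: n b F => [|n IH] b F mF F0.
  rewrite muln0 expr0 mul1e; apply: eq_integral => t _.
  by congr F; rewrite tuple0 [RHS]tuple0.
have mFa : measurable_fun [set: n.+1.-tuple plane] (fun t => F (tuple_affine b r t)).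
  exact: (measurableT_comp mF (measurable_tuple_affine b r)).
rewrite (tonelli_volume mFa)// (tonelli_volume mF)//.
pose c k := b (lift ord0 k).
pose H (t : n.-tuple plane) := (\int[lambda]_x \int[lambda]_y F (consC (t, x, y)))%E.
have mG : measurable_fun [set: n.-tuple plane * line * line] (fun p : n.-tuple plane * line * line => F (consC p)).
  exact: (measurableT_comp mF (@measurable_consC R n)).
have G0 (p : n.-tuple plane * line * line) : (0 <= F (consC p))%E by exact: F0.
have mK := @measurable_fun_fubini_tonelli_F _ _ _ _ _ lambda _ mG G0.
have mH : measurable_fun [set: n.-tuple plane] H.
  exact: measurable_iterated mF F0.
have H0 t : (0 <= H t)%E by apply: integral_ge0 => x _; exact: integral_ge0.
have mKt t : measurable_fun [set: line] (fun x : line => \int[lambda]_y F (consC (t, x, y)))%E.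
  exact: (measurableT_comp mK (measurable_pair1 t)).
have mGtx t x : measurable_fun [set: line] (fun y : line => F (consC (t, x, y))).
  exact: (measurableT_comp mG (measurable_pair1 (t, x))).
have r1 : 0 <= `|r|^-1 by rewrite invr_ge0.
transitivity (\int[volume R n]_t ((`|r|^-1 ^+ 2)%:E * H (tuple_affine c r t)))%E.
  apply: eq_integral => t _.
  pose s := tuple_affine c r t.
  transitivity (\int[lambda]_x ((`|r|^-1)%:E * \int[lambda]_y F (consC (s, ((b ord0).1 + r * x)%R, y))))%E.
    apply: eq_integral => x _; rewrite -(lebesgue_affine (b ord0).2 r0 (mGtx _ _))//.
    by apply: eq_integral => y _; rewrite tuple_affine_consC.
  have mKa := measurableT_comp (mKt s) (measurable_affine (b ord0).1 r).
  have Ka0 x : (0 <= \int[lambda]_y F (consC (s, ((b ord0).1 + r * x)%R, y)))%E.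
    exact: integral_ge0.
  rewrite (ge0_integralTZl lambda r1 mKa Ka0).
  have Ks0 x : (0 <= \int[lambda]_y F (consC (s, x, y)))%E by exact: integral_ge0.
  have := lebesgue_affine (b ord0).1 r0 (mKt s) Ks0.
  by rewrite /= => ->; rewrite muleA -EFinM -expr2.
have r2 : 0 <= `|r|^-1 ^+ 2 by rewrite exprn_ge0.
have mHa := measurableT_comp mH (measurable_tuple_affine c r).
rewrite (ge0_integralTZl (volume R n) r2 mHa (fun t => H0 _)).
by rewrite (IH c H mH H0) muleA -EFinM -exprD mulnS.
Qed.

End Affine.

(** * Measurability and dilations on Omega *)

Section OnOmega.
Context (R : realType).
Local Notation line := (measurableTypeR R).
Local Notation plane := (line * line)%type.
Local Notation lambda := (@lebesgue_measure R).

Section OpenSet.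
Context d (T : measurableType d) (N : nat) (X : T -> 'rV[R[i]]_N).
Context (mRe : forall k, measurable_fun [set: T] (fun x => complex.Re (X x 0 k) : line))
  (mIm : forall k, measurable_fun [set: T] (fun x => complex.Im (X x 0 k) : line)).

Lemma measurable_fun_open (U : set 'rV[R[i]]_N) (u : 'rV[R[i]]_N -> R) : open U ->
  (forall z, U z -> u w @[w --> z] --> u z) ->
  measurable_fun (X @^-1` U) (fun x => u (X x) : line).
Proof.
move=> oU cu _; apply: (measurability _ (RGenOInfty.measurableE R)); last exact: (measurable_open_preimage mRe mIm oU).
move=> _ [_ [c ->] <-].
have -> : X @^-1` U `&` (fun x => u (X x)) @^-1` `]c, +oo[ =
    X @^-1` (U `&` [set z | c < u z]).
  by apply/seteqP; split => x /=; rewrite in_itv /= andbT.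
apply: (measurable_open_preimage mRe mIm).
rewrite openE => z [Uz cz]; apply: filterI; first exact: open_nbhs_nbhs.
exact: (cu z Uz _ (lt_nbhsr cz)).
Qed.

Lemma measurable_open (U : set 'rV[R[i]]_N) : open U -> measurable (X @^-1` U).
Proof. exact: (measurable_open_preimage mRe mIm). Qed.

End OpenSet.

Lemma cvg_normc (T : Type) (H : set_system T) (FF : Filter H) (f : T -> R[i]) (l : R[i]) :
  f @ H --> l -> normc (f x) @[x --> H] --> normc l.
Proof.
move=> /cvgrPdist_le fl; apply/cvgrPdist_le => e e0.
have /= := fl e%:C; rewrite ltcR => /(_ e0); apply: filterS => x.
rewrite normr_normc lecR; apply: le_trans.
have h1 := normcD (l - f x) (f x); have h2 := normcD (f x - l) l.
have h3 : normc (f x - l) = normc (l - f x) by rewrite -normcNE opprB.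
rewrite subrK in h1; rewrite subrK h3 in h2.
by rewrite ler_norml; apply/andP; split; lra.
Qed.

Lemma holomorphic_cvg n (U : set 'rV[R[i]]_n) (f : 'rV[R[i]]_n -> R[i]) z :
  holomorphic U f -> U z -> f w @[w --> z] --> f z.
Proof. by move=> hf /hf /differentiable_continuous. Qed.

Section Omega.
Context (n : nat) (Omega : set 'rV[R[i]]_n).
Context (oO : open Omega).
Local Notation OmegaR := (@toCn R n @^-1` Omega).
Implicit Types f : 'rV[R[i]]_n -> R[i].

Lemma measurable_toCn (k : 'I_n) :
  measurable_fun [set: n.-tuple plane] (fun x => complex.Re (toCn x 0 k) : line) /\
  measurable_fun [set: n.-tuple plane] (fun x => complex.Im (toCn x 0 k) : line).
Proof.
have [m1 m2] := @measurable_coord R n k; split.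
  by rewrite (_ : (fun x => _) = fun x => (tnth x k).1)//; apply/funext => x; rewrite mxE.
by rewrite (_ : (fun x => _) = fun x => (tnth x k).2)//; apply/funext => x; rewrite mxE.
Qed.

Lemma measurable_OmegaR : measurable OmegaR.
Proof.
by apply: measurable_open_preimage oO => k; have [] := measurable_toCn k.
Qed.

Lemma measurable_OmegaR_fun (u : 'rV[R[i]]_n -> R) :
  (forall z, Omega z -> u w @[w --> z] --> u z) ->
  measurable_fun OmegaR (fun x => u (toCn x) : line).
Proof.
by apply: measurable_fun_open oO => k; have [] := measurable_toCn k.
Qed.

Lemma measurable_sq_normc f : holomorphic Omega f ->
  measurable_fun OmegaR (fun x => ((normc (f (toCn x)) ^+ 2)%:E)).
Proof.
move=> hf; apply/measurable_EFinP; apply: (@measurable_OmegaR_fun (fun z => normc (f z) ^+ 2)).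
move=> z Oz; have c1 := cvg_normc (nbhs_filter z) (holomorphic_cvg hf Oz).
exact: (cvgM c1 c1).
Qed.

(** The affine map sends Omega into itself, so the change of variables bounds the
    norm of the dilated function by that of f up to the Jacobian. *)
Lemma dilation_integral f (b : 'rV[R[i]]_n) (r : R) : r != 0 -> holomorphic Omega f ->
  (forall z, Omega z -> Omega (b + r%:C *: z)) ->
  holomorphic Omega (fun z => f (b + r%:C *: z)) ->
  (\int[volume R n]_(x in OmegaR) (normc (f (b + r%:C *: toCn x)) ^+ 2)%:E <=
   (`|r|^-1 ^+ (2 * n))%:E *
   \int[volume R n]_(x in OmegaR) (normc (f (toCn x)) ^+ 2)%:E)%E.
Proof.
move=> r0 hf Or hfr; pose F := (fun x : n.-tuple plane => (normc (f (toCn x)) ^+ 2)%:E) \_ OmegaR.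
pose G := (fun x : n.-tuple plane => (normc (f (b + r%:C *: toCn x)) ^+ 2)%:E) \_ OmegaR.
rewrite [X in (X <= _)%E]integral_mkcond [X in (_ <= _ * X)%E]integral_mkcond.
rewrite -/F -/G.
have mO := measurable_OmegaR.
have mF : measurable_fun [set: n.-tuple plane] F.
  by apply/(measurable_restrictT _ mO); exact: measurable_sq_normc.
have mG : measurable_fun [set: n.-tuple plane] G.
  by apply/(measurable_restrictT _ mO); exact: (measurable_sq_normc hfr).
have F0 x : (0 <= F x)%E.
  by rewrite /F patchE; case: ifP => // _; rewrite lee_fin exprn_ge0// normc_ge0.
have G0 x : (0 <= G x)%E.
  by rewrite /G patchE; case: ifP => // _; rewrite lee_fin exprn_ge0// normc_ge0.
pose c (k : 'I_n) := (complex.Re (b 0 k), complex.Im (b 0 k)).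
have cE (t : n.-tuple plane) : toCn (tuple_affine c r t) = b + r%:C *: toCn t.
  apply/rowP => k; rewrite !mxE tnth_mktuple /=.
  by case: (b 0 k) => x y; case: (tnth t k) => u v /=; simpc.
rewrite -(volume_affine c r0 mF F0).
apply: ge0_le_integral => //.
  exact: (measurableT_comp mF (measurable_tuple_affine c r)).
move=> x _; rewrite /G patchE; case: ifP => [|_]; last exact: F0.
rewrite inE => Ox; rewrite /F patchE.
have Oax : tuple_affine c r x \in OmegaR by rewrite inE /= cE; exact: Or.
by rewrite Oax cE.
Qed.

Lemma bounded_setE : bounded_set Omega ->
  exists K : R, forall z, Omega z -> forall k, normc (z 0 k) <= K.
Proof.
move=> [M [Mr MO]]; exists (complex.Re M + 1) => z Oz k.
have MK : M < (complex.Re M + 1)%:C.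
  by rewrite -[X in X < _](RRe_real Mr) ltcR ltrDl.
have := MO _ MK z Oz; rewrite /= -lecR -normr_normc; apply: le_trans.
rewrite [X in _ <= X](_ : _ = mx_norm z)// mx_normE.
by rewrite -[X in X <= _]nngE num_le; exact: (le_bigmax _ _ (0, k)).
Qed.

Lemma OmegaR_fin_volume : bounded_set Omega -> (volume R n OmegaR < +oo)%E.
Proof.
move=> /bounded_setE[K OK].
apply: le_lt_trans (volume_cube_fin n K).
apply: le_measure; rewrite ?inE; [exact: measurable_OmegaR|exact: measurable_cube|].
move=> t Ot k; have := OK _ Ot k.
have := normc_Re (toCn t 0 k); have := normc_Im (toCn t 0 k).
rewrite !mxE /= => h1 h2 h3.
by split; rewrite -ler_norml; [exact: le_trans h2 h3|exact: le_trans h1 h3].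
Qed.

End Omega.
End OnOmega.

(** * Pointwise bounds by integrals *)

Lemma scale_sum (R : realType) (c : R) (a b : \bar R) : (0 <= a)%E -> (0 <= b)%E ->
  (2%:E * (c%:E * a) + 2%:E * (c%:E * b) = (2 * c)%:E * (a + b))%E.
Proof. by move=> a0 b0; rewrite !muleA -!EFinM ge0_muleDr. Qed.

Lemma eqe_le (R : realType) (a b : \bar R) : a = b -> (a <= b)%E.
Proof. by move=> ->. Qed.

Lemma ge0_integral_ge_cst (R : realType) d (T : measurableType d)
    (mu : {measure set T -> \bar R}) (I : set T) (c : R) (G : T -> \bar R) :
  measurable I -> 0 <= c -> measurable_fun setT G -> (forall x, 0 <= G x)%E ->
  (forall x, I x -> c%:E <= G x)%E -> (c%:E * mu I <= \int[mu]_x G x)%E.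
Proof.
move=> mI c0 mG G0 cG; rewrite -integral_cst//.
apply: (@le_trans _ _ (\int[mu]_(x in I) G x)%E).
  by apply: ge0_le_integral => //; exact: measurable_funTS.
by apply: ge0_subset_integral => //; exact: measurableT.
Qed.

Section AreaBound.
Context (R : realType).
Local Notation line := (measurableTypeR R).
Local Notation plane := (line * line)%type.
Local Notation lambda := (@lebesgue_measure R).

Definition cmeasurable d (T : measurableType d) (F : T -> R[i]) :=
  measurable_fun [set: T] (fun x => complex.Re (F x) : line) /\
  measurable_fun [set: T] (fun x => complex.Im (F x) : line).

Section cmeasurable.
Context d (T : measurableType d).
Implicit Types F G : T -> R[i].

Lemma cmeasurable_cst c : cmeasurable (fun _ : T => c).
Proof. by split; exact: measurable_cst. Qed.

Lemma cmeasurableD F G : cmeasurable F -> cmeasurable G ->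
  cmeasurable (fun x => F x + G x).
Proof.
move=> [F1 F2] [G1 G2]; split.
  rewrite (_ : (fun x => _) = fun x => complex.Re (F x) + complex.Re (G x)).
    exact: measurable_funD.
  by apply/funext => x; rewrite raddfD.
rewrite (_ : (fun x => _) = fun x => complex.Im (F x) + complex.Im (G x)).
  exact: measurable_funD.
by apply/funext => x; rewrite raddfD.
Qed.

Lemma cmeasurableMr F c : cmeasurable F -> cmeasurable (fun x => F x * c).
Proof.
move=> [F1 F2]; case: c => a b.
have mr (h : T -> line) (k : R) : measurable_fun setT h -> measurable_fun setT (fun x => h x * k : line).
  by move=> mh; apply: measurable_funM => //; exact: measurable_cst.
split.
  rewrite (_ : (fun x => _) = fun x => complex.Re (F x) * a - complex.Im (F x) * b).
    by apply: measurable_funB; exact: mr.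
  by apply/funext => x; case: (F x).
rewrite (_ : (fun x => _) = fun x => complex.Re (F x) * b + complex.Im (F x) * a).
  by apply: measurable_funD; exact: mr.
by apply/funext => x; case: (F x).
Qed.

Lemma cmeasurable_sum n (F : 'I_n -> T -> R[i]) : (forall k, cmeasurable (F k)) ->
  cmeasurable (fun x => \sum_(k < n) F k x).
Proof.
elim: n F => [|n IH] F mF.
  rewrite (_ : (fun x => _) = fun=> 0); first exact: cmeasurable_cst.
  by apply/funext => x; rewrite big_ord0.
rewrite (_ : (fun x => _) = fun x => (\sum_(k < n) F (widen_ord (leqnSn n) k) x) + F ord_max x).
  by apply: cmeasurableD => //; apply: IH => k; exact: mF.
by apply/funext => x; rewrite big_ord_recr.
Qed.

End cmeasurable.

Definition cplx (p : plane) : R[i] := p.1 +i* p.2.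

Lemma cmeasurable_cplx : cmeasurable cplx.
Proof. by split; [exact: measurable_fst|exact: measurable_snd]. Qed.

Definition slice N (f : 'rV[R[i]]_N -> R[i]) (z v : 'rV[R[i]]_N) (w : R[i]) : R[i] :=
  f (z + w *: v).

Definition square_density N (f : 'rV[R[i]]_N -> R[i]) (z v : 'rV[R[i]]_N) (rho : R) :
    plane -> \bar R :=
  (fun p => (normc (slice f z v (cplx p)))%:E) \_ [set p | in_square rho (cplx p)].

Section OneVariable.
Context (N : nat) (Omega : set 'rV[R[i]]_N) (oO : open Omega).
Context (f : 'rV[R[i]]_N -> R[i]) (hf : holomorphic Omega f).
Context (z v : 'rV[R[i]]_N) (rho : R) (rho0 : 0 < rho).
Context (Oz : forall w, in_square rho w -> Omega (z + w *: v)).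

Local Notation phi := (slice f z v).
Local Notation Q := [set p : plane | in_square rho (cplx p)].
Local Notation k := (square_density f z v rho).

Let k_ge0 p : (0 <= k p)%E.
Proof. by rewrite /square_density patchE; case: ifP => // _; rewrite lee_fin normc_ge0. Qed.

Let measurable_Q : measurable Q.
Proof.
have -> : Q = `[- rho, rho]%classic `*` `[- rho, rho]%classic.
  apply/seteqP; split => -[x y] /=; rewrite !in_itv /=.
    by move=> [/= -> -> -> ->].
  by move=> [/andP[? ?] /andP[? ?]]; split.
by apply: measurableX; exact: measurable_itv.
Qed.

Let measurable_k : measurable_fun [set: plane] k.
Proof.
pose X (p : plane) := z + cplx p *: v.
have mX j : cmeasurable (fun p => X p 0 j).
  rewrite (_ : (fun p => _) = fun p => z 0 j + cplx p * v 0 j); last first.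
    by apply/funext => p; rewrite !mxE.
  apply: cmeasurableD; first exact: cmeasurable_cst.
  exact/cmeasurableMr/cmeasurable_cplx.
apply/(measurable_restrictT _ measurable_Q); apply/measurable_EFinP.
have QO : Q `<=` X @^-1` Omega by move=> p /Oz.
have mO : measurable (X @^-1` Omega).
  by apply: measurable_open oO => j; have [] := mX j.
apply: (measurable_funS mO QO).
apply: (@measurable_fun_open R _ _ _ X _ _ Omega (fun u => normc (f u)) oO).
- by move=> j; have [] := mX j.
- by move=> j; have [] := mX j.
- by move=> u Ou; exact: (cvg_normc (nbhs_filter u) (holomorphic_cvg hf Ou)).
Qed.

Let dphi w : in_square rho w -> differentiable phi w.
Proof. by move=> /Oz /hf /cdiff_slice /cdiff_differentiable. Qed.

Let kE x y : in_square rho (x +i* y) -> k (x, y) = (normc (phi (x +i* y)))%:E.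
Proof. by move=> H; rewrite /square_density patchE mem_set. Qed.

Lemma cint_le_integral (s : R) (F : R -> R[i]) (G : line -> \bar R) : 0 < s ->
  {in `[- s, s], continuous F} -> measurable_fun setT G -> (forall x, 0 <= G x)%E ->
  (forall x : R, - s <= x <= s -> ((normc (F x))%:E <= G x)%E) ->
  ((normc (cint (- s) s F))%:E <= 2%:E * \int[lambda]_x G x)%E.
Proof.
move=> s0 cF mG G0 FG; have [i1 i2] := integrable_ReIm cF.
pose I : set line := `[- s, s]%classic.
have mI : measurable I by exact: measurable_itv.
have key (h : R -> R) : lambda.-integrable I (EFin \o h) ->
    (forall x, `|h x| <= normc (F x)) ->
    (`|\int[lambda]_(x in I) h x|%:E <= \int[lambda]_x G x)%E.
  move=> ih hF; rewrite EFin_normr_Rintegral//.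
  have mh : measurable_fun I (EFin \o h) by case/integrableP : ih.
  apply: (le_trans (le_abse_integral _ mI mh)).
  apply: (@le_trans _ _ (\int[lambda]_(x in I) G x)%E).
    apply: ge0_le_integral => //.
    - exact: measurableT_comp.
    - exact: measurable_funTS.
    - move=> x; rewrite /I /= in_itv /= => xs; apply: le_trans (FG x xs).
      by rewrite lee_fin.
  by apply: ge0_subset_integral => //; exact: measurableT.
apply: (@le_trans _ _ (\int[lambda]_x G x + \int[lambda]_x G x)%E); last first.
  by rewrite -[2%R]/(1 + 1)%R EFinD ge0_muleDl// mul1e.
apply: (@le_trans _ _ (`|complex.Re (cint (- s) s F)|%:E + `|complex.Im (cint (- s) s F)|%:E)%E).
  by rewrite -EFinD lee_fin; exact: normc_ReIm.
apply: leeD.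
  by apply: (key (fun t => complex.Re (F t))) => // x; exact: normc_Re.
by apply: (key (fun t => complex.Im (F t))) => // x; exact: normc_Im.
Qed.

(** Cauchy's formula on the contour of the square of radius s, estimated by the
    integral of |f| over its four sides. *)
Lemma square_bound (s : R) : rho / 2 <= s <= rho ->
  ((4 * normc (f z))%:E <= (4 / rho)%:E *
    (\int[lambda]_x (k (x, - s)%R + k (x, s)) +
     \int[lambda]_y (k (s, y) + k (- s, y)%R)))%E.
Proof.
move=> /andP[s1 s2]; have s0 : 0 < s by rewrite (lt_le_trans _ s1)// divr_gt0.
have sub w : in_square s w -> in_square rho w by move=> [? ? ? ?]; split; lra.
have l0 : leading (f z) 0 phi.
  have c0 : in_square rho 0 by split => /=; lra.
  have /differentiable_continuous cphi := dphi c0.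
  have p0 : phi 0 = f z by rewrite /slice scale0r addr0.
  move=> e e0; have /cvgrPdist_le /(_ e%:C) := cphi.
  rewrite ltcR => /(_ e0) /nbhs_normcP[r r0 H].
  exists r => // w wr; rewrite !expr0 !mulr1 -p0 -normcNE opprB.
  have := H w; rewrite sub0r normrN normr_normc ltcR => /(_ wr).
  by rewrite normr_normc lecR.
have := cauchy_coef s0 (fun w ws => dphi (sub w ws)) l0.
pose h w := phi w * w^-1 ^+ 1; rewrite -/h => bound.
have dh w : square_edge s w -> differentiable h w.
  move=> ws; have w0 := square_edge_neq0 s0 ws.
  by apply: diff_mul; [exact/dphi/sub/ws.1|exact: diff_invX].
have hle w : square_edge s w -> normc (h w) <= 2 / rho * normc (phi w).
  move=> ws; have w0 := square_edge_neq0 s0 ws; have [_ sw] := ws.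
  rewrite /h expr1 normcM normcV mulrC ler_wpM2r ?normc_ge0//.
  rewrite invf_ple ?posrE ?divr_gt0//; last by rewrite (lt_le_trans s0).
  by rewrite invf_div; apply: le_trans sw.
have [cB cT cL cR] := square_edge_cont s0 dh.
have mkx (y : R) : measurable_fun [set: line] (fun x : line => k (x, y)).
  exact: (measurableT_comp measurable_k (measurable_pair2 y)).
have mky (x : R) : measurable_fun [set: line] (fun y : line => k (x, y)).
  exact: (measurableT_comp measurable_k (measurable_pair1 x)).
have r20 : 0 <= 2 / rho by rewrite divr_ge0// ltW.
pose G1 x := ((2 / rho)%:E * (k (x, - s)%R + k (x, s)))%E.
pose G2 y := ((2 / rho)%:E * (k (s, y) + k (- s, y)%R))%E.
have mS1 : measurable_fun [set: line] (fun x : line => k (x, - s)%R + k (x, s))%E.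
  exact: emeasurable_funD (mkx _) (mkx _).
have mS2 : measurable_fun [set: line] (fun y : line => k (s, y) + k (- s, y)%R)%E.
  exact: emeasurable_funD (mky _) (mky _).
have S10 x : (0 <= k (x, - s)%R + k (x, s))%E by rewrite adde_ge0.
have S20 y : (0 <= k (s, y) + k (- s, y)%R)%E by rewrite adde_ge0.
have mG1 : measurable_fun setT G1 by exact: (measurable_funeM _ mS1).
have mG2 : measurable_fun setT G2 by exact: (measurable_funeM _ mS2).
have G10 x : (0 <= G1 x)%E by rewrite mule_ge0 ?lee_fin.
have G20 x : (0 <= G2 x)%E by rewrite mule_ge0 ?lee_fin.
have kb w : square_edge s w -> k (complex.Re w, complex.Im w) = (normc (phi w))%:E.
  by case: w => x y [ws _]; rewrite kE//; exact: sub.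
have b1 := @cint_le_integral s _ G1 s0 (contB cB cT) mG1 G10.
have b2 := @cint_le_integral s _ G2 s0 (contB cR cL) mG2 G20.
have {}b1 := b1 _; have {}b2 := b2 _.
apply: (@le_trans _ _ (2%:E * \int[lambda]_x G1 x + 2%:E * \int[lambda]_x G2 x)%E).
  apply: (@le_trans _ _ ((normc (cint (- s) s (fun x => h (x +i* - s) - h (x +i* s))))%:E +
     (normc (cint (- s) s (fun y => h (s +i* y) - h (- s +i* y))))%:E)%E).
    rewrite -EFinD lee_fin; apply: (le_trans bound).
    by apply: (le_trans (normcD _ _)); rewrite normcM normci mul1r.
  apply: leeD.
    apply: b1 => x xs; rewrite /G1 (kb _ (square_edgeB s0 xs)) (kb _ (square_edgeT s0 xs)).
    rewrite -EFinD -EFinM lee_fin mulrDr; apply: (le_trans (normcB _ _)).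
    by apply: lerD; apply: hle; [exact: square_edgeB|exact: square_edgeT].
  apply: b2 => x xs; rewrite /G2 (kb _ (square_edgeR s0 xs)) (kb _ (square_edgeL s0 xs)).
  rewrite -EFinD -EFinM lee_fin mulrDr; apply: (le_trans (normcB _ _)).
  by apply: lerD; apply: hle; [exact: square_edgeR|exact: square_edgeL].
have E1 : (\int[lambda]_x G1 x = _)%E := ge0_integralTZl lambda r20 mS1 S10.
have E2 : (\int[lambda]_x G2 x = _)%E := ge0_integralTZl lambda r20 mS2 S20.
have I10 : (0 <= \int[lambda]_x (k (x, - s)%R + k (x, s)))%E by exact: integral_ge0.
have I20 : (0 <= \int[lambda]_y (k (s, y) + k (- s, y)%R))%E by exact: integral_ge0.
have r4 : 2 * (2 / rho) = 4 / rho by rewrite mulrA -natrM.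
have E := etrans (congr2 (fun u v => 2%:E * u + 2%:E * v)%E E1 E2) (scale_sum (2 / rho) I10 I20).
exact: (eqe_le (etrans E (congr1 (fun c => (c%:E * _)%E) r4))).
Qed.

(** Averaging the bound over the contours of radius s between rho/2 and rho
    replaces the contour integrals by an area integral: as s varies, the sides
    sweep parts of the square. *)
Lemma area_bound :
  ((normc (f z))%:E <= (8 / rho ^+ 2)%:E * \int[lambda]_x \int[lambda]_y k (x, y))%E.
Proof.
have r40 : 0 <= 4 / rho by rewrite divr_ge0// ltW.
have rr : rho / 2 < rho by rewrite ltr_pdivrMr// ltr_pMr// ltr1n.
have f0 : 0 <= 4 * normc (f z) by rewrite mulr_ge0// normc_ge0.
have c0 : 0 <= (2 * rho)^-1 by rewrite invr_ge0 mulr_ge0// ltW.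
have N1 : (-1 : R) != 0 by rewrite oppr_eq0 oner_eq0.
have lI0 : lambda (`[rho / 2, rho]%classic : set line) = (rho / 2)%:E.
  have -> := lebesgue_measure_itv `[rho / 2, rho].
  by rewrite /= lte_fin rr -EFinB; congr (_%:E); field.
have final (D : \bar R) : ((4 * normc (f z))%:E * (rho / 2)%:E <= (4 / rho)%:E * (4%:E * D))%E ->
    ((normc (f z))%:E <= (8 / rho ^+ 2)%:E * D)%E.
  move=> i3; have c0' : (0 <= ((2 * rho)^-1)%:E)%E by rewrite lee_fin.
  have := lee_wpmul2l c0' i3; rewrite !muleA -!EFinM.
  have -> : (2 * rho)^-1 * (4 * normc (f z)) * (rho / 2) = normc (f z).
    by field; rewrite gt_eqF.
  have -> : (2 * rho)^-1 * (4 / rho) * 4 = 8 / rho ^+ 2.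
    by field; rewrite gt_eqF.
  by [].
have mul4 (D : \bar R) : (0 <= D)%E -> (D + D + (D + D) = 4%:E * D)%E.
  move=> D0; rewrite (_ : 4%R = (1 + 1) + (1 + 1))%R; last by ring.
  by rewrite !EFinD !ge0_muleDl ?mul1e// ?adde_ge0.
pose A (y : line) := (\int[lambda]_x k (x, y))%E.
pose B (x : line) := (\int[lambda]_y k (x, y))%E.
pose D := (\int[lambda]_x B x)%E.
have A0 y : (0 <= A y)%E by apply: integral_ge0 => x _; exact: k_ge0.
have B0 y : (0 <= B y)%E by apply: integral_ge0 => x _; exact: k_ge0.
have mA : measurable_fun [set: line] A.
  exact: (@measurable_fun_fubini_tonelli_G _ _ _ _ _ lambda k measurable_k k_ge0).
have mB : measurable_fun [set: line] B.
  exact: (@measurable_fun_fubini_tonelli_F _ _ _ _ _ lambda k measurable_k k_ge0).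
have DA : (\int[lambda]_y A y = D)%E.
  have e1 := @fubini_tonelli1 _ _ _ _ _ lambda lambda k measurable_k k_ge0.
  have e2 := @fubini_tonelli2 _ _ _ _ _ lambda lambda k measurable_k k_ge0.
  exact: etrans (esym e2) e1.
have refl (F : line -> \bar R) : measurable_fun setT F -> (forall x, 0 <= F x)%E ->
    (\int[lambda]_x F (0 + -1 * x)%R = \int[lambda]_x F x)%E.
  by move=> mF F0; rewrite (lebesgue_affine 0 N1 mF F0) normrN1 invr1 mul1e.
have mneg (F : line -> \bar R) : measurable_fun setT F ->
    measurable_fun setT (fun x : line => F (0 + -1 * x)%R).
  by move=> mF; exact: (measurableT_comp mF (measurable_affine 0 (-1))).
pose H (s : line) := ((A (0 + -1 * s)%R + A s) + (B s + B (0 + -1 * s)%R))%E.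
have mH1 : measurable_fun setT (fun s : line => (A (0 + -1 * s)%R + A s))%E.
  exact: emeasurable_funD (mneg _ mA) mA.
have mH2 : measurable_fun setT (fun s : line => (B s + B (0 + -1 * s)%R))%E.
  exact: emeasurable_funD mB (mneg _ mB).
have mH : measurable_fun setT H by exact: emeasurable_funD mH1 mH2.
have H10 s : (0 <= A (0 + -1 * s)%R + A s)%E by exact: (adde_ge0 (A0 _) (A0 _)).
have H20 s : (0 <= B s + B (0 + -1 * s)%R)%E by exact: (adde_ge0 (B0 _) (B0 _)).
have H0 s : (0 <= H s)%E by exact: (adde_ge0 (H10 _) (H20 _)).
have intD (F G : line -> \bar R) : measurable_fun setT F -> measurable_fun setT G ->
    (forall x, 0 <= F x)%E -> (forall x, 0 <= G x)%E ->
    (\int[lambda]_x (F x + G x) = \int[lambda]_x F x + \int[lambda]_x G x)%E.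
  by move=> mF mG F0 G0; rewrite ge0_integralD.
have HD : (\int[lambda]_s H s = (D + D) + (D + D))%E.
  have e1 := intD _ _ mH1 mH2 H10 H20.
  have e2 := intD (fun s => A (0 + -1 * s)%R) A (mneg A mA) mA (fun s => A0 _) A0.
  have e3 := intD B (fun s => B (0 + -1 * s)%R) mB (mneg B mB) B0 (fun s => B0 _).
  have e4 := refl A mA A0; have e5 := refl B mB B0.
  have e6 := etrans e2 (congr2 (@adde R) (etrans e4 DA) DA).
  have e7 := etrans e3 (congr2 (@adde R) (erefl D) e5).
  exact: (etrans e1 (congr2 (@adde R) e6 e7)).
have mkx (y : R) : measurable_fun [set: line] (fun x : line => k (x, y)).
  exact: (measurableT_comp measurable_k (measurable_pair2 y)).
have mky (x : R) : measurable_fun [set: line] (fun y : line => k (x, y)).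
  exact: (measurableT_comp measurable_k (measurable_pair1 x)).
have sb (s : R) : rho / 2 <= s <= rho ->
    ((4 * normc (f z))%:E <= (4 / rho)%:E * H s)%E.
  move=> sI; have sN : 0 + -1 * s = - s by rewrite add0r mulN1r.
  have E1 : (\int[lambda]_x (k (x, - s)%R + k (x, s)) = A (- s)%R + A s)%E.
    exact: (intD _ _ (mkx _) (mkx _) (fun x => k_ge0 _) (fun x => k_ge0 _)).
  have E2 : (\int[lambda]_y (k (s, y) + k (- s, y)%R) = B s + B (- s)%R)%E.
    exact: (intD _ _ (mky _) (mky _) (fun x => k_ge0 _) (fun x => k_ge0 _)).
  have HE : H s = (A (- s)%R + A s + (B s + B (- s)%R))%E by rewrite /H sN.
  have E := congr1 (fun u => (4 / rho)%:E * u)%E (etrans (congr2 (@adde R) E1 E2) (esym HE)).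
  exact: (le_trans (square_bound sI) (eqe_le E)).
pose I : set line := `[rho / 2, rho]%classic.
have mI : measurable I by exact: measurable_itv.
have lI : lambda I = (rho / 2)%:E by exact: lI0.
have mH' : measurable_fun setT (fun s => (4 / rho)%:E * H s)%E by exact: (measurable_funeM _ mH).
have H'0 s : (0 <= (4 / rho)%:E * H s)%E by rewrite mule_ge0 ?lee_fin.
have sbI s : I s -> ((4 * normc (f z))%:E <= (4 / rho)%:E * H s)%E.
  by rewrite /I /= in_itv /= => /sb.
have i1 := ge0_integral_ge_cst lambda mI f0 mH' H'0 sbI.
have D0 : (0 <= D)%E by apply: integral_ge0 => x _; exact: B0.
have e8 : (\int[lambda]_s ((4 / rho)%:E * H s) = (4 / rho)%:E * (4%:E * D))%E.
  exact: (etrans (ge0_integralTZl lambda r40 mH H0)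
    (congr1 (fun u => ((4 / rho)%:E * u)%E) (etrans HD (mul4 D D0)))).
by apply: final; rewrite -e8 -lI.
Qed.

End OneVariable.
End AreaBound.

Section PointBound.
Context (R : realType).
Local Notation line := (measurableTypeR R).
Local Notation plane := (line * line)%type.
Local Notation lambda := (@lebesgue_measure R).

Section Multi.
Context (N : nat) (Omega : set 'rV[R[i]]_N) (oO : open Omega).
Context (f : 'rV[R[i]]_N -> R[i]) (hf : holomorphic Omega f).
Context (rho : R) (rho0 : 0 < rho).
Implicit Types (z : 'rV[R[i]]_N).

(** The coordinate directions are kept as a family v, so that the bound in
    dimension n can be proved one direction at a time. *)
Definition lincomb n (v : 'I_n -> 'rV[R[i]]_N) (t : n.-tuple plane) : 'rV[R[i]]_N :=
  \sum_(k < n) cplx (tnth t k) *: v k.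

Definition cube_density n z (v : 'I_n -> 'rV[R[i]]_N) : n.-tuple plane -> \bar R :=
  (fun t => (normc (f (z + lincomb v t)))%:E) \_ (@cube R n rho).

Lemma lincomb_consC n (v : 'I_n.+1 -> 'rV[R[i]]_N) (p : n.-tuple plane * line * line) :
  lincomb v (consC p) =
  cplx (p.1.2, p.2) *: v ord0 + lincomb (fun k => v (lift ord0 k)) p.1.1.
Proof.
rewrite /lincomb big_ord_recl tnth0; congr (_ + _).
by apply: eq_bigr => k _; rewrite tnthS.
Qed.

Lemma cmeasurable_lincomb n (v : 'I_n -> 'rV[R[i]]_N) z j :
  cmeasurable (fun t : n.-tuple plane => (z + lincomb v t) 0 j).
Proof.
rewrite (_ : (fun t => _) = fun t => z 0 j + \sum_(k < n) cplx (tnth t k) * v k 0 j); last first.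
  apply/funext => t; rewrite !mxE summxE; congr (_ + _).
  by apply: eq_bigr => k _; rewrite mxE.
apply: cmeasurableD; first exact: cmeasurable_cst.
apply: cmeasurable_sum => k; apply: cmeasurableMr.
by have [m1 m2] := @measurable_coord R n k; split.
Qed.

Lemma cube_density_ge0 n z (v : 'I_n -> 'rV[R[i]]_N) t : (0 <= cube_density z v t)%E.
Proof. by rewrite /cube_density patchE; case: ifP => // _; rewrite lee_fin normc_ge0. Qed.

Lemma measurable_cube_density n z (v : 'I_n -> 'rV[R[i]]_N) :
  (forall t, cube rho t -> Omega (z + lincomb v t)) ->
  measurable_fun [set: n.-tuple plane] (cube_density z v).
Proof.
move=> Ov; pose X (t : n.-tuple plane) := z + lincomb v t.
have mC := @measurable_cube R n rho.
apply/(measurable_restrictT _ mC); apply/measurable_EFinP.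
have QO : cube rho `<=` X @^-1` Omega by move=> t /Ov.
have mRe j : measurable_fun [set: n.-tuple plane] (fun t => complex.Re (X t 0 j) : line).
  by have [] := cmeasurable_lincomb v z j.
have mIm j : measurable_fun [set: n.-tuple plane] (fun t => complex.Im (X t 0 j) : line).
  by have [] := cmeasurable_lincomb v z j.
have mO : measurable (X @^-1` Omega) := measurable_open mRe mIm oO.
apply: (measurable_funS mO QO).
apply: (measurable_fun_open mRe mIm (u := fun u => normc (f u)) oO) => u Ou.
exact: (cvg_normc (nbhs_filter u) (holomorphic_cvg hf Ou)).
Qed.

(** The bound for one complex line applied in each direction in turn; the
    integrals nest by Tonelli's theorem. *)
Lemma cube_bound n z (v : 'I_n -> 'rV[R[i]]_N) :
  (forall t, cube rho t -> Omega (z + lincomb v t)) ->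
  ((normc (f z))%:E <=
   ((8 / rho ^+ 2) ^+ n)%:E * \int[volume R n]_t cube_density z v t)%E.
Proof.
have c0 : 0 <= 8 / rho ^+ 2 by rewrite divr_ge0// sqr_ge0.
elim: n z v => [|n IH] z v Ov.
  rewrite expr0 mul1e [volume R 0]/= integral_dirac//; last first.
    exact: measurable_cube_density.
  rewrite diracT mul1e /cube_density patchE mem_set; last by case.
  by rewrite /lincomb big_ord0 addr0.
have rr : - rho <= 0 <= rho by rewrite oppr_le0 ltW.
pose u k := v (lift ord0 k).
have cubeC (t : n.-tuple plane) (x y : R) : cube rho t -> - rho <= x <= rho -> - rho <= y <= rho ->
    cube rho (consC (t, x, y)) by move=> ? ? ?; apply/consC_cube.
have Ou t : cube rho t -> Omega (z + lincomb u t).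
  move=> ct; have := Ov _ (cubeC t 0 0 ct rr rr).
  rewrite lincomb_consC (_ : cplx (0, 0) = 0)// scale0r add0r.
  exact.
have mK := measurable_cube_density Ov.
have mKu := measurable_cube_density Ou.
have K0 := cube_density_ge0 z v.
have key t : (cube_density z u t <= (8 / rho ^+ 2)%:E *
     \int[lambda]_x \int[lambda]_y cube_density z v (consC (t, x, y)))%E.
  rewrite {1}/cube_density patchE; case: ifPn; last first.
    move=> _; rewrite mule_ge0 ?lee_fin//; apply: integral_ge0 => x _.
    by apply: integral_ge0 => y _; exact: K0.
  rewrite inE => ct.
  have Oz w : in_square rho w -> Omega (z + lincomb u t + w *: v ord0).
    move=> [w1 w2 w3 w4]; have := Ov (consC (t, complex.Re w, complex.Im w)).
    rewrite lincomb_consC /= -addrA [_ + lincomb _ _]addrC.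
    rewrite (_ : cplx (complex.Re w, complex.Im w) = w); last by case: (w).
    by apply; apply: cubeC => //; rewrite ?w1 ?w2 ?w3 ?w4.
  suff E : (\int[lambda]_x \int[lambda]_y
        square_density f (z + lincomb u t) (v ord0) rho (x, y) =
      \int[lambda]_x \int[lambda]_y cube_density z v (consC (t, x, y)))%E.
    by rewrite -E; exact: (area_bound oO hf rho0 Oz).
  apply: eq_integral => x _; apply: eq_integral => y _.
  rewrite /square_density /cube_density !patchE.
  have -> : ((x, y) \in [set p : plane | in_square rho (cplx p)]) =
      (consC (t, x, y) \in cube rho).
    apply/idP/idP; rewrite !inE => H.
      by case: H => /= h1 h2 h3 h4; apply: cubeC => //; rewrite ?h1 ?h2 ?h3 ?h4.
    by have [[_ /= /andP[? ?]] /andP[? ?]] := (consC_cube rho (t, x, y)).1 H; split.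
  case: ifP => // _; rewrite /slice lincomb_consC /= -addrA.
  by rewrite [lincomb _ _ + _]addrC.
have cn0 : 0 <= (8 / rho ^+ 2) ^+ n by rewrite exprn_ge0.
have mT := measurable_iterated mK K0.
have T0 t : (0 <= \int[lambda]_x \int[lambda]_y cube_density z v (consC (t, x, y)))%E.
  by apply: integral_ge0 => x _; apply: integral_ge0 => y _; exact: K0.
have step : (\int[volume R n]_t cube_density z u t <=
    (8 / rho ^+ 2)%:E * \int[volume R n.+1]_t cube_density z v t)%E.
  have E := ge0_integralTZl (volume R n) c0 mT T0.
  rewrite (tonelli_volume mK K0) -E.
  apply: ge0_le_integral => //.
  - by move=> t _; exact: cube_density_ge0.
  - exact: (measurable_funeM _ mT).
apply: (le_trans (IH z u Ou)).
rewrite (exprSr (8 / rho ^+ 2) n) [X in (_ <= X * _)%E]EFinM -[X in (_ <= X)%E]muleA.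
apply: lee_wpmul2l => //.
Qed.

End Multi.
End PointBound.

Lemma le_1_sqr (R : realType) (y : R) : 0 <= y -> y <= 1 + y ^+ 2.
Proof. by move=> y0; nra. Qed.

Section SupBound.
Context (R : realType) (n : nat) (Omega : set 'rV[R[i]]_n).
Context (oO : open Omega) (bO : bounded_set Omega).
Local Notation line := (measurableTypeR R).
Local Notation plane := (line * line)%type.
Local Notation OmegaR := (@toCn R n @^-1` Omega).

(** Point evaluations near a are bounded on the unit ball of A^2(Omega). The
    integral of |f| over a cube inside Omega is compared with that of
    1 + |f|^2, which replaces the Cauchy-Schwarz inequality. *)
Lemma point_bound (a : 'rV[R[i]]_n) : Omega a -> exists2 rho : R, 0 < rho &
  exists2 C : R, 0 <= C & forall (f : 'rV[R[i]]_n -> R[i]) (z : 'rV[R[i]]_n), holomorphic Omega f ->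
    (forall k, normc (z 0 k - a 0 k) <= rho) ->
    ((\int[volume R n]_(x in OmegaR) (normc (f (toCn x)) ^+ 2)%:E) <= 1)%E ->
    Omega z /\ normc (f z) <= C.
Proof.
move=> Oa; have [r r0 rO] := nbhs_rV_ReIm (open_nbhs_nbhs (conj oO Oa)).
pose rho := r / 4; have rho0 : 0 < rho by rewrite divr_gt0.
exists rho => //.
pose V := volume R n OmegaR.
have V0 : (0 <= V)%E by exact: measure_ge0.
have Vf : V \is a fin_num by rewrite ge0_fin_numE//; exact: OmegaR_fin_volume.
pose c := (8 / rho ^+ 2) ^+ n.
have c0 : 0 <= c by rewrite exprn_ge0// divr_ge0// sqr_ge0.
have mO := measurable_OmegaR oO.
exists (c * (fine V + 1)); first by rewrite mulr_ge0// addr_ge0// fine_ge0.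
move=> f z hf az int1.
have near_a (u : 'rV[R[i]]_n) : (forall k, normc (a 0 k - u 0 k) < r) -> Omega u.
  move=> H; apply: rO => k; split; apply: le_lt_trans (H k).
    exact: normc_Re.
  exact: normc_Im.
have za k : normc (a 0 k - z 0 k) <= rho by rewrite -normcNE opprB.
have rhor : rho < r by rewrite ltr_pdivrMr// ltr_pMr// ltr1n.
split; first by apply: near_a => k; exact: le_lt_trans (za k) rhor.
pose v k : 'rV[R[i]]_n := delta_mx 0 k.
have vE (t : n.-tuple plane) : lincomb v t = toCn t.
  apply/rowP => j; rewrite summxE (bigD1 j)//= big1 => [|i ij].
    by rewrite !mxE !eqxx mulr1 addr0.
  by rewrite !mxE eq_sym (negbTE ij) andbF mulr0.
have Ov t : cube rho t -> Omega (z + lincomb v t).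
  move=> ct; rewrite vE; apply: near_a => k; rewrite !mxE opprD addrA.
  apply: (le_lt_trans (normcB _ _)).
  have h1 := za k.
  have h2 : normc ((tnth t k).1 +i* (tnth t k).2) <= 2 * rho.
    by apply: in_square_normc; have [/andP[? ?] /andP[? ?]] := ct k; split.
  by apply: (le_lt_trans (lerD h1 h2)); rewrite /rho; lra.
have bd := cube_bound oO hf rho0 Ov.
pose b (k : 'I_n) := (complex.Re (z 0 k), complex.Im (z 0 k)).
have bE (t : n.-tuple plane) : toCn (tuple_affine b 1 t) = z + toCn t.
  apply/rowP => k; rewrite !mxE tnth_mktuple /= !mul1r.
  by case: (z 0 k) => x y; case: (tnth t k).
pose F := (fun x : n.-tuple plane => (normc (f (toCn x)))%:E) \_ OmegaR.
have F0 x : (0 <= F x)%E.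
  by rewrite /F patchE; case: ifP => // _; rewrite lee_fin normc_ge0.
have mF : measurable_fun [set: n.-tuple plane] F.
  apply/(measurable_restrictT _ mO); apply/measurable_EFinP.
  apply: (measurable_OmegaR_fun oO (u := fun u => normc (f u))) => u Ou.
  exact: (cvg_normc (nbhs_filter u) (holomorphic_cvg hf Ou)).
have V1 := volume_affine b (oner_neq0 R) mF F0.
rewrite normr1 invr1 expr1n mul1e in V1.
pose V2 : \bar R := (\int[volume R n]_(x in OmegaR) (normc (f (toCn x)) ^+ 2)%:E)%E.
have i1 : (\int[volume R n]_t cube_density f rho z v t <= \int[volume R n]_t F t)%E.
  rewrite -V1; apply: ge0_le_integral => //.
  - by move=> t _; exact: cube_density_ge0.
  - exact: (measurable_cube_density oO hf Ov).
  - exact: (measurableT_comp mF (measurable_tuple_affine b 1)).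
  move=> t _; rewrite /cube_density patchE; case: ifPn => [|_]; last exact: F0.
  rewrite inE => /Ov; rewrite vE => Ozt.
  have tO : tuple_affine b 1 t \in OmegaR by rewrite inE /= bE.
  by rewrite /F patchE tO bE.
have i2 : (\int[volume R n]_t F t <= V + V2)%E.
  rewrite /F -integral_mkcond.
  have m1 : measurable_fun OmegaR (fun x => (normc (f (toCn x)))%:E).
    by apply/(measurable_restrictT _ mO).
  have m2 := measurable_sq_normc oO hf.
  have m3 : measurable_fun OmegaR (fun=> 1%:E : \bar R) by exact: measurable_cst.
  have p0 x : OmegaR x -> (0 <= (normc (f (toCn x)) ^+ 2)%:E)%E.
    by move=> _; rewrite lee_fin exprn_ge0// normc_ge0.
  have p1 x : OmegaR x -> (0 <= 1%:E :> \bar R)%E by rewrite lee_fin ler01.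
  have -> : V = (\int[volume R n]_(x in OmegaR) 1%:E)%E.
    by rewrite integral_cst// mul1e.
  rewrite -(ge0_integralD _ mO p1 m3 p0 m2).
  apply: ge0_le_integral => //.
  - by move=> x _; rewrite lee_fin normc_ge0.
  - exact: emeasurable_funD m3 m2.
  move=> x _; rewrite -EFinD lee_fin.
  have := normc_ge0 (f (toCn x)); move: (normc _) => y y0; exact: le_1_sqr.
rewrite -lee_fin; apply: (le_trans bd); rewrite EFinM; apply: lee_wpmul2l => //.
apply: (le_trans i1); apply: (le_trans i2).
rewrite EFinD (fineK Vf); apply: leeD2l; exact: int1.
Qed.

End SupBound.

(** * The space A^2(Omega) *)

(** This inequality, integrated, stands in for the triangle inequality of the
    norm: the constant 2 is harmless in the compactness argument. *)
Lemma sqr_normcD (R : realType) (x y : R[i]) :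
  normc (x + y) ^+ 2 <= 2 * normc x ^+ 2 + 2 * normc y ^+ 2.
Proof.
have h := normcD x y; have hx := normc_ge0 x; have hy := normc_ge0 y.
have hz := normc_ge0 (x + y).
move: (normc x) (normc y) (normc (x + y)) h hx hy hz => a b c h ha hb hc.
have : 0 <= (a + b + c) * (a + b - c) by rewrite mulr_ge0//; lra.
have := sqr_ge0 (a - b); nra.
Qed.

Lemma normc_sqrE (R : realType) (z : R[i]) : (normc z) ^+ 2 = complex.Re z ^+ 2 + complex.Im z ^+ 2.
Proof. by case: z => x y; rewrite sqr_sqrtr// addr_ge0// sqr_ge0. Qed.

Section Hilbert.
Context (R : realType) (n : nat) (Omega : set 'rV[R[i]]_n).
Context (oO : open Omega) (bO : bounded_set Omega).
Local Notation line := (measurableTypeR R).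
Local Notation plane := (line * line)%type.
Local Notation OmegaR := (@toCn R n @^-1` Omega).
Local Notation Cn := 'rV[R[i]]_n.
Local Notation mu := (volume R n).
Implicit Types f h : Cn -> R[i].
Local Notation bergman := (bergman Omega).
Local Notation inner := (inner Omega).
Local Notation L2norm := (L2norm Omega).

Let mO := measurable_OmegaR oO.

Definition sqnorm f : R := \int[mu]_(x in OmegaR) (normc (f (toCn x)) ^+ 2).
(** The squared norm before its finiteness is known. *)
Definition esqnorm f : \bar R := (\int[mu]_(x in OmegaR) (normc (f (toCn x)) ^+ 2)%:E)%E.

Lemma esqnorm_ge0 f : (0 <= esqnorm f)%E.
Proof. by apply: integral_ge0 => x _; rewrite lee_fin exprn_ge0// normc_ge0. Qed.

Lemma sqnorm_ge0 f : 0 <= sqnorm f.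
Proof. exact: fine_ge0 (esqnorm_ge0 f). Qed.

Lemma L2norm_sqr f : L2norm f ^+ 2 = sqnorm f.
Proof. by rewrite sqr_sqrtr//; exact: sqnorm_ge0. Qed.

Lemma L2norm_ge0 f : 0 <= L2norm f.
Proof. exact: sqrtr_ge0. Qed.

Lemma esqnormE f : bergman f -> esqnorm f = (sqnorm f)%:E.
Proof.
move=> [_ fi]; rewrite /sqnorm /Rintegral fineK//.
by rewrite ge0_fin_numE//; exact: esqnorm_ge0.
Qed.

Lemma eq_sqnorm f h : (forall z, Omega z -> f z = h z) -> sqnorm f = sqnorm h.
Proof. by move=> fh; apply: eq_Rintegral => x; rewrite inE => /fh ->. Qed.

Lemma holomorphic_lin a f h : holomorphic Omega f -> holomorphic Omega h ->
  holomorphic Omega (fun z => a * f z + h z).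
Proof.
move=> hf hh z Oz.
exact: (differentiableD (differentiableZ a (hf z Oz)) (hh z Oz)).
Qed.

Lemma esqnormZ a f : holomorphic Omega f ->
  esqnorm (fun z => a * f z) = ((normc a ^+ 2)%:E * esqnorm f)%E.
Proof.
move=> hf; rewrite /esqnorm -ge0_integralZl//.
- by apply: eq_integral => x _; rewrite -EFinM normcM exprMn.
- exact: (measurable_sq_normc oO hf).
- by move=> x _; rewrite lee_fin exprn_ge0// normc_ge0.
- by rewrite lee_fin exprn_ge0// normc_ge0.
Qed.

Lemma esqnormD f h : holomorphic Omega f -> holomorphic Omega h ->
  (esqnorm (fun z => f z + h z)%R <= 2%:E * esqnorm f + 2%:E * esqnorm h)%E.
Proof.
move=> hf hh.
have mf := measurable_sq_normc oO hf; have mh := measurable_sq_normc oO hh.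
have hfh : holomorphic Omega (fun z => f z + h z).
  by move=> z Oz; exact: (differentiableD (hf z Oz) (hh z Oz)).
have p2 : (0 <= 2%:E :> \bar R)%E by rewrite lee_fin.
have nn (u : Cn -> R[i]) x : OmegaR x -> (0 <= (normc (u (toCn x)) ^+ 2)%:E)%E.
  by move=> _; rewrite lee_fin exprn_ge0// normc_ge0.
have nn2 (u : Cn -> R[i]) x : OmegaR x -> (0 <= 2%:E * (normc (u (toCn x)) ^+ 2)%:E)%E.
  by move=> Ox; rewrite mule_ge0//; exact: nn.
rewrite /esqnorm -!ge0_integralZl//; try (by move=> x Ox; exact: nn).
have m2f := measurable_funeM 2%:E mf; have m2h := measurable_funeM 2%:E mh.
rewrite -(ge0_integralD _ mO (nn2 f) m2f (nn2 h) m2h).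
apply: ge0_le_integral => //.
- by move=> x Ox; exact: (nn (fun z => f z + h z) x Ox).
- exact: (measurable_sq_normc oO hfh).
- exact: emeasurable_funD m2f m2h.
- by move=> x _; rewrite -!EFinM -EFinD lee_fin; exact: sqr_normcD.
Qed.

Lemma bergman_lin a f h : bergman f -> bergman h -> bergman (fun z => a * f z + h z).
Proof.
move=> [hf fi] [hh hi]; split; first exact: holomorphic_lin.
have haf : holomorphic Omega (fun z => a * f z).
  by move=> z Oz; exact: (differentiableZ a (hf z Oz)).
apply: le_lt_trans (esqnormD haf hh) _.
rewrite (esqnormZ a hf) lte_add_pinfty// !lte_mul_pinfty ?lee_fin ?exprn_ge0 ?normc_ge0//.
Qed.

Lemma bergman_cst c : bergman (fun=> c).
Proof.
split; first by move=> z _; exact: differentiable_cst.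
by rewrite integral_cst// lte_mul_pinfty// ?lee_fin ?exprn_ge0 ?normc_ge0//;
  exact: OmegaR_fin_volume.
Qed.

Lemma bergmanZ a f : bergman f -> bergman (fun z => a * f z).
Proof.
move=> bf; have := bergman_lin a bf (bergman_cst 0).
by congr bergman; apply/funext => z; rewrite addr0.
Qed.

Lemma bergmanB f h : bergman f -> bergman h -> bergman (fun z => f z - h z).
Proof.
move=> bf bh; have := bergman_lin (-1) bh bf.
by congr bergman; apply/funext => z; rewrite mulN1r addrC.
Qed.

Lemma bergman_sum N (F : 'I_N -> Cn -> R[i]) : (forall k, bergman (F k)) ->
  bergman (fun z => \sum_(k < N) F k z).
Proof.
elim: N F => [|N IH] F bF.
  rewrite (_ : (fun z => _) = fun=> 0); first exact: bergman_cst.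
  by apply/funext => z; rewrite big_ord0.
have := bergman_lin 1 (bF ord_max) (IH (fun k => F (widen_ord (leqnSn N) k)) (fun k => bF _)).
by congr bergman; apply/funext => z; rewrite big_ord_recr /= mul1r addrC.
Qed.

Lemma sqnormZ a f : bergman f -> sqnorm (fun z => a * f z) = normc a ^+ 2 * sqnorm f.
Proof.
move=> bf; apply: EFin_inj; rewrite EFinM -(esqnormE bf) -(esqnormE (bergmanZ a bf)).
by case: bf => hf _; exact: esqnormZ.
Qed.

Lemma sqnormD f h : bergman f -> bergman h ->
  sqnorm (fun z => f z + h z) <= 2 * sqnorm f + 2 * sqnorm h.
Proof.
move=> bf bh; rewrite -lee_fin EFinD !EFinM.
have bfh : bergman (fun z => f z + h z).
  have := bergman_lin 1 bf bh.
  by congr bergman; apply/funext => z; rewrite mul1r.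
rewrite -(esqnormE bf) -(esqnormE bh) -(esqnormE bfh).
by case: bf bh => hf _ [hh _]; exact: esqnormD.
Qed.

(** Both parts are dominated by |f|^2 + |h|^2. *)
Lemma inner_integrable f h : bergman f -> bergman h ->
  cintegrable mu OmegaR (fun x => f (toCn x) * conjc (h (toCn x))).
Proof.
move=> [hf fi] [hh hi].
have sq_int (u : Cn -> R[i]) : holomorphic Omega u -> (esqnorm u < +oo)%E ->
    mu.-integrable OmegaR (fun x => (normc (u (toCn x)) ^+ 2)%:E).
  move=> hu ui; apply/integrableP; split; first exact: (measurable_sq_normc oO hu).
  rewrite (_ : integral _ _ _ = esqnorm u)//; apply: eq_integral => x _.
  by rewrite gee0_abs// lee_fin exprn_ge0// normc_ge0.
have dom := integrableD mO (sq_int f hf fi) (sq_int h hh hi).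
have cReIm (u : Cn -> R[i]) z : holomorphic Omega u -> Omega z ->
    (complex.Re (u w) @[w --> z] --> complex.Re (u z)) /\
    (complex.Im (u w) @[w --> z] --> complex.Im (u z)).
  by move=> hu Oz; exact: (cvg_ReIm (nbhs_filter z) (holomorphic_cvg hu Oz)).
have bd (x y : R[i]) : normc (x * conjc y) <= normc x ^+ 2 + normc y ^+ 2.
  rewrite normcM (_ : normc (conjc y) = normc y); last first.
    by case: y => a b /=; rewrite sqrrN.
  have := sqr_ge0 (normc x - normc y); have := normc_ge0 x; have := normc_ge0 y.
  by move: (normc x) (normc y) => a b; nra.
split; apply: (le_integrable mO _ _ dom).
- apply/measurable_EFinP.
  apply: (measurable_OmegaR_fun oO (u := fun z => complex.Re (f z * conjc (h z)))) => z Oz.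
  have [f1 f2] := cReIm f z hf Oz; have [h1 h2] := cReIm h z hh Oz.
  have E (w : Cn) : complex.Re (f w * conjc (h w)) =
      complex.Re (f w) * complex.Re (h w) + complex.Im (f w) * complex.Im (h w).
    by case: (f w) (h w) => [? ?] [? ?] /=; rewrite mulrN opprK.
  rewrite E (_ : (fun w => _) = fun w => complex.Re (f w) * complex.Re (h w) +
      complex.Im (f w) * complex.Im (h w)); last exact/funext.
  exact: (cvgD (cvgM f1 h1) (cvgM f2 h2)).
- move=> x _; rewrite /= lee_fin; apply: (le_trans (normc_Re _)).
  by apply: (le_trans (bd _ _)); rewrite ger0_norm// addr_ge0// exprn_ge0// normc_ge0.
- apply/measurable_EFinP.
  apply: (measurable_OmegaR_fun oO (u := fun z => complex.Im (f z * conjc (h z)))) => z Oz.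
  have [f1 f2] := cReIm f z hf Oz; have [h1 h2] := cReIm h z hh Oz.
  have E (w : Cn) : complex.Im (f w * conjc (h w)) =
      complex.Im (f w) * complex.Re (h w) - complex.Re (f w) * complex.Im (h w).
    by case: (f w) (h w) => [? ?] [? ?] /=; rewrite mulrN addrC.
  rewrite E (_ : (fun w => _) = fun w => complex.Im (f w) * complex.Re (h w) -
      complex.Re (f w) * complex.Im (h w)); last exact/funext.
  exact: (cvgB (cvgM f2 h1) (cvgM f1 h2)).
- move=> x _; rewrite /= lee_fin; apply: (le_trans (normc_Im _)).
  by apply: (le_trans (bd _ _)); rewrite ger0_norm// addr_ge0// exprn_ge0// normc_ge0.
Qed.

Lemma inner_lin a f h (k : Cn -> R[i]) : bergman f -> bergman h -> bergman k ->
  inner (fun z => a * f z + h z) k = a * inner f k + inner h k.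
Proof.
move=> bf bh bk; have ifk := inner_integrable bf bk; have ihk := inner_integrable bh bk.
rewrite /inner -(cintegralZl mO a ifk) -(cintegralD mO (cintegrableZl mO a ifk) ihk).
by congr cintegral; apply/funext => x; rewrite mulrDl mulrA.
Qed.

Lemma inner_conj f h : bergman f -> bergman h -> inner h f = conjc (inner f h).
Proof.
move=> bf bh; rewrite /inner -(cintegral_conj mO (inner_integrable bf bh)).
congr cintegral; apply/funext => x.
by case: (f _) (h _) => [a b] [c d] /=; simpc; congr Complex; ring.
Qed.

Lemma inner_sqnorm f : inner f f = (sqnorm f)%:C.
Proof.
rewrite /inner /cintegral; congr Complex.
  apply: eq_Rintegral => x _; rewrite normc_sqrE.
  by case: (f _) => a b /=; ring.
rewrite (_ : (fun x => _) = fun=> 0); first by rewrite Rintegral_cst ?mul0r.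
by apply/funext => x; case: (f _) => a b /=; ring.
Qed.

End Hilbert.

(** * Orthonormal systems and singular decompositions *)

Lemma mul_conjc_normc (R : realType) (z : R[i]) : z * conjc z = (normc z ^+ 2)%:C.
Proof. by rewrite normc_sqrE; case: z => a b; simpc; congr Complex; ring. Qed.

Section Orthonormal.
Context (R : realType) (n : nat) (Omega : set 'rV[R[i]]_n).
Context (oO : open Omega) (bO : bounded_set Omega).
Local Notation Cn := 'rV[R[i]]_n.
Implicit Types f h : Cn -> R[i].
Local Notation bergman := (bergman Omega).
Local Notation inner := (inner Omega).
Local Notation sqnorm := (sqnorm Omega).

Lemma inner0 h : inner (fun=> 0) h = 0.
Proof.
rewrite /inner (_ : (fun x => _) = fun=> 0); last by apply/funext => x; rewrite mul0r.
by rewrite /cintegral !Rintegral_cst ?mul0r//; exact: measurable_OmegaR.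
Qed.

Lemma inner_sum N (a : nat -> R[i]) (F : nat -> Cn -> R[i]) h :
  (forall k, bergman (F k)) -> bergman h ->
  inner (fun z => \sum_(k < N) a k * F k z) h = \sum_(k < N) a k * inner (F k) h.
Proof.
move=> bF bh; elim: N => [|N IH].
  rewrite big_ord0 (_ : (fun z => _) = fun=> 0); first exact: inner0.
  by apply/funext => z; rewrite big_ord0.
have bS := bergman_sum oO bO (fun k : 'I_N => bergmanZ oO bO (a k) (bF k)).
have E : (fun z => \sum_(k < N.+1) a k * F k z) =
    (fun z => a N * F N z + \sum_(k < N) a k * F k z).
  by apply/funext => z; rewrite big_ord_recr addrC.
by rewrite E (inner_lin oO (a N) (bF N) bS bh) IH [RHS]big_ord_recr addrC.
Qed.

(* Coefficients vanish where sigma does, since the system u is orthonormal only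
   on the indices with a nonzero sigma. *)
Section System.
Context (sigma : nat -> R) (u : nat -> Cn -> R[i]) (bu : forall k, bergman (u k)).
Context (ou : orthonormal_on Omega sigma u).
Context (a : nat -> R[i]) (a0 : forall k, sigma k = 0 -> a k = 0).
Context (N : nat).

Let S z := \sum_(k < N) a k * u k z.

Let bS : bergman S.
Proof.
have b := bergman_sum oO bO (fun k : 'I_N => bergmanZ oO bO (a k) (bu k)).
exact: b.
Qed.

Lemma sqnorm_orthonormal : sqnorm S = \sum_(k < N) normc (a k) ^+ 2.
Proof.
suff : (sqnorm S)%:C = (\sum_(k < N) normc (a k) ^+ 2)%:C by case.
rewrite -(inner_sqnorm oO S) rmorph_sum /= {1}/S (inner_sum N a bu bS).
apply: eq_bigr => k _; rewrite -mul_conjc_normc.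
have [/a0->|sk] := eqVneq (sigma k) 0; first by rewrite !mul0r.
congr (_ * _); rewrite (inner_conj oO bS (bu k)); congr conjc.
rewrite /S (inner_sum N a bu (bu k)) (bigD1 k)//= (ou sk sk) eqxx mulr1 big1 ?addr0//.
move=> j jk; have [/a0->|sj] := eqVneq (sigma j) 0; first by rewrite mul0r.
by rewrite (ou sj sk) (negbTE (jk : (j : nat) != k)) mulr0.
Qed.

Lemma bessel_system f : bergman f -> (forall k, sigma k != 0 -> a k = inner f (u k)) ->
  \sum_(k < N) normc (a k) ^+ 2 <= sqnorm f.
Proof.
move=> bf af; rewrite -sqnorm_orthonormal.
have Sf : inner S f = inner S S.
  rewrite {1 2}/S (inner_sum N a bu bf) (inner_sum N a bu bS).
  apply: eq_bigr => k _; have [/a0->|sk] := eqVneq (sigma k) 0; first by rewrite !mul0r.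
  congr (_ * _); rewrite (inner_conj oO bf (bu k)) (inner_conj oO bS (bu k)); congr conjc.
  rewrite -(af k sk) /S (inner_sum N a bu (bu k)) (bigD1 k)//= (ou sk sk) eqxx mulr1 big1 ?addr0//.
  move=> j jk; have [/a0->|sj] := eqVneq (sigma j) 0; first by rewrite mul0r.
  by rewrite (ou sj sk) (negbTE (jk : (j : nat) != k)) mulr0.
pose D z := -1 * S z + f z.
have bD : bergman D by exact: (bergman_lin oO (-1) bS bf).
suff : (sqnorm D)%:C = (sqnorm f - sqnorm S)%:C.
  by case=> E; rewrite -subr_ge0 -E; exact: sqnorm_ge0.
rewrite -(inner_sqnorm oO D).
rewrite {1}/D (inner_lin oO (-1) bS bf bD) (inner_conj oO bD bS) (inner_conj oO bD bf).
rewrite {1 2}/D (inner_lin oO (-1) bS bf bS) (inner_lin oO (-1) bS bf bf).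
rewrite (inner_conj oO bS bf) Sf !(inner_sqnorm oO).
by move: (sqnorm S) (sqnorm f) => x y; simpc; congr Complex; ring.
Qed.

End System.

(** The head of the decomposition is kept, and its tail is bounded by Bessel's
    inequality through the monotonicity of the singular values. The
    compactness of T enters through the factor sigma_K. *)
Lemma singular_bound T sigma e u f K : singular_decomposition Omega T sigma e u ->
  (forall h, bergman h -> bergman (T h)) -> bergman f ->
  sqnorm (T f) <= 2 * (\sum_(k < K) sigma k ^+ 2 * normc (inner f (e k)) ^+ 2 +
                       sigma K ^+ 2 * sqnorm f).
Proof.
move=> [[s0 sm] _ beu [oe ou] dec] bT bf.
have be k := (beu k).1; have bu k := (beu k).2.
pose c k := if sigma k == 0 then 0 else inner f (e k).
have c0 k : sigma k = 0 -> c k = 0 by move=> sk; rewrite /c sk eqxx.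
have cf k : sigma k != 0 -> c k = inner f (e k) by rewrite /c => /negbTE->.
pose a k := (sigma k)%:C * inner f (e k).
have a0 k : sigma k = 0 -> a k = 0 by move=> sk; rewrite /a sk mul0r.
have aE k : normc (a k) ^+ 2 = sigma k ^+ 2 * normc (c k) ^+ 2.
  rewrite /a normcM normc_real exprMn real_normK ?num_real//.
  have [sk|sk] := eqVneq (sigma k) 0; first by rewrite sk expr0n /= !mul0r.
  by rewrite cf.
set B := _ + _.
have B0 : 0 <= B.
  rewrite addr_ge0//; last by rewrite mulr_ge0 ?sqr_ge0// sqnorm_ge0.
  by rewrite sumr_ge0// => k _; rewrite mulr_ge0 ?sqr_ge0.
pose S N z := \sum_(k < N) a k * u k z.
have bS N : bergman (S N).
  have b := bergman_sum oO bO (fun k : 'I_N => bergmanZ oO bO (a k) (bu k)).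
  exact: b.
have SB N : (K <= N)%N -> sqnorm (S N) <= B.
  move=> KN; rewrite (sqnorm_orthonormal bu ou a0 N).
  rewrite -(big_mkord xpredT (fun k => normc (a k) ^+ 2)) (eq_bigr _ (fun k _ => aE k)).
  rewrite (big_cat_nat (leq0n K) KN) /= big_mkord; apply: lerD.
    apply: ler_sum => k _; have [sk|sk] := eqVneq (sigma k) 0.
      by rewrite sk expr0n /= !mul0r.
    by rewrite (cf _ sk).
  apply: (@le_trans _ _ (\sum_(K <= k < N) sigma K ^+ 2 * normc (c k) ^+ 2)).
    rewrite big_nat_cond [X in _ <= X]big_nat_cond; apply: ler_sum => k /andP[/andP[Kk _] _].
    by apply: ler_wpM2r; rewrite ?sqr_ge0// ler_sqr ?nnegrE//; exact: sm.
  rewrite -mulr_sumr; apply: ler_wpM2l; first exact: sqr_ge0.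
  apply: le_trans (bessel_system be oe c0 N bf cf).
  rewrite -(big_mkord xpredT (fun k => normc (c k) ^+ 2)) (big_cat_nat (leq0n K) KN) /=.
  by rewrite lerDr sumr_ge0// => k _; rewrite sqr_ge0.
apply/ler_addgt0Pr => eps eps0.
have /cvgrPdist_le /(_ (Num.sqrt (eps / 2))) := dec f bf.
rewrite sqrtr_gt0 divr_gt0// => /(_ isT) [N0 _ HN].
pose N := maxn N0 K.
have := HN N (leq_maxl _ _); rewrite /= sub0r normrN ger0_norm ?L2norm_ge0// => HL.
pose D z := T f z - S N z.
have bD : bergman D by exact: (bergmanB oO (bT f bf) (bS N)).
have HD : sqnorm D <= eps / 2.
  rewrite -L2norm_sqr -[leRHS]sqr_sqrtr ?divr_ge0 ?(ltW eps0)//.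
  by rewrite ler_sqr ?nnegrE ?sqrtr_ge0 ?L2norm_ge0.
have E : sqnorm (T f) = sqnorm (fun z => D z + S N z).
  by apply: eq_sqnorm => z _; rewrite /D subrK.
rewrite E; apply: (le_trans (sqnormD oO bD (bS N))).
have := SB N (leq_maxr _ _); move: (sqnorm D) (sqnorm _) HD => x y; lra.
Qed.

End Orthonormal.

(** * Leading terms *)

Section LeadingTerms.
Context (R : realType).
Implicit Types (p q : R[i] -> R[i]) (c d k w : R[i]) (m : nat).

Lemma eq_leading c m p q (rho : R) : 0 < rho ->
  (forall w, normc w < rho -> p w = q w) -> leading c m p -> leading c m q.
Proof.
move=> rho0 pq lp e /lp[r r0 H]; exists (Num.min r rho); first by rewrite lt_min r0.
by move=> w; rewrite lt_min => /andP[/H ? /pq <-].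
Qed.

Lemma leading_monomial c m : leading c m (fun w => c * w ^+ m).
Proof.
move=> e e0; exists 1 => // w _; rewrite subrr normc0 mulr_ge0 ?(ltW e0)//.
by rewrite exprn_ge0// normc_ge0.
Qed.

Lemma leadingD c d m p q : leading c m p -> leading d m q ->
  leading (c + d) m (fun w => p w + q w).
Proof.
move=> lp lq e e0; have e20 : 0 < e / 2 by rewrite divr_gt0.
have [r r0 Hr] := lp _ e20; have [s s0 Hs] := lq _ e20.
exists (Num.min r s); first by rewrite lt_min r0.
move=> w; rewrite lt_min => /andP[/Hr h1 /Hs h2].
have -> : p w + q w - (c + d) * w ^+ m = (p w - c * w ^+ m) + (q w - d * w ^+ m) by ring.
apply: (le_trans (normcD _ _)); apply: (le_trans (lerD h1 h2)).
by rewrite -mulrDl -splitr.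
Qed.

Lemma leading_mul c m p k (q : R[i] -> R[i]) : leading c m p ->
  q w @[w --> 0] --> k -> leading (k * c) m (fun w => q w * p w).
Proof.
move=> lp /cvgrPdist_le cq e e0.
pose B := normc k + normc c + 1.
have B0 : 0 < B by rewrite ltr_wpDl// addr_ge0// normc_ge0.
pose e' := Num.min 1 (e / (2 * B)).
have e'0 : 0 < e' by rewrite lt_min ltr01 divr_gt0// mulr_gt0.
have [r r0 Hr] := lp _ e'0.
have := cq e'%:C; rewrite ltcR => /(_ e'0) /nbhs_normcP[s s0 Hs].
exists (Num.min r s); first by rewrite lt_min r0.
move=> w; rewrite lt_min => /andP[/Hr h1 ws].
have := Hs w; rewrite sub0r normrN !normr_normc lecR ltcR => /(_ ws) h2.
have -> : q w * p w - k * c * w ^+ m =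
    q w * (p w - c * w ^+ m) - (k - q w) * (c * w ^+ m) by ring.
have h3 : normc (q w) <= normc k + 1.
  have -> : q w = k - (k - q w) by ring.
  apply: (le_trans (normcB _ _)); rewrite lerD2l.
  by apply: (le_trans h2); rewrite ge_min lexx.
have X0 : 0 <= normc w ^+ m by rewrite exprn_ge0// normc_ge0.
apply: (le_trans (normcB _ _)); rewrite !normcM normcX.
have eB : e' * B <= e / 2.
  rewrite -ler_pdivlMr// -mulrA -invfM ge_min lexx orbT//.
have k0 := normc_ge0 k; have c0 := normc_ge0 c.
have t1 : normc (q w) * normc (p w - c * w ^+ m) <= (normc k + 1) * (e' * normc w ^+ m).
  by apply: ler_pM => //; exact: normc_ge0.
have t2 : normc (k - q w) * (normc c * normc w ^+ m) <= e' * (normc c * normc w ^+ m).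
  by apply: ler_wpM2r => //; exact: mulr_ge0.
apply: (le_trans (lerD t1 t2)).
have -> : (normc k + 1) * (e' * normc w ^+ m) + e' * (normc c * normc w ^+ m) =
   e' * B * normc w ^+ m by rewrite /B; ring.
by apply: ler_wpM2r => //; apply: (le_trans eB); rewrite ler_piMr ?(ltW e0)// invf_le1// ler1n.
Qed.

Lemma leading_lt c m m' p : (m < m')%N -> leading c m' p -> leading 0 m p.
Proof.
move=> mm lp e e0; have [r r0 Hr] := lp 1 ltr01.
pose B := normc c + 1; have B0 : 0 < B by rewrite ltr_wpDl// normc_ge0.
pose s := Num.min 1 (e / B); have s0 : 0 < s by rewrite lt_min ltr01 divr_gt0.
exists (Num.min r s); first by rewrite lt_min r0.
move=> w; rewrite lt_min => /andP[/Hr h1 ws]; rewrite mul0r subr0.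
have w0 := normc_ge0 w; have X0 : 0 <= normc w ^+ m by rewrite exprn_ge0.
have w1 : normc w <= 1 by apply: (le_trans (ltW ws)); rewrite ge_min lexx.
have we : normc w * B <= e.
  by rewrite -ler_pdivlMr//; apply: (le_trans (ltW ws)); rewrite ge_min lexx orbT.
have -> : p w = (p w - c * w ^+ m') + c * w ^+ m' by ring.
apply: (le_trans (normcD _ _)); rewrite normcM normcX.
have h2 : normc w ^+ m' <= normc w ^+ m * normc w.
  by rewrite -exprSr ler_wiXn2l.
apply: (@le_trans _ _ (B * normc w ^+ m')).
  by rewrite /B mulrDl addrC lerD2l.
apply: (le_trans (ler_wpM2l (ltW B0) h2)).
by rewrite mulrCA mulrC ler_wpM2r// mulrC.
Qed.

Lemma leading_scale c m p k : k != 0 -> leading c m p ->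
  leading (c * k ^+ m) m (fun w => p (k * w)).
Proof.
move=> k0 lp e e0; have nk : 0 < normc k by rewrite lt_def normc_eq0 k0 normc_ge0.
have nkm : 0 < normc k ^+ m by rewrite exprn_gt0.
have [r r0 Hr] := lp _ (divr_gt0 e0 nkm).
exists (r / normc k); first by rewrite divr_gt0.
move=> w; rewrite ltr_pdivlMr// mulrC -normcM => /Hr.
by rewrite normcM !exprMn mulrA [e / _ * _]mulrA divfK// gt_eqF.
Qed.

End LeadingTerms.

(** * Leading terms of the derivative along the line through a *)

Section Jets.
Context (R : realType) (n : nat) (Omega : set 'rV[R[i]]_n).
Context (oO : open Omega).
Context (a : 'rV[R[i]]_n) (Oa : Omega a).
Local Notation Cn := 'rV[R[i]]_n.
Implicit Types (f h : Cn -> R[i]) (c d w : R[i]) (m : nat).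

(** The leading term at a of the derivative of f in the direction a, on the
    complex line through 0 and a. This derivative, rather than f itself, is what
    C_g multiplies by g. *)
Definition jet f m c := leading c m (fun w => 'D_a f (a + w *: a)).

Lemma ray_near : exists2 rho : R, 0 < rho & forall w, normc w < rho -> Omega (a + w *: a).
Proof.
have Oa0 : Omega (a + (0 : R[i]) *: a) by rewrite scale0r addr0.
have /nbhs_normcP[r r0 H] := slice_near oO Oa0.
by exists r => // w wr; apply: H; rewrite sub0r normrN normr_normc ltcR.
Qed.

Lemma jet_near f h m c d : (forall w, Omega (a + w *: a) -> 
    'D_a f (a + w *: a) = 'D_a h (a + w *: a)) -> c = d ->
  jet f m c -> jet h m d.
Proof.
move=> fh <-; have [rho rho0 Hr] := ray_near.
by apply: (eq_leading rho0) => w /Hr; exact: fh.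
Qed.

Lemma eq_jet f h m c : (forall z, Omega z -> f z = h z) -> jet f m c -> jet h m c.
Proof.
move=> fh jf; apply: (jet_near _ (erefl c) jf) => w Ow.
have nf : \forall z \near (a + w *: a), f z = h z.
  exact: (filterS fh (open_nbhs_nbhs (conj oO Ow))).
exact: (near_eq_derive a nf).
Qed.

Lemma jet_lin f h m c d k : holomorphic Omega f -> holomorphic Omega h ->
  jet f m c -> jet h m d -> jet (fun z => k * f z + h z) m (k * c + d).
Proof.
move=> hf hh jf jh.
have ck : (fun _ : R[i] => k) @ (0 : R[i]) --> k by exact: (@cvg_cst _ _ _ _ (nbhs_filter (0 : R[i]))).
have [rho rho0 Hr] := ray_near.
apply: (eq_leading rho0) (leadingD (leading_mul jf ck) jh) => w /Hr Ow.
have df := @diff_derivable _ _ _ _ _ a (hf _ Ow).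
have dh := @diff_derivable _ _ _ _ _ a (hh _ Ow).
pose z := a + w *: a.
have E : 'D_a (fun z => k * f z + h z) z = k * 'D_a f z + 'D_a h z.
  have E1 : 'D_a (k \*: f + h) z = _ := deriveD (@derivableZ _ _ _ _ k _ _ df) dh.
  by rewrite -[k * _](deriveZ k df).
exact: (esym E).
Qed.

Lemma jetZ f m c k : holomorphic Omega f -> jet f m c -> jet (fun z => k * f z) m (k * c).
Proof.
move=> hf jf; have h0 : holomorphic Omega (fun=> 0 : R[i]).
  by move=> z _; exact: (@differentiable_cst _ _ _ (0 : R[i]) z).
have j0 : jet (fun=> 0) m 0.
  have := jet_lin (-1) hf hf jf jf; rewrite mulN1r addNr.
  by apply: eq_jet => z _; rewrite mulN1r addNr.
have := jet_lin k hf h0 jf j0; rewrite addr0.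
by apply: eq_jet => z _; rewrite addr0.
Qed.

Lemma derive_affine f (b z v : Cn) (r : R[i]) :
  'D_v (fun z => f (b + r *: z)) z = 'D_(r *: v) f (b + r *: z).
Proof.
apply: (congr1 (fun F : R[i] -> R[i] => lim (F @ (0 : R[i])^'))); apply/funext => t /=.
by congr (_ *: (f _ - _)); rewrite scalerDr !scalerA addrCA mulrC.
Qed.

Lemma holomorphic_affine f (b : Cn) (r : R[i]) (U : set Cn) : holomorphic Omega f ->
  (forall z, U z -> Omega (b + r *: z)) -> holomorphic U (fun z => f (b + r *: z)).
Proof.
move=> hf UO z Uz.
have dl : differentiable (fun z : Cn => b + r *: z) z.
  have d1 : differentiable (fun z : Cn => r *: z) z by case: (is_diff_scaler r z).
  exact: (differentiableD (@differentiable_cst _ _ _ b z) d1).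
exact: (differentiable_comp dl (hf _ (UO z Uz))).
Qed.

(** The chain rule gives one factor r, and the substitution of r w in w^m the
    others. *)
Lemma jet_dilation f m c (r : R[i]) : r != 0 -> holomorphic Omega f ->
  (forall z, Omega z -> Omega ((1 - r) *: a + r *: z)) ->
  jet f m c -> jet (fun z => f ((1 - r) *: a + r *: z)) m (r ^+ m.+1 * c).
Proof.
move=> r0 hf Or jf.
have ck : (fun _ : R[i] => r) @ (0 : R[i]) --> r by exact: (@cvg_cst _ _ _ _ (nbhs_filter (0 : R[i]))).
have [rho rho0 Hr] := ray_near.
have := leading_mul (leading_scale r0 jf) ck.
rewrite (_ : r * (c * r ^+ m) = r ^+ m.+1 * c); last by rewrite exprS; ring.
apply: (eq_leading rho0) => w /Hr Ow; rewrite derive_affine (derive_dirZ _ _ (hf _ (Or _ Ow))).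
congr (_ * 'D_a f _); rewrite scalerDr addrA -scalerDl subrK scale1r.
by rewrite scalerA.
Qed.

End Jets.

Section JetBounds.
Context (R : realType) (n : nat) (Omega : set 'rV[R[i]]_n).
Context (oO : open Omega) (bO : bounded_set Omega).
Context (a : 'rV[R[i]]_n) (Oa : Omega a).
Local Notation Cn := 'rV[R[i]]_n.
Implicit Types (f h : Cn -> R[i]) (c d w : R[i]) (m : nat).
Local Notation jet := (jet a).
Local Notation sqnorm := (sqnorm Omega).
Local Notation bergman := (bergman Omega).

(** On the line through a, R(C_g f) = g R f, and the factor 1 + w between R and
    the derivative in the direction a cancels: C_g acts on leading terms as
    multiplication by g(a). *)
Lemma jet_Cop f g F m c : convex Omega -> Omega 0 -> holomorphic Omega f ->
  holomorphic Omega g -> holomorphic Omega F -> (forall v, Omega v -> F v = Cop g f v) ->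
  jet f m c -> jet F m (g a * c).
Proof.
move=> cO O0 hf hg hF FE jf; have [rho rho0 Hr] := ray_near oO Oa.
have Oa0 : Omega (a + (0 : R[i]) *: a) by rewrite scale0r addr0.
have cg : g (a + w *: a) @[w --> (0 : R[i])] --> g a.
  have d0 := cdiff_differentiable (cdiff_slice (hg _ Oa0)).
  have E : g a = g (a + (0 : R[i]) *: a) by rewrite scale0r addr0.
  rewrite [X in _ --> X]E; exact: (differentiable_continuous d0).
have m0 : 0 < Num.min rho 1 by rewrite lt_min rho0 ltr01.
apply: (eq_leading m0) (leading_mul jf cg) => w; rewrite lt_min => /andP[/Hr Ow w1].
have aw : a + w *: a = (1 + w) *: a by rewrite scalerDl scale1r.
have w0 : 1 + w != 0.
  apply/eqP => /eqP; rewrite addrC addr_eq0 => /eqP wE.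
  by move: w1; rewrite wE normcNE [1](_ : _ = 1%:C)// normc_real normr1 ltxx.
have := Cop_derive oO cO O0 hf hg Ow (hF _ Ow) FE.
rewrite {2 4}aw (derive_dirZ _ _ (hF _ Ow)) (derive_dirZ _ _ (hf _ Ow)).
by rewrite -mulrA => /(mulfI w0) ->; rewrite mulrC.
Qed.

(** Cauchy's inequality on a square of the line through a, where the values of f
    are bounded by the norm. *)
Lemma jet_bound m : exists2 C : R, 0 <= C & forall f c, bergman f -> sqnorm f <= 1 ->
  jet f m c -> normc c <= C.
Proof.
have [rho0 rho00 [M M0 HM]] := point_bound oO bO Oa.
have [K0 HK] := bounded_setE bO.
pose K := Num.max K0 1; have K1 : 1 <= K by rewrite le_max lexx orbT.
have Kp : 0 < K := lt_le_trans ltr01 K1.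
have aK k : normc (a 0 k) <= K by apply: (le_trans (HK a Oa k)); rewrite le_max lexx.
pose rho := rho0 / (2 * K).
have rhop : 0 < rho by rewrite divr_gt0// mulr_gt0.
exists (m.+1%:R * (8 * M / rho ^+ m.+1)).
  by rewrite mulr_ge0// divr_ge0 ?mulr_ge0// exprn_ge0// ltW.
move=> f c bf f1 jf; have [hf _] := bf.
have f1E : (\int[volume R n]_(x in @toCn R n @^-1` Omega)
    (normc (f (toCn x)) ^+ 2)%:E <= 1)%E.
  by rewrite [X in (X <= _)%E](esqnormE bf) lee_fin.
have near_a w : in_square rho w -> Omega (a + w *: a) /\ normc (f (a + w *: a)) <= M.
  move=> ws; apply: (HM f _ hf _ f1E) => k; rewrite !mxE addrAC subrr add0r normcM.
  have h1 := in_square_normc ws.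
  apply: (le_trans (ler_pM (normc_ge0 _) (normc_ge0 _) h1 (aK k))).
  by rewrite mulrAC mulrC divfK ?lexx // gt_eqF// mulr_gt0.
have dpsi w : in_square rho w -> cdiff (fun u => f (a + u *: a)) w ('D_a f (a + w *: a)).
  by move=> /near_a[Ow _]; exact: (cdiff_slice (hf _ Ow)).
have lpsi : leading c m ('D_1 (fun u : R[i] => f (a + u *: a))).
  apply: (eq_leading rhop) jf => w wr; apply/esym; apply: cdiff_derive.
  by apply: dpsi; exact: (normc_in_square (ltW wr)).
apply: (cauchy_ineq_derive rhop _ _ lpsi) => w ws.
  exact: (cdiff_differentiable (dpsi w ws)).
by have [] := near_a w ws.
Qed.

Lemma bergman_bounded f M : holomorphic Omega f ->
  (forall z, Omega z -> normc (f z) <= M) -> bergman f.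
Proof.
move=> hf fM; split=> //.
have mO := measurable_OmegaR oO.
apply: (@le_lt_trans _ _ (\int[volume R n]_(x in @toCn R n @^-1` Omega) (M ^+ 2)%:E)%E).
  apply: ge0_le_integral => //.
  - by move=> x _; rewrite lee_fin exprn_ge0// normc_ge0.
  - exact: (measurable_sq_normc oO hf).
  - move=> x Ox; rewrite lee_fin; have f0 := normc_ge0 (f (toCn x)).
    by rewrite ler_sqr ?nnegrE// ?fM// (le_trans f0)// fM.
rewrite integral_cst// lte_mul_pinfty ?lee_fin ?sqr_ge0//.
exact: OmegaR_fin_volume.
Qed.

(** A multiple of (L - 1)^(m+1), where the linear form L takes the value 1 at a. *)
Lemma jet_exists m : a != 0 -> exists2 f, bergman f & jet f m 1.
Proof.
move=> /rV0Pn[k ak].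
pose L (z : Cn) := (a 0 k)^-1 * z 0 k - 1.
pose f (z : Cn) := 1 / m.+1%:R * L z ^+ m.+1.
have hL z : differentiable L z.
  have dz := @differentiable_coord R[i] _ _ z 0 k.
  exact: (differentiableB (differentiableZ (a 0 k)^-1 dz) (@differentiable_cst _ _ _ (1 : R[i]) z)).
have hf : holomorphic Omega f.
  by move=> z _; exact: (differentiableZ (1 / m.+1%:R) (diff_exp m.+1 (hL z))).
have LE w : L (a + w *: a) = w.
  by rewrite /L !mxE; field.
have [K HK] := bounded_setE bO.
have [B HB] : exists B : R, forall z, Omega z -> normc (L z) <= B.
  exists (normc (a 0 k)^-1 * K + 1) => z Oz; apply: (le_trans (normcB _ _)).
  apply: lerD; last by rewrite [1](_ : _ = 1%:C)// normc_real normr1.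
  by rewrite normcM ler_wpM2l ?normc_ge0// HK.
exists f.
  apply: (@bergman_bounded _ (normc (1 / m.+1%:R) * B ^+ m.+1)) => // z Oz.
  rewrite normcM normcX ler_wpM2l ?normc_ge0//.
  have L0 := normc_ge0 (L z); rewrite lerXn2r ?nnegrE ?HB//.
  exact: le_trans L0 (HB z Oz).
have [rho rho0 Hr] := ray_near oO Oa.
apply: (eq_leading rho0) (leading_monomial 1 m) => w /Hr Ow.
have E := cdiff_derive (cdiff_slice (hf _ Ow)).
rewrite -E (_ : (fun u => f (a + u *: a)) = fun u => 1 / m.+1%:R * u ^+ m.+1); last first.
  by apply/funext => u; rewrite /f LE.
by have [_ ->] := is_derive_monomial 1 w m.
Qed.

(** A near-minimizer of the norm among the functions with leading term w^m,
    rescaled to norm 1. The infimum of these norms is positive by jet_bound. *)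
Lemma extremal m : a != 0 -> exists f, [/\ bergman f, sqnorm f = 1 &
  exists kappa : R, [/\ 0 < kappa, jet f m kappa%:C &
    forall h c, bergman h -> jet h m c ->
      normc c ^+ 2 <= 2 * kappa ^+ 2 * sqnorm h]].
Proof.
move=> a0; have [C C0 HC] := jet_bound m; have [f0 bf0 jf0] := jet_exists m a0.
pose S := [set x : R | exists2 h, bergman h & jet h m 1 /\ sqnorm h = x].
have S0 : S (sqnorm f0) by exists f0.
have C1 : 0 < C + 1 by rewrite ltr_wpDl.
(* below this bound (C + 1) h would contradict the choice of C *)
have lbS : lbound S ((C + 1) ^- 2).
  move=> _ [h bh [jh <-]]; rewrite leNgt; apply/negP => hlt.
  have small : sqnorm (fun z => (C + 1)%:C * h z) <= 1.
    rewrite (sqnormZ oO bO _ bh) normc_real (gtr0_norm C1).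
    by rewrite mulrC -ler_pdivlMr ?exprn_gt0// div1r ltW.
  have := HC _ _ (bergmanZ oO bO (C + 1)%:C bh) small (jetZ oO Oa (C + 1)%:C bh.1 jh).
  by rewrite mulr1 normc_real (gtr0_norm C1) leNgt ltrDl ltr01.
have infS : has_inf S by split; [exists (sqnorm f0)|exists ((C + 1) ^- 2)].
pose D := inf S.
have D0 : 0 < D.
  apply: (@lt_le_trans _ _ ((C + 1) ^- 2)); first by rewrite invr_gt0 exprn_gt0.
  by apply: lb_le_inf => //; exists (sqnorm f0).
have [_ [f bf [jf <-]] fD] := inf_adherent D0 infS.
have Df : D <= sqnorm f by apply: ge_inf; [exact: infS.2|exists f].
have f0' : 0 < sqnorm f := lt_le_trans D0 Df.
pose kappa := (Num.sqrt (sqnorm f))^-1.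
have k0 : 0 < kappa by rewrite invr_gt0 sqrtr_gt0.
have k2 : kappa ^+ 2 = (sqnorm f)^-1 by rewrite exprVn sqr_sqrtr// ltW.
exists (fun z => kappa%:C * f z); split.
- exact: (bergmanZ oO bO kappa%:C bf).
- by rewrite (sqnormZ oO bO _ bf) normc_real (gtr0_norm k0) k2 mulVf// gt_eqF.
have jk := jetZ oO Oa kappa%:C bf.1 jf; rewrite mulr1 in jk.
exists kappa; split; [exact: k0|exact: jk|move=> h c bh jh].
have [->|c0] := eqVneq c 0.
  by rewrite normc0 expr0n /= mulr_ge0 ?sqnorm_ge0// mulr_ge0// sqr_ge0.
have nc0 : 0 < normc c by rewrite lt_def normc_eq0 c0 normc_ge0.
have Dh : D <= sqnorm (fun z => c^-1 * h z).
  apply: ge_inf; first exact: infS.2.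
  have jc := jetZ oO Oa c^-1 bh.1 jh; rewrite mulVf// in jc.
  by exists (fun z => c^-1 * h z); [exact: (bergmanZ oO bO c^-1 bh)|split; [exact: jc|]].
have Dh' : normc c ^+ 2 * D <= sqnorm h.
  move: Dh; rewrite (sqnormZ oO bO _ bh) normcV exprVn mulrC.
  by rewrite ler_pdivlMr ?exprn_gt0// mulrC.
rewrite k2 mulrAC ler_pdivlMr//.
apply: (@le_trans _ _ (normc c ^+ 2 * (2 * D))).
  by rewrite ler_wpM2l ?sqr_ge0// mulrDl mul1r ltW.
by rewrite mulrCA ler_wpM2l.
Qed.

End JetBounds.

(** * Test functions *)

(** Values rounded down to multiples of eps take finitely many values. *)
Lemma pigeonhole (R : realType) (I : finType) (x : nat -> I -> R) (M eps : R) :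
  0 < eps -> (forall m i, `|x m i| <= M) ->
  exists m m', (m < m')%N /\ forall i, `|x m i - x m' i| <= eps.
Proof.
move=> e0 xM; pose y m i := (x m i + M) / eps.
have y0 m i : 0 <= y m i.
  by rewrite divr_ge0 ?(ltW e0)// -lerBlDr sub0r; have := xM m i; rewrite ler_norml => /andP[].
pose B := Num.trunc (2 * M / eps).
have yB m i : (Num.trunc (y m i) < B.+1)%N.
  rewrite ltnS; apply: le_truncn; rewrite ler_pM2r ?invr_gt0// mulr_natl mulr2n lerD2r.
  by have := xM m i; rewrite ler_norml => /andP[].
pose code m : {ffun I -> 'I_B.+1} := [ffun i => Ordinal (yB m i)].
pose T : finType := {ffun I -> 'I_B.+1}.
have /injectivePn[m [m' mm cE]] : ~~ injectiveb (fun m : 'I_(#|T|.+1) => code m : T).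
  by apply/negP => /injectiveP /leq_card; rewrite card_ord ltnn.
have close i : `|x m i - x m' i| <= eps.
  have /(congr1 val) /= tE := congr1 (fun f : T => f i) cE; rewrite !ffunE /= in tE.
  have /andP[h1 h2] := truncn_itv (y0 m i); have /andP[h3 h4] := truncn_itv (y0 m' i).
  rewrite tE in h1 h2.
  have : `|y m i - y m' i| <= 1.
    rewrite ler_norml; move: h1 h2 h3 h4; rewrite -natr1; move: (_%:R) => N.
    by move=> h1 h2 h3 h4; apply/andP; split; lra.
  rewrite /y -mulrBl normrM normfV (gtr0_norm e0) ler_pdivrMr// mul1r.
  by rewrite opprD addrACA subrr addr0.
case: (ltngtP m m') => [lt|gt|/val_inj E]; last by rewrite E eqxx in mm.
  by exists m, m'.
by exists m', m; split => // i; rewrite distrC.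
Qed.

Lemma bernoulli_ineq (R : realType) (x : R) k : 0 <= x <= 1 -> 1 - k%:R * x <= (1 - x) ^+ k.
Proof.
move=> /andP[x0 x1]; elim: k => [|k IH]; first by rewrite mul0r subr0 expr0.
rewrite exprS; have x1' : 0 <= 1 - x by rewrite subr_ge0.
apply: le_trans (ler_wpM2l x1' IH); rewrite -natr1.
have : 0 <= k%:R * (x * x) by rewrite mulr_ge0// mulr_ge0.
by move: (k%:R) => N; nra.
Qed.

Section Compactness.
Context (R : realType) (n : nat) (Omega : set 'rV[R[i]]_n).
Context (oO : open Omega) (bO : bounded_set Omega) (cO : convex Omega) (O0 : Omega 0).
Context (a : 'rV[R[i]]_n) (Oa : Omega a) (a0 : a != 0).
Local Notation Cn := 'rV[R[i]]_n.
Implicit Types (f h : Cn -> R[i]) (c d w : R[i]) (m : nat).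
Local Notation jet := (jet a).
Local Notation sqnorm := (sqnorm Omega).
Local Notation bergman := (bergman Omega).
Local Notation inner := (inner Omega).

Lemma affine_cvg (b z : Cn) (r : R[i]) : b + r *: w @[w --> z] --> b + r *: z.
Proof.
have c1 : (fun _ : Cn => b) @ z --> b by exact: (@cvg_cst _ _ _ _ (nbhs_filter z)).
exact: (@cvgD _ _ _ _ (nbhs_filter z) _ _ _ _ c1 (@scaler_continuous _ _ r z)).
Qed.

(** A dilation with center a maps the closure of Omega into Omega: for z in the
    closure and w in Omega close to z, the point a + r (z - a) is a convex
    combination of w and of a point close to a. *)
Lemma dilation_near_closure f (r : R) : 0 < r < 1 -> holomorphic Omega f ->
  holomorphic_near_closure Omega (fun z => f ((1 - r)%:C *: a + r%:C *: z)).
Proof.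
move=> /andP[r0 r1] hf; pose phi z := (1 - r)%:C *: a + r%:C *: z.
exists (phi @^-1` Omega); split.
- rewrite openE => z Oz.
  have nO : nbhs (phi z) Omega := open_nbhs_nbhs (conj oO Oz).
  exact: (@affine_cvg ((1 - r)%:C *: a) z r%:C Omega nO).
- move=> z cz; have s0 : 1 - r != 0 by rewrite subr_eq0 gt_eqF.
  pose q := r / (1 - r).
  have nb : nbhs z ((fun w : Cn => (a + q%:C *: z) + (- q%:C) *: w) @^-1` Omega).
    have az : Omega ((a + q%:C *: z) + (- q%:C) *: z) by rewrite scaleNr addrK.
    exact: (@affine_cvg (a + q%:C *: z) z (- q%:C) Omega (open_nbhs_nbhs (conj oO az))).
  have [w [Ow Ow']] := cz _ nb.
  have r01 : 0 <= r <= 1 by rewrite !ltW.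
  have := convexE cO Ow Ow' r01; rewrite /phi /preimage /=; congr (Omega _).
  have qE : (1 - r)%:C * q%:C = r%:C.
    by rewrite -rmorphM /= /q mulrC divfK.
  rewrite !scalerDr !scalerA mulrN qE scaleNr.
  by rewrite addrC subrK.
- by apply: (holomorphic_affine hf).
Qed.

(** Near-extremal functions, dilated so that C_g is given on them by its integral
    formula. The dilation factor r depends on m: with r^(m+1) >= 1/2 the leading
    coefficient can be restored at the cost of a bounded factor in the norm. *)
Lemma test_function : exists2 K : R, 0 < K & forall m, exists p : (Cn -> R[i]) * R,
  [/\ bergman p.1, holomorphic_near_closure Omega p.1, sqnorm p.1 <= K,
      0 < p.2 /\ jet p.1 m p.2%:C &
      forall h c, bergman h -> jet h m c ->
        normc c ^+ 2 <= 2 * p.2 ^+ 2 * sqnorm h].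
Proof.
exists (4 * 2 ^+ (2 * n)); first by rewrite mulr_gt0// exprn_gt0.
move=> m; have [f [bf f1 [kappa [k0 jf ext]]]] := extremal oO bO Oa m a0.
(* by Bernoulli's inequality r^(m+1) >= 1/2 *)
pose r : R := 1 - (2 * m.+1%:R)^-1.
have M0 : 0 < 2 * m.+1%:R :> R by rewrite mulr_gt0// ltr0n.
have M1 : 1 < 2 * m.+1%:R :> R.
  by rewrite -natrM ltr1n mulnS.
have r1 : r < 1 by rewrite /r ltrBlDr ltrDl invr_gt0.
have r0 : 0 < r by rewrite /r subr_gt0 invf_lt1.
have rm : 2^-1 <= r ^+ m.+1.
  pose t : R := (2 * m.+1%:R)^-1; have x01 : 0 <= t <= 1.
    by apply/andP; split; [rewrite invr_ge0 ltW|rewrite invf_le1 ?ltW].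
  apply: le_trans (bernoulli_ineq m.+1 x01).
  rewrite /t invfM mulrCA mulfV ?pnatr_eq0// mulr1; lra.
have r2 : r^-1 <= 2.
  rewrite -[2]invrK lef_pV2 ?posrE ?invr_gt0//; apply: (le_trans rm).
  by rewrite exprS ler_piMr ?(ltW r0)// exprn_ile1// ltW.
have rC0 : r%:C != 0 :> R[i] by rewrite fmorph_eq0 gt_eqF.
pose k := r ^- m.+1.
have k2 : k <= 2 by rewrite /k -[2]invrK lef_pV2 ?posrE ?invr_gt0// exprn_gt0.
have kp : 0 < k by rewrite invr_gt0 exprn_gt0.
pose F z := k%:C * f z.
have bF : bergman F := bergmanZ oO bO k%:C bf.
have jF : jet F m (k%:C * kappa%:C) := jetZ oO Oa k%:C bf.1 jf.
pose b := (1 - r)%:C *: a.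
have Or z : Omega z -> Omega (b + r%:C *: z).
  move=> Oz; have r01 : 0 <= r <= 1 by rewrite !ltW.
  by rewrite addrC; exact: (convexE cO Oz Oa r01).
pose W z := F (b + r%:C *: z).
have hW : holomorphic Omega W := holomorphic_affine bF.1 Or.
have dW : (esqnorm Omega W <= (`|r|^-1 ^+ (2 * n))%:E * esqnorm Omega F)%E.
  exact: (dilation_integral oO (lt0r_neq0 r0) bF.1 Or hW).
have bW : bergman W.
  split=> //; apply: (le_lt_trans dW); rewrite (esqnormE bF) -EFinM; exact: ltry.
have r01' : 0 < r < 1 by rewrite r0.
exists (W, kappa); split.
- exact: bW.
- exact: (dilation_near_closure r01' bF.1).
- have := dW; rewrite (esqnormE bW) (esqnormE bF) -EFinM lee_fin.
  move/le_trans; apply; rewrite (sqnormZ oO bO _ bf) f1 mulr1 normc_real (gtr0_norm kp) (gtr0_norm r0).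
  have kk : k ^+ 2 <= 4 by have := k2; have := kp; move: (k) => x x0 x2; nra.
  have rr : r^-1 ^+ (2 * n) <= 2 ^+ (2 * n) by rewrite lerXn2r ?nnegrE ?invr_ge0 ?(ltW r0).
  have ri : 0 <= r^-1 by rewrite invr_ge0 ltW.
  rewrite mulrC; exact: (ler_pM (exprn_ge0 2 (ltW kp)) (exprn_ge0 _ ri) kk rr).
- split; first exact: k0.
  have bE : b = (1 - r%:C) *: a by rewrite /b rmorphB.
  have Or' z : Omega z -> Omega ((1 - r%:C) *: a + r%:C *: z) by move=> /Or; rewrite bE.
  have := jet_dilation oO Oa rC0 bF.1 Or' jF.
  have -> : r%:C ^+ m.+1 * (k%:C * kappa%:C) = kappa%:C.
    by rewrite mulrA -rmorphXn -rmorphM /= /k mulfV ?mul1r// expf_neq0// gt_eqF.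
  have FW z : Omega z -> F ((1 - r%:C) *: a + r%:C *: z) = W z by rewrite /W bE.
  exact: (eq_jet oO Oa FW).
- exact: ext.
Qed.

End Compactness.

(** * The vanishing of g *)

Section Forward.
Context (R : realType) (n : nat) (Omega : set 'rV[R[i]]_n).
Context (oO : open Omega) (bO : bounded_set Omega) (cO : convex Omega) (O0 : Omega 0).
Local Notation Cn := 'rV[R[i]]_n.
Implicit Types (f h g : Cn -> R[i]) (c d w : R[i]) (m : nat).
Local Notation sqnorm := (sqnorm Omega).
Local Notation bergman := (bergman Omega).
Local Notation inner := (inner Omega).

(** The direction a of the leading terms has to be nonzero. *)
Lemma nonzero_point g z : (0 < n)%N -> holomorphic Omega g -> Omega z -> g z != 0 ->
  exists a, [/\ Omega a, a != 0 & g a != 0].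
Proof.
move=> n0 hg Oz gz; have [z0|z0] := eqVneq z 0; last by exists z.
rewrite {}z0 in Oz gz; pose v : Cn := delta_mx 0 (Ordinal n0).
have O1 : Omega (0 + (0 : R[i]) *: v) by rewrite scale0r addr0.
have /nbhs_normcP[r r0 Hr] := slice_near oO O1.
have cg := differentiable_continuous (cdiff_differentiable (cdiff_slice (hg _ O1))).
have g0 : 0 < normc (g 0) by rewrite lt_def normc_eq0 gz normc_ge0.
have := cvg_normc (nbhs_filter (0 : R[i])) cg.
rewrite scale0r addr0 => /(_ _ (lt_nbhsr g0)) /nbhs_normcP[s s0 Hs].
pose t := Num.min r s / 2.
have t0 : 0 < t by rewrite divr_gt0// lt_min r0.
have tm : t < Num.min r s.
  by rewrite /t ltr_pdivrMr// ltr_pMr ?lt_min ?r0// ltr1n.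
have nt : `|0 - t%:C| = t%:C by rewrite sub0r normrN normr_normc normc_real gtr0_norm.
move: tm; rewrite lt_min => /andP[tr ts].
exists (0 + t%:C *: v); split.
- by apply: Hr; rewrite nt ltcR.
- rewrite add0r scaler_eq0 negb_or fmorph_eq0 gt_eqF//=.
  by apply/eqP => /rowP/(_ (Ordinal n0)); rewrite !mxE !eqxx => /eqP; rewrite oner_eq0.
- have := Hs t%:C; rewrite nt ltcR => /(_ ts) /=.
  by apply: contraTneq => ->; rewrite normc0 ltxx.
Qed.

Lemma coefficient_bound (sigma : nat -> R) (e : nat -> Cn -> R[i]) f k :
  (forall j, bergman (e j)) -> orthonormal_on Omega sigma e -> bergman f ->
  sigma k != 0 -> normc (inner f (e k)) ^+ 2 <= sqnorm f.
Proof.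
move=> be oe bf sk.
pose c j := if sigma j == 0 then 0 else inner f (e j).
have c0 j : sigma j = 0 -> c j = 0 by move=> sj; rewrite /c sj eqxx.
have cf j : sigma j != 0 -> c j = inner f (e j) by rewrite /c => /negbTE->.
have := bessel_system oO bO be oe c0 k.+1 bf cf.
apply: le_trans; rewrite big_ord_recr /= (cf k sk) lerDr sumr_ge0// => j _.
exact: sqr_ge0.
Qed.

(** Suppose g(a) <> 0. The difference F of two test functions of different orders
    m < m' has the leading term of the first one, so C_g F has norm at least
    |g(a)| up to a constant. But some such F has small coefficients on the first N
    vectors e_k, by the pigeonhole principle, and sigma_N is small, so that C_g F
    is small. *)
Lemma Cop_in_schatten_eq0 g (s : R) z : (0 < n)%N -> holomorphic Omega g ->
  Cop_in_schatten Omega s g -> Omega z -> g z = 0.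
Proof.
move=> n0 hg [T [[bT linT _] ext] [sigma [e [u [dec _]]]]] Oz.
apply/eqP; apply: contraT => gz.
have [a [Oa a0 ga]] := nonzero_point n0 hg Oz gz.
have [K Kp /choice[P HP]] := test_function oO bO cO Oa a0.
pose W m := (P m).1; pose kappa m := (P m).2.
have bW m : bergman (W m) by have [] := HP m.
have KW m : sqnorm (W m) <= K by have [] := HP m.
have [[s0 sm] slim beu [oe ou] _] := dec.
have be k := (beu k).1.
pose delta := normc (g a) ^+ 2 / 2.
have delta0 : 0 < delta by rewrite divr_gt0// exprn_gt0// lt_def normc_eq0 ga normc_ge0.
(* F will have squared norm at most 4 K. In the bound of the norm of T F, this N
   makes the tail at most delta / 4, and eps below does so for the head. *)
have [N sN] : exists N, sigma N ^+ 2 * (8 * K) <= delta / 4.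
  pose eps := Num.min 1 (delta / 4 / (8 * K)).
  have K8 : 0 < 8 * K by rewrite mulr_gt0.
  have eps0 : 0 < eps by rewrite lt_min ltr01 divr_gt0// divr_gt0.
  have /cvgrPdist_le /(_ _ eps0) [N _ HN] := slim.
  exists N; have := HN N (leqnn N); rewrite /= sub0r normrN ger0_norm// le_min => /andP[h1 h2].
  rewrite -ler_pdivlMr//; apply: le_trans h2.
  by rewrite expr2 ler_piMl.
pose A := \sum_(k < N) sigma k ^+ 2.
have A0 : 0 <= A by rewrite sumr_ge0// => k _; rewrite sqr_ge0.
pose eps := Num.min 1 (delta / (16 * (A + 1))).
have A1 : 0 < A + 1 by rewrite ltr_wpDl.
have eps0 : 0 < eps by rewrite lt_min ltr01 divr_gt0// mulr_gt0.
have epsA : 4 * A * eps ^+ 2 <= delta / 4.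
  have e1 : eps <= 1 by rewrite ge_min lexx.
  have e2 : eps * (16 * (A + 1)) <= delta.
    by rewrite -ler_pdivlMr ?mulr_gt0// ge_min lexx orbT.
  move: (eps) (A) (delta) eps0 e1 e2 A0 => x y d x0 x1 xd y0.
  have := mulr_ge0 y0 (mulr_ge0 (ltW x0) (_ : 0 <= 1 - x)); rewrite subr_ge0 => /(_ x1).
  nra.
pose x m (i : 'I_N * bool) : R := if sigma i.1 == 0 then 0 else
  if i.2 then complex.Re (inner (W m) (e i.1)) else complex.Im (inner (W m) (e i.1)).
have xK m i : `|x m i| <= K + 1.
  rewrite /x; case: eqVneq => [_|sk]; first by rewrite normr0 addr_ge0// ltW.
  have h := le_trans (coefficient_bound be oe (bW m) sk) (KW m).
  have h1 : normc (inner (W m) (e i.1)) <= K + 1.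
    have := normc_ge0 (inner (W m) (e i.1)); move: (normc _) h => y yK y0.
    by rewrite leNgt; apply/negP => yl; move: (K) Kp yK yl => k k0 yK yl; nra.
  by case: i.2; apply: le_trans h1; [exact: normc_Re|exact: normc_Im].
have [m [m' [mm close]]] := pigeonhole eps0 xK.
pose F z := -1 * W m' z + W m z.
have bF : bergman F := bergman_lin oO (-1) (bW m') (bW m).
have FK : sqnorm F <= 4 * K.
  have := sqnormD oO (bergmanZ oO bO (-1) (bW m')) (bW m).
  rewrite (sqnormZ oO bO (-1) (bW m')) normcNE normc1 expr1n mul1r -/F => h.
  apply: (le_trans h); have h1 := KW m; have h2 := KW m'.
  by move: (sqnorm _) (sqnorm _) h1 h2 => y1 y2 h1 h2; lra.
have jT k j c : jet a (W k) j c -> jet a (T (W k)) j (g a * c).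
  move=> jW; have [_ near_k _ _ _] := HP k.
  apply: (jet_Cop oO Oa cO O0 (bW k).1 hg (bT _ (bW k)).1 _ jW) => v Ov.
  by apply: ext => //; exact/mem_set.
have [_ _ _ [k0 jm] opt] := HP m.
have [_ _ _ [_ jm'] _] := HP m'.
have jF : jet a (T F) m (g a * (kappa m)%:C).
  have j0 : jet a (W m') m 0 := leading_lt mm jm'.
  have := jet_lin oO Oa (-1) (bT _ (bW m')).1 (bT _ (bW m)).1 (jT m' m _ j0) (jT m m _ jm).
  rewrite mulr0 mulr0 add0r; apply: (eq_jet oO Oa) => v Ov.
  by rewrite (linT (-1) _ _ (bW m') (bW m) v (mem_set Ov)).
have low : delta <= sqnorm (T F).
  have k0' : 0 < kappa m := k0.
  have := opt _ _ (bT _ bF) jF; rewrite normcM normc_real (gtr0_norm k0') exprMn => h.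
  have {}h : normc (g a) ^+ 2 * kappa m ^+ 2 <= 2 * kappa m ^+ 2 * sqnorm (T F) := h.
  rewrite -(ler_pM2r (exprn_gt0 2 k0')) /delta; move: h.
  move: (sqnorm (T F)) (kappa m ^+ 2) (normc (g a) ^+ 2) => x1 x2 x3 h.
  nra.
have := singular_bound oO bO N dec bT bF.
have up : \sum_(k < N) sigma k ^+ 2 * normc (inner F (e k)) ^+ 2 <= 2 * A * eps ^+ 2.
  rewrite mulrAC [2 * _ * _]mulrC /A mulr_suml; apply: ler_sum => k _.
  have [sk|sk] := eqVneq (sigma k) 0; first by rewrite sk expr0n /= !mul0r.
  apply: ler_wpM2l; first exact: sqr_ge0.
  rewrite normc_sqrE (inner_lin oO (-1) (bW m') (bW m) (be k)).
  have := close (k, true); have := close (k, false); rewrite /x /= (negbTE sk).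
  case: (inner (W m) (e k)) => y1 y2; case: (inner (W m') (e k)) => z1 z2 /=.
  have sq (y : R) : `|y| <= eps -> y ^+ 2 <= eps ^+ 2.
    by move=> h; rewrite -(real_normK (num_real y)) ler_sqr ?nnegrE// ltW.
  move=> /sq h2 /sq h1; move: h1 h2; clear; nra.
have s2 := sqr_ge0 (sigma N).
have up2 : sigma N ^+ 2 * sqnorm F <= sigma N ^+ 2 * (4 * K) by exact: ler_wpM2l.
move: up up2 low sN epsA delta0.
move: (sqnorm (T F)) (sqnorm F) (\sum_(k < N) _) (sigma N ^+ 2) => tf f S q; nra.
Qed.

End Forward.

(** * The case g = 0, and the equivalence *)

Section Backward.
Context (R : realType) (n : nat) (Omega : set 'rV[R[i]]_n).
Context (oO : open Omega) (bO : bounded_set Omega) (cO : convex Omega) (O0 : Omega 0).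
Local Notation Cn := 'rV[R[i]]_n.
Implicit Types (f g : Cn -> R[i]) (z : Cn).

Lemma L2norm0 f : (forall z, Omega z -> f z = 0) -> L2norm Omega f = 0.
Proof.
move=> f0; have E : L2norm Omega f ^+ 2 = 0.
  rewrite L2norm_sqr (@eq_sqnorm R n Omega f (fun=> 0) f0).
  rewrite -(mul0r (sqnorm Omega (fun=> 0))) -[X in X * _](_ : normc (0 : R[i]) ^+ 2 = 0); last first.
    by rewrite normc0 expr0n.
  rewrite -(sqnormZ oO bO 0 (bergman_cst oO bO 0)).
  by apply: eq_sqnorm => z _; rewrite mul0r.
by apply/eqP; rewrite -sqrf_eq0 E.
Qed.

Lemma Cop_eq0 g f z : (forall v, Omega v -> g v = 0) -> Omega z -> Cop g f z = 0.
Proof.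
move=> g0 Oz; have h0 (t : R) : t \in `]0, 1]%classic ->
    radial f (t%:C *: z) * g (t%:C *: z) / t%:C = 0.
  rewrite inE /= in_itv /= => /andP[t0 t1].
  have t01 : 0 <= t <= 1 by rewrite (ltW t0).
  have := convexE cO Oz O0 t01; rewrite scaler0 addr0 => /g0 ->.
  by rewrite mulr0 mul0r.
pose I : set (measurableTypeR R) := `]0, 1]%classic.
have int0 (F : R -> R) : (forall t, t \in I -> F t = 0) ->
    \int[@lebesgue_measure R]_(t in I) F t = 0.
  move=> F0; rewrite (eq_Rintegral _ F0) Rintegral_cst ?mul0r//.
  exact: measurable_itv.
by congr Complex; apply: int0 => t /h0 ->.
Qed.

Lemma Cop_in_schatten0 g (s : R) : s != 0 -> (forall z, Omega z -> g z = 0) ->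
  Cop_in_schatten Omega s g.
Proof.
move=> s0 g0; have b0 := bergman_cst oO bO 0.
exists (fun _ _ => 0); first split.
- split=> [f _|c f h _ _ z _|]; first exact: b0.
    by rewrite mulr0 addr0.
  by exists 0 => f _; rewrite mul0r L2norm0.
- by move=> f _ z /set_mem Oz; rewrite Cop_eq0.
exists (fun=> 0), (fun _ _ => 0), (fun _ _ => 0); split.
  split.
  - by split=> [k|j k _]; exact: lexx.
  - exact: cvg_cst.
  - by move=> k; split; exact: b0.
  - by split=> j k; rewrite eqxx.
  - move=> f _; rewrite (_ : (fun N => _) = fun=> 0); first exact: cvg_cst.
    apply/funext => N; apply: L2norm0 => z _.
    by rewrite big1 ?subr0// => k _; rewrite !mulr0.
by rewrite eseries0 ?ltry// => k _ _; rewrite powR0.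
Qed.

End Backward.

Theorem corollary4p9 (R : realType) (n : nat) (n_ge1 : (0 < n)%N)
    (Omega : set 'rV[R[i]]_n) (Omega_open : open Omega)
    (Omega_bounded : bounded_set Omega) (Omega_convex : convex Omega)
    (Omega_smooth_finite_type : smooth_finite_type Omega)
    (Omega0 : Omega 0)
    (g : 'rV[R[i]]_n -> R[i]) (g_hol : holomorphic Omega g)
    (s : R) (s_gt0 : 0 < s) :
  Cop_in_schatten Omega s g <-> (forall z, Omega z -> g z = 0).
Proof.
split=> [Cg z Oz|g0].
  exact: (Cop_in_schatten_eq0 Omega_open Omega_bounded Omega_convex Omega0 n_ge1 g_hol Cg Oz).
exact: (Cop_in_schatten0 Omega_open Omega_bounded Omega_convex Omega0 (lt0r_neq0 s_gt0) g0).
Qed.
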